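(* Let $X=\{X_t,t\ge0\}$ be a real-valued càdlàg centered Lévy process with moments of all orders, Gaussian variance $\sigma^2$ ($\sigma\geq 0$) and Lévy measure $\nu$. Fix $n\ge1$ such that the Teugels polynomial of order $n$, $p_n(x)$, does not have a zero root, and let $a_1,\ldots,a_n$ be the roots of $p_n(x)$, $\mathbf{a}=(a_1,\ldots,a_n)$. Let $t\geq 0$. If $\sigma=0$, then $$P_{n+1}(X_t^{(1)},\ldots,X_t^{(n+1)})=\frac{(-1)^n}{n+1}H_t^{(n+1)}+J_{n+1}^{\mathbf{a}}(X_t^{(1)},\ldots,X_t^{(n)})+\frac{(-1)^n}{n+1}C_nt,$$ where $$C_n=\int_{\mathbb{R}}x\,(p_n(x)-p_n(0))\,\nu(dx),$$ and $J_{n+1}^{\mathbf{a}}(X_t^{(1)},\ldots,X_t^{(n)})+\frac{(-1)^n}{n+1}C_nt$ is orthogonal (in $L^2(\Omega)$) to $P_1(X_t^{(1)}),\ldots,P_n(X_t^{(1)},\ldots,X_t^{(n)})$. If $\sigma>0$, then $$P_{n+2}(X_t^{(1)},\ldots,X_t^{(n+2)})=\frac{(-1)^{n+1}}{n+2}\big(H_t^{(n+2)}+\lambda_nH_t^{(n+1)}+\lambda_{n-1}H_t^{(n)}\big)+J_{n+2}^{\sigma,\mathbf{a}}(X_t^{(1)},\ldots,X_t^{(n+1)})+\frac{(-1)^{n+1}}{n+2}D_{n+1}t,$$ where $\lambda_n,\lambda_{n-1}$ are the real numbers such that $p_{n+1}^\sigma(x)=xp_n(x)-\lambda_np_n^\sigma(x)-\lambda_{n-1}p_{n-1}^\sigma(x)$,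 and $$D_{n+1}=\sigma^2p_n(0)+\int_{\mathbb{R}}x^2p_n(x)\,\nu(dx).$$ Moreover, $J_{n+2}^{\sigma,\mathbf{a}}(X_t^{(1)},\ldots,X_t^{(n+1)})+\frac{(-1)^{n+1}}{n+2}D_{n+1}t$ is orthogonal (in $L^2(\Omega)$) to $P_1(X_t^{(1)}),\ldots,P_{n-1}(X_t^{(1)},\ldots,X_t^{(n-1)})$.
   Context: Variations: $X_t^{(1)}=X_t$, $X_t^{(2)}=[X,X]_t$, $X_t^{(j)}=\sum_{0<s\le t}(\Delta X_s)^j$ for $j\ge3$. Kailath–Segall polynomials: $P_0=1$, $P_m(x_1,\ldots,x_m)=\frac1m\sum_{j=1}^m(-1)^{j+1}x_jP_{m-j}(x_1,\ldots,x_{m-j})$. Teugels polynomials: $p_m(x)$ (resp. $p_m^\sigma(x)$, when $\sigma>0$) is the monic polynomial of degree $m$ orthogonal to all polynomials of lower degree with respect to $\gamma(dx)=x^2\nu(dx)$ (resp. $\gamma^\sigma(dx)=\sigma^2\delta_0(dx)+x^2\nu(dx)$); $p_0=p_0^\sigma=1$. It is understood that $\operatorname{Supp}(\nu)$ has at least $n$ points, so that $p_n$ (and $p^\sigma_{n+1}$) are uniquely determined; $p_n$ then has $n$ distinct real roots. When $\sigma>0$, numbers $\lambda_n,\lambda_{n-1}$ as in the claim exist and are unique. For a polynomial $P(x)=c_0+c_1x+\cdots+c_mx^m$ put $\mathcal{L}(P)(x_1,\ldots,x_{m+1})=c_0x_1+\cdots+c_mx_{m+1}$. Teugels martingales: $Y_t^{(j)}=X_t^{(j)}-\mathbb{E}[X_t^{(j)}]$,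 $j\ge1$. Orthogonalized martingales: $H_t^{(m+1)}=\mathcal{L}(p_m^\sigma)(Y_t^{(1)},\ldots,Y_t^{(m+1)})$ if $\sigma>0$, and $H_t^{(m+1)}=\mathcal{L}(p_m)(Y_t^{(1)},\ldots,Y_t^{(m+1)})$ if $\sigma=0$. Polynomials $J$, for $\mathbf{a}=(a_1,\ldots,a_n)$ distinct and nonzero: - Given $(x_1,\ldots,x_n)$, let $(y_1,\ldots,y_n)$ be the unique solution of $x_i=\sum_{j=1}^na_j^iy_j$, $i=1,\ldots,n$, and $u_{n+1}=\sum_{j=1}^na_j^{n+1}y_j$. Then $J_{n+1}^{\mathbf{a}}(x_1,\ldots,x_n)=P_{n+1}(x_1,\ldots,x_n,u_{n+1})$. - Given $(x_1,\ldots,x_{n+1})$, let $(y_1,\ldots,y_n)$ be the unique solution of $x_i=\sum_{j=1}^na_j^iy_j$, $i=2,\ldots,n+1$, and $u_{n+2}^\sigma=\sum_{j=1}^na_j^{n+2}y_j$. Then $J_{n+2}^{\sigma,\mathbf{a}}(x_1,\ldots,x_{n+1})=P_{n+2}(x_1,\ldots,x_{n+1},u_{n+2}^\sigma)$. *)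

(* Defs.v *)
From HB Require Import structures.
From mathcomp Require Import all_boot all_order all_algebra.
From mathcomp Require Import all_classical all_reals all_analysis.
From mathcomp Require Import measurable_realfun.

Set Implicit Arguments.
Unset Strict Implicit.
Unset Printing Implicit Defensive.

Import Order.TTheory GRing.Theory Num.Theory.
Import numFieldNormedType.Exports.

Local Open Scope classical_set_scope.
Local Open Scope ring_scope.

(* A process is a family indexed by R, of which only the members with
   nonnegative index are ever constrained or used. *)

Section LevyProcess.
Context d (T : measurableType d) (R : realType) (P : probability T R).
Implicit Types X Q : R -> {RV P >-> R}.

Definition cadlag (f : R -> R) : Prop :=
  (forall t, 0 <= t -> f s @[s --> t^'+] --> f t) /\
  (forall t, 0 < t -> cvg (f s @[s --> t^'-])).

Definition increment X (s t : R) (w : T) : R := X t w - X s w.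

(* As the sets B i may be the whole line, the product rule for the full family
   contains the product rules for all its subfamilies. *)
Definition independent_increments X : Prop :=
  forall (k : nat) (s : nat -> R), 0 <= s 0%N ->
    (forall i, (i < k)%N -> s i <= s i.+1) ->
    forall B : nat -> set R, (forall i, measurable (B i)) ->
      P (\bigcap_(i in `I_k) (increment X (s i) (s i.+1) @^-1` B i)) =
      (\prod_(i < k) P (increment X (s i) (s i.+1) @^-1` B i))%E.

Definition stationary_increments X : Prop :=
  forall s h : R, 0 <= s -> 0 <= h ->
    forall B : set R, measurable B ->
      P (increment X s (s + h) @^-1` B) = P (increment X 0 h @^-1` B).

Record levy_process X : Prop := LevyProcess {
  levy_start : {ae P, forall w, X 0 w = 0};
  levy_cadlag : forall w, cadlag (fun t => X t w);
  levy_independent : independent_increments X;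
  levy_stationary : stationary_increments X }.

Definition levy_measure (nu : {measure set R -> \bar R}) : Prop :=
  nu [set 0] = 0%E /\ (\int[nu]_x (Num.min 1 (x ^+ 2))%:E < +oo)%E.

(* Real and imaginary parts of the exponent of the Lévy-Khintchine formula
     i b u - sigma^2 u^2 / 2 + \int (e^(iux) - 1 - iux 1_{|x| <= 1}) nu(dx). *)
Definition levy_exponent_re (sigma : R) (nu : {measure set R -> \bar R})
    (u : R) : R :=
  - (sigma ^+ 2 * u ^+ 2) / 2 + \int[nu]_x (cos (u * x) - 1).

Definition levy_exponent_im (b : R) (nu : {measure set R -> \bar R})
    (u : R) : R :=
  b * u + \int[nu]_x (sin (u * x) - if `|x| <= 1 then u * x else 0).

(* The Lévy-Khintchine formula E[e^(iuX_t)] = e^(t psi(u)), split into its real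
   and imaginary parts. *)
Definition levy_characteristics X (sigma : R)
    (nu : {measure set R -> \bar R}) : Prop :=
  levy_measure nu /\
  exists b : R, forall t u : R, 0 <= t ->
    let re := levy_exponent_re sigma nu u in
    let im := levy_exponent_im b nu u in
    ('E_P[fun w => cos (u * X t w)] = (expR (t * re) * cos (t * im))%:E)%E /\
    ('E_P[fun w => sin (u * X t w)] = (expR (t * re) * sin (t * im))%:E)%E.

Definition all_moments X : Prop :=
  forall (t : R) (k : nat), 0 <= t ->
    P.-integrable setT (fun w => (X t w ^+ k)%:E).

Definition centered X : Prop := forall t : R, 0 <= t -> ('E_P[X t] = 0)%E.

(* [s] lists the points of the partition 0 < s_1 < ... < s_k = t, without 0;
   cf. [variation] in the library. *)
Definition squared_variation X (t : R) (s : seq R) (w : T) : R :=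
  let F := (fun r => X r w) \o nth t (0 :: s) in
  \sum_(0 <= i < size s) (F i.+1 - F i) ^+ 2.

Definition mesh_lt (t : R) (s : seq R) (delta : R) : Prop :=
  forall i, (i < size s)%N ->
    nth t (0 :: s) i.+1 - nth t (0 :: s) i < delta.

(* [Q] is (a version of) the quadratic variation process [X, X]: for every t,
   Q_t is the limit in probability of the sums of squared increments along the
   partitions of [0, t] whose mesh tends to 0. *)
Definition is_quadratic_variation X Q : Prop :=
  forall t : R, 0 <= t ->
  forall eps eta : R, 0 < eps -> 0 < eta ->
  exists2 delta : R, 0 < delta &
    forall s : seq R, itv_partition 0 t s -> mesh_lt t s delta ->
      (P [set w | (eps <= `|squared_variation X t s w - Q t w|)%R]
       <= eta%:E)%E.

Definition jump X (t : R) (w : T) : R :=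
  X t w - lim (X s w @[s --> t^'-]).

(* Unordered sum over the uncountable index set ]0, t], as the difference of
   the sums of the positive and of the negative terms. *)
Definition jump_power_sum X (j : nat) (t : R) (w : T) : R :=
  let f := fun s => (jump X s w ^+ j)%:E in
  fine (esum `]0%R, t] f^\+ - esum `]0%R, t] f^\-)%E.

(* X^(j), for j >= 1; [Q] stands for [X, X]. The value at j = 0 is unused. *)
Definition Xvar X Q (j : nat) (t : R) (w : T) : R :=
  match j with
  | 0 => 0
  | 1 => X t w
  | 2 => Q t w
  | _ => jump_power_sum X j t w
  end.

Definition Yvar X Q (j : nat) (t : R) (w : T) : R :=
  Xvar X Q j t w - fine 'E_P[Xvar X Q j t]%E.

Definition L2_orthogonal (U V : T -> R) : Prop :=
  [/\ U \in Lfun P 2%:E, V \in Lfun P 2%:E & ('E_P[U \* V] = 0)%E].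

End LevyProcess.

(* A finite family (x_1, ..., x_m) is encoded as a function [x : nat -> R],
   of which only the values x 1, ..., x m are used. *)

Section KailathSegall.
Context (R : realType).
Implicit Types x : nat -> R.

(* The list [P_m; P_(m-1); ...; P_0]. *)
Fixpoint KS_list x (m : nat) : seq R :=
  if m is m'.+1 then
    (m%:R^-1 * \sum_(1 <= j < m.+1)
       (-1) ^+ j.+1 * x j * (KS_list x m')`_j.-1) :: KS_list x m'
  else [:: 1].

Definition KS (m : nat) x : R := head 0 (KS_list x m).

Lemma KS0 x : KS 0 x = 1. Proof. by []. Qed.

Lemma nth_KS_list x m j : (j <= m)%N -> (KS_list x m)`_j = KS (m - j) x.
Proof.
elim: m j => [|m IHm] [|j] //= jm.
by rewrite subSS IHm.
Qed.

Lemma KS_rec x m : (0 < m)%N ->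
  KS m x = m%:R^-1 * \sum_(1 <= j < m.+1) (-1) ^+ j.+1 * x j * KS (m - j) x.
Proof.
case: m => // m _; rewrite {1}/KS /=; congr (_ * _).
rewrite !big_nat; apply: eq_bigr => -[|j] // /andP[_ jm].
by rewrite nth_KS_list// subSS.
Qed.

(* The operator L: c_0 + c_1 x + ... + c_m x^m |-> c_0 x_1 + ... + c_m x_(m+1) *)
Definition Lop (q : {poly R}) x : R := \sum_(i < size q) q`_i * x i.+1.

(* With [J] defined below, [J 1 a] is J_(n+1)^a and [J 2 a] is
   J_(n+2)^(sigma, a). *)

Section J.
Variables (k n : nat) (a : n.-tuple R).

Definition power_mx : 'M[R]_n := \matrix_(i < n, j < n) tnth a j ^+ (i + k).

(* The solution of x_i = \sum_j a_j^i y_j, i = k, ..., n + k - 1; see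
   [power_solutionP]. *)
Definition power_solution x : 'cV[R]_n :=
  invmx power_mx *m \col_(i < n) x (i + k)%N.

Lemma power_mx_unit : uniq a -> 0 \notin (a : seq R) -> power_mx \in unitmx.
Proof.
move=> ua a0.
pose v : 'rV[R]_n := \row_j tnth a j.
have -> : power_mx = Vandermonde n v *m diag_mx (\row_j (tnth a j ^+ k)).
  apply/matrixP => i j; rewrite mul_mx_diag !mxE.
  by rewrite exprD.
rewrite unitmx_mul !unitmxE det_Vandermonde det_diag !unitfE.
apply/andP; split; last first.
  apply/prodf_neq0 => j _; rewrite mxE expf_neq0//.
  by apply: contraNneq a0 => <-; exact: mem_tnth.
apply/prodf_neq0 => i _; apply/prodf_neq0 => j ij.
rewrite !mxE subr_eq0; apply/eqP => eji.
by move: ij; rewrite (tuple_uniqP _ ua _ _ eji) ltnn.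
Qed.

Lemma power_solutionP x (y : 'cV[R]_n) : uniq a -> 0 \notin (a : seq R) ->
  (forall i : 'I_n, x (i + k)%N = \sum_j tnth a j ^+ (i + k) * y j 0) <->
  y = power_solution x.
Proof.
move=> ua a0; have Mu := power_mx_unit ua a0.
have E : (forall i : 'I_n, x (i + k)%N = \sum_j tnth a j ^+ (i + k) * y j 0) <->
    \col_(i < n) x (i + k)%N = power_mx *m y.
  split=> [h|/matrixP h i].
    apply/matrixP => i j; rewrite ord1 !mxE h.
    by apply: eq_bigr => l _; rewrite mxE.
  have := h i 0; rewrite !mxE => ->.
  by apply: eq_bigr => l _; rewrite mxE.
rewrite E /power_solution; split=> [->|->]; first by rewrite mulKmx.
by rewrite mulKVmx.
Qed.

Definition J x : R :=
  let u := \sum_j tnth a j ^+ (n + k) * power_solution x j 0 in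
  KS (n + k) (fun i => if i == (n + k)%N then u else x i).

End J.
End KailathSegall.

Section Teugels.
Context (R : realType).
Implicit Types (mu nu : {measure set R -> \bar R}) (sigma : R).

(* The measure x^2 nu(dx). *)
Definition teugels_gamma nu (A : set R) : \bar R :=
  (\int[nu]_(x in A) (x ^+ 2)%:E)%E.

Section teugels_gamma_measure.
Variable nu : {measure set R -> \bar R}.

Let teugels_gamma0 : teugels_gamma nu set0 = 0%E.
Proof. by rewrite /teugels_gamma integral_set0. Qed.

Let teugels_gamma_ge0 A : (0 <= teugels_gamma nu A)%E.
Proof. by apply: integral_ge0 => x _; rewrite lee_fin sqr_ge0. Qed.

Let teugels_gamma_additive : semi_sigma_additive (teugels_gamma nu).
Proof.
move=> F mF tF mUF; rewrite /teugels_gamma ge0_integral_bigcup//.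
- by apply: is_cvg_ereal_nneg_natsum => n _; exact: teugels_gamma_ge0.
- apply/measurable_EFinP; apply: measurable_funTS.
  exact: exprn_measurable.
- by move=> x _; rewrite lee_fin sqr_ge0.
Qed.

HB.instance Definition _ := isMeasure.Build _ _ _ (teugels_gamma nu)
  teugels_gamma0 teugels_gamma_ge0 teugels_gamma_additive.

End teugels_gamma_measure.

(* The measure sigma^2 delta_0(dx) + x^2 nu(dx). *)
Definition teugels_gamma_sigma sigma nu : {measure set R -> \bar R} :=
  measure_add (mscale (NngNum (sqr_ge0 sigma)) (dirac (0 : R)))
    (teugels_gamma nu).

Definition monic_orthogonal mu (m : nat) (q : {poly R}) : Prop :=
  [/\ q \is monic, size q = m.+1 &
    forall r : {poly R}, (size r <= m)%N ->
      (\int[mu]_x (q.[x] * r.[x])%:E = 0)%E].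

Definition measure_support mu : set R :=
  [set x | forall U : set R, open_nbhs x U -> (0 < mu U)%E].

Definition has_n_points (n : nat) (A : set R) : Prop :=
  exists s : seq R, [/\ uniq s, size s = n & forall x, x \in s -> A x].

Definition C_const (pn : {poly R}) nu : R :=
  \int[nu]_x (x * (pn.[x] - pn.[0])).

Definition D_const (pn : {poly R}) sigma nu : R :=
  sigma ^+ 2 * pn.[0] + \int[nu]_x (x ^+ 2 * pn.[x]).

End Teugels.

(* H^(m), for m >= 1, given the Teugels polynomials [p] and [ps] (the latter
   with respect to [teugels_gamma_sigma]). *)
Definition Hvar d (T : measurableType d) (R : realType) (P : probability T R)
    (X Q : R -> {RV P >-> R}) (sigma : R) (p ps : nat -> {poly R})
    (m : nat) (t : R) (w : T) : R :=
  Lop (if 0 < sigma then ps m.-1 else p m.-1) (fun j => Yvar X Q j t w).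

(* Main.v *)
(* Cut [0, t] into N equal intervals and let D_1, ..., D_N be the increments of X
   over them. By Newton's identities, the Kailath-Segall polynomial P_m of the
   power sums S_j = D_1^j + ... + D_N^j is the elementary symmetric polynomial
   e_m of the increments. As these are independent and centered, e_a and e_b are
   orthogonal for a <> b, E[S_j e_k] = 0 for k >= 2 and
   E[S_j e_1] = N E[X_(t/N)^(j+1)].

   Along a subsequence, S_2 converges almost surely to [X, X]_t; on this event the
   other power sums converge to the sums of the powers of the jumps, path by path.
   All moments of the S_j are bounded in N, so expectations pass to the limit.
   The limit t kappa_k of N E[X_(t/N)^k] is read off the Levy-Khintchine formula
   by approximating x^k by the trigonometric polynomials (sin(e x)/e)^k, and
   kappa_k is the integral of x^(k-2) with respect to
   sigma^2 delta_0(dx) + x^2 nu(dx).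

   It follows that H^(m+1), m >= 1, and P_k are orthogonal for k >= 1: for k >= 2
   because H is of first order, and for k = 1 because p_m is orthogonal to 1. The
   decomposition itself is algebraic: u_(n+1) differs from x_(n+1) by L(p_n)(x),
   because the a_j are the roots of p_n. *)

Require Import Defs.
From mathcomp Require Import all_boot all_order all_algebra.
From mathcomp Require Import all_classical all_reals all_analysis.
From mathcomp Require Import measurable_realfun ring lra.

Set Implicit Arguments.
Unset Strict Implicit.
Unset Printing Implicit Defensive.

Import Order.TTheory GRing.Theory Num.Theory.
Import numFieldNormedType.Exports.
Import HBNNSimple.

Local Open Scope classical_set_scope.
Local Open Scope ring_scope.

(** * Random variables with moments of all orders *)

(** No stochastic calculus enters: the orthogonality relations hold exactly on every grid, and only
    limits remain to be justified. Quadratic variation is a limit in probability only, so it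
    converges almost surely along a subsequence. Sums of a function vanishing near 0 need no such
    extraction, as finitely many jumps contribute. The error of truncating x^j in this way, for j >=
    3, is a small multiple of S_2, hence uniformly small once S_2 is bounded along the path. The
    Levy-Khintchine formula speaks of bounded functions of X, whereas the cumulants need unbounded
    ones. The error of (sin(e x)/e)^k is of order e^2 |x|^(k+2), and N E[|X_(t/N)|^k] is bounded in
    N for k >= 2; so e can be fixed before N grows. If sigma > 0, the recurrence turns the bracket
    of the three H's into L(x p_n), whose arguments start at Y^(2). This is why D involves all of
    p_n while C omits p_n(0): the missing term belongs to X itself, which has mean 0. *)

Section AllMoments.
Context d (T : measurableType d) (R : realType) (P : probability T R).
Implicit Types U V : T -> R.

(** Integer powers without absolute values suffice, and the class is an algebra. Polynomials in the
    increments or in the variations are therefore integrable without further estimates. *)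
Definition has_all_moments U : Prop :=
  measurable_fun setT U /\
  forall k, P.-integrable setT (fun w => (U w ^+ k)%:E).

Lemma has_all_moments_integrable U :
  has_all_moments U -> P.-integrable setT (EFin \o U).
Proof. by move=> [_ /(_ 1%N)]; under eq_fun do rewrite expr1. Qed.

Lemma has_all_moments_cst c : has_all_moments (fun=> c).
Proof.
split=> [|k]; first exact: measurable_cst.
exact: (@finite_measure_integrable_cst _ _ _ P setT (c ^+ k) measurableT).
Qed.

Lemma has_all_momentsD U V :
  has_all_moments U -> has_all_moments V -> has_all_moments (U \+ V).
Proof.
move=> [mU iU] [mV iV]; split=> [|k]; first exact: measurable_funD.
have : P.-integrable setT
    (fun w => (2 ^+ k)%:E * (`|(U w ^+ k)%:E| + `|(V w ^+ k)%:E|))%E.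
  apply: integrableZl => //; apply: integrableD => //; exact: integrable_abse.
apply: le_integrable => //=.
  by apply/measurable_EFinP; apply: measurable_funX; exact: measurable_funD.
move=> w _; rewrite lee_fin !normrX.
rewrite [leRHS]ger0_norm; last by rewrite mulr_ge0 ?addr_ge0// ?exprn_ge0.
set x : R := `|U w|; set y : R := `|V w|.
have xy : `|U w + V w| <= 2 * Num.max x y.
  rewrite (le_trans (ler_normD _ _))// mulr2n mulrDl mul1r lerD//.
    by rewrite le_max lexx.
  by rewrite le_max lexx orbT.
rewrite (le_trans (lerXn2r k _ _ xy)) ?nnegrE//.
  by rewrite mulr_ge0// le_max normr_ge0.
rewrite exprMn ler_wpM2l ?exprn_ge0//.
by case: (leP x y) => _; rewrite ?lerDl ?lerDr exprn_ge0// normr_ge0.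
Qed.

Lemma has_all_momentsX U n :
  has_all_moments U -> has_all_moments (fun w => U w ^+ n).
Proof.
move=> [mU iU]; split=> [|k]; first exact: measurable_funX.
by under eq_fun do rewrite -exprM; exact: iU.
Qed.

Lemma has_all_momentsM U V :
  has_all_moments U -> has_all_moments V -> has_all_moments (U \* V).
Proof.
move=> [mU iU] [mV iV]; split=> [|k]; first exact: measurable_funM.
have : P.-integrable setT
    (fun w => ((U w ^+ (k * 2))%:E + (V w ^+ (k * 2))%:E))%E.
  by apply: integrableD.
apply: le_integrable => //=.
  by apply/measurable_EFinP; apply: measurable_funX; exact: measurable_funM.
move=> w _; rewrite lee_fin exprMn !exprM [leRHS]ger0_norm; last first.
  by rewrite addr_ge0 ?sqr_ge0.
rewrite ler_norml; apply/andP; split; nra.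
Qed.

Lemma has_all_momentsZ c U :
  has_all_moments U -> has_all_moments (fun w => c * U w).
Proof. exact/has_all_momentsM/has_all_moments_cst. Qed.

Lemma has_all_moments_sum (I : Type) (r : seq I) (Q : pred I) (F : I -> T -> R) :
  (forall i, Q i -> has_all_moments (F i)) ->
  has_all_moments (fun w => \sum_(i <- r | Q i) F i w).
Proof.
move=> FQ; elim: r => [|i r IHr].
  by under eq_fun do rewrite big_nil; exact: has_all_moments_cst.
have [Qi|nQi] := boolP (Q i).
  under eq_fun do rewrite big_cons Qi.
  exact: has_all_momentsD (FQ _ Qi) IHr.
by under eq_fun do rewrite big_cons (negbTE nQi).
Qed.

Lemma ExpectationD U V : has_all_moments U -> has_all_moments V ->
  \int[P]_w (U w + V w) = \int[P]_w U w + \int[P]_w V w.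
Proof.
by move=> /has_all_moments_integrable iU /has_all_moments_integrable iV;
  rewrite RintegralD.
Qed.

Lemma ExpectationZ c U : has_all_moments U ->
  \int[P]_w (c * U w) = c * \int[P]_w U w.
Proof. by move=> /has_all_moments_integrable iU; rewrite RintegralZl. Qed.

Lemma Expectation_cst c : \int[P]_w c = c.
Proof. by rewrite Rintegral_cst//= probability_setT mulr1. Qed.

Lemma Expectation_sum (I : Type) (r : seq I) (Q : pred I) (F : I -> T -> R) :
  (forall i, Q i -> has_all_moments (F i)) ->
  \int[P]_w (\sum_(i <- r | Q i) F i w) =
  \sum_(i <- r | Q i) \int[P]_w F i w.
Proof.
move=> FQ; elim: r => [|i r IHr].
  under eq_Rintegral do rewrite big_nil.
  by rewrite big_nil (Expectation_cst 0).
rewrite big_cons; have [Qi|nQi] := boolP (Q i).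
  under eq_Rintegral do rewrite big_cons Qi.
  by rewrite ExpectationD ?IHr//; [exact: FQ|exact: has_all_moments_sum].
by under eq_Rintegral do rewrite big_cons (negbTE nQi).
Qed.

Lemma le_Expectation U V : has_all_moments U -> has_all_moments V ->
  (forall w, U w <= V w) -> \int[P]_w U w <= \int[P]_w V w.
Proof.
by move=> /has_all_moments_integrable iU /has_all_moments_integrable iV UV;
  exact: le_Rintegral.
Qed.

Lemma has_all_moments_Lfun U : has_all_moments U -> U \in Lfun P 2%:E.
Proof.
move=> [mU iU]; rewrite inE; apply/andP; split; rewrite inE//=.
rewrite /finite_norm unlock /= poweR_lty//.
under eq_integral do rewrite powR_mulrn// -normrX.
by have /integrableP[_] := iU 2%N.
Qed.

(** Bounded second moments give uniform integrability. Fatou's lemma passes the bound to the limit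
    [Z], and a bounded substitute for the identity reduces the convergence to the dominated case. *)
Lemma Vitali_expectation (Z_ : nat -> T -> R) (Z : T -> R) (B : R) :
  (forall n, has_all_moments (Z_ n)) -> measurable_fun setT Z ->
  (forall n, \int[P]_w (Z_ n w ^+ 2) <= B) ->
  {ae P, forall w, Z_ n w @[n --> \oo] --> Z w} ->
  P.-integrable setT (fun w => (Z w ^+ 2)%:E) /\
  \int[P]_w Z_ n w @[n --> \oo] --> \int[P]_w Z w.
Proof.
move=> mZ_ mZ ZB cZ.
have Z2B : (\int[P]_w (Z w ^+ 2)%:E <= B%:E)%E.
  have -> : (\int[P]_w (Z w ^+ 2)%:E =
      \int[P]_w limn_einf (fun n => (Z_ n w ^+ 2)%:E))%E.
    apply: ae_eq_integral => //.
    - by apply/measurable_EFinP; exact: measurable_funX.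
    - under eq_fun do rewrite -[limn_einf _]oppeK -limn_esupN.
      apply: measurableT_comp => //; apply: measurable_fun_limn_esup => n.
      apply: measurableT_comp => //; apply/measurable_EFinP.
      by apply: measurable_funX; case: (mZ_ n).
    - apply: filterS cZ => w cZw _.
      rewrite is_cvg_limn_einfE; last first.
        apply/cvg_ex; exists (Z w ^+ 2)%:E; apply: cvg_EFin; first exact: nearW.
        by rewrite /comp/= !expr2; exact: cvgM.
      apply/esym/cvg_lim => //; apply: cvg_EFin; first exact: nearW.
      by rewrite /comp/= !expr2; exact: cvgM.
  have mZ2 n : measurable_fun setT (fun w => (Z_ n w ^+ 2)%:E).
    by apply/measurable_EFinP; apply: measurable_funX; case: (mZ_ n).
  apply: (le_trans (fatou _ _ mZ2 _)) => // [n w _|].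
    by rewrite lee_fin sqr_ge0.
  rewrite limn_einf_lim; apply: lime_le; first exact: is_cvg_einfs.
  apply: nearW => n; apply: (@le_trans _ _ (\int[P]_w (Z_ n w ^+ 2)%:E)%E).
    by apply: ereal_inf_lbound; exists n => //=.
  have := ZB n; rewrite -lee_fin fineK//.
  by apply: integrable_fin_num => //; case: (mZ_ n) => _; exact.
have iZ2 : P.-integrable setT (fun w => (Z w ^+ 2)%:E).
  apply/integrableP; split; first by apply/measurable_EFinP;
    exact: measurable_funX.
  under eq_integral do rewrite gee0_abs ?lee_fin ?sqr_ge0//.
  exact: le_lt_trans Z2B (ltry _).
split=> //.
have iZ : P.-integrable setT (EFin \o Z).
  have : P.-integrable setT (fun w => 1%:E + (Z w ^+ 2)%:E)%E.
    apply: integrableD => //; exact: finite_measure_integrable_cst.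
  apply: le_integrable => //=; first exact/measurable_EFinP.
  move=> w _; rewrite lee_fin [leRHS]ger0_norm ?addr_ge0 ?sqr_ge0//.
  by rewrite ler_norml; apply/andP; split; nra.
have B0 : 0 <= B by apply: le_trans (ZB 0%N); apply: Rintegral_ge0 => w _;
  exact: sqr_ge0.
(* A smooth truncation: |x - f s x| <= s x^2 is controlled by the second moments uniformly in n, and
   |f s x| <= 1/s permits dominated convergence. *)
pose f (s x : R) := x / (1 + (s * x) ^+ 2).
have fpos (s x : R) : 0 < 1 + (s * x) ^+ 2 by rewrite ltr_pwDl// sqr_ge0.
have f_id (s : R) x : 0 < s -> `|x - f s x| <= s * x ^+ 2.
  move=> s0; have -> : x - f s x = (s * x ^+ 2) * ((s * x) / (1 + (s * x) ^+ 2)).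
    by rewrite /f; field; rewrite gt_eqF.
  have sx0 : 0 <= s * x ^+ 2 by rewrite mulr_ge0 ?sqr_ge0// ltW.
  rewrite normrM (ger0_norm sx0) ler_piMr// normrM normfV.
  rewrite [`|1 + _|]gtr0_norm//.
  rewrite ler_pdivrMr// mul1r ler_norml; apply/andP; split; nra.
have f_bd (s : R) x : 0 < s -> `|f s x| <= s^-1.
  move=> s0; rewrite /f normrM normfV [`|1 + _|]gtr0_norm// ler_pdivrMr//.
  rewrite -[leLHS](mulKf (lt0r_neq0 s0)) ler_pM2l ?invr_gt0//.
  rewrite -[X in X * _](gtr0_norm s0) -normrM ler_norml; apply/andP; split; nra.
have cf s : continuous (f s).
  move=> x; apply: cvgM; first exact: cvg_id.
  apply: cvgV; first by rewrite gt_eqF.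
  apply: cvgD; first exact: cvg_cst.
  by rewrite !expr2; apply: cvgM; apply: cvgM; (exact: cvg_cst || exact: cvg_id).
have mf s (U : T -> R) : measurable_fun setT U ->
    measurable_fun setT (f s \o U).
  move=> mU; apply: measurableT_comp => //.
  exact: continuous_measurable_fun.
have if_ s (U : T -> R) : 0 < s -> measurable_fun setT U ->
    P.-integrable setT (EFin \o (f s \o U)).
  move=> s0 mU.
  apply: (@le_integrable _ _ _ P setT _ _ (fun=> (s^-1)%:E)) => //=.
  - exact/measurable_EFinP/mf.
  - by move=> w _; rewrite lee_fin [leRHS]ger0_norm ?f_bd// invr_ge0 ltW.
  - by apply: finite_measure_integrable_cst; exact: measurableT.
have approx s (U : T -> R) : 0 < s -> measurable_fun setT U ->
    P.-integrable setT (EFin \o U) ->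
    P.-integrable setT (fun w => (U w ^+ 2)%:E) ->
    \int[P]_w (U w ^+ 2) <= B ->
    `|\int[P]_w U w - \int[P]_w f s (U w)| <= s * B.
  move=> s0 mU iU iU2 UB; rewrite -RintegralB//; last exact: if_.
  have iD : P.-integrable setT (EFin \o (fun w => U w - f s (U w))).
    rewrite (_ : _ \o _ = (EFin \o U) \- (EFin \o (f s \o U)))%E//.
    by apply: integrableB => //; exact: if_.
  apply: le_trans (le_normr_Rintegral _ iD) _ => //.
  apply: (@le_trans _ _ (\int[P]_w (s * U w ^+ 2))).
    apply: le_Rintegral => //; last by move=> w _; exact: f_id.
      exact: (integrable_abse iD).
    by rewrite (_ : _ \o _ = fun w => s%:E * (U w ^+ 2)%:E)%E//;
      exact: integrableZl.
  by rewrite RintegralZl// ler_wpM2l// ltW.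
have ZBr : \int[P]_w (Z w ^+ 2) <= B.
  by rewrite -lee_fin fineK//; exact: integrable_fin_num.
apply/cvgrPdist_le => e e0.
(* The denominator has B + 1 because B may be 0. The two truncation errors and the dominated
   convergence get e / 3 each. *)
pose s := e / (3 * (B + 1)).
have s0 : 0 < s by rewrite divr_gt0// mulr_gt0// ltr_wpDl.
have sB : s * B <= e / 3.
  rewrite /s invfM mulrA -mulrA ler_piMr ?divr_ge0 ?(ltW e0)//.
  by rewrite mulrC ler_pdivrMr ?mul1r ?ltr_wpDl// lerDl.
have cfZ : \int[P]_w f s (Z_ n w) @[n --> \oo] --> \int[P]_w f s (Z w).
  have : {ae P, forall w n, setT w -> (`|(f s (Z_ n w))%:E| <= (s^-1)%:E)%E}.
    by apply: aeW => w n _; rewrite lee_fin f_bd.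
  move=> /(@dominated_convergence _ _ _ P setT measurableT
    (fun n w => (f s (Z_ n w))%:E) (fun w => (f s (Z w))%:E)) H.
  have [] // := H.
  - by move=> n; apply/measurable_EFinP/mf; case: (mZ_ n).
  - exact/measurable_EFinP/mf.
  - apply: filterS cZ => w cZw _; apply: cvg_EFin; first exact: nearW.
    exact: (continuous_cvg _ (cf s (Z w)) cZw).
  - by apply: finite_measure_integrable_cst; exact: measurableT.
  - move=> _ _ h; apply: fine_cvg; rewrite fineK//.
    by apply: integrable_fin_num => //; exact: if_.
have := cfZ => /cvgrPdist_le /(_ (e / 3)); rewrite divr_gt0// => /(_ isT).
apply: filterS => n hn.
have h1 := approx s Z s0 mZ iZ iZ2 ZBr.
have mn := mZ_ n.
have h2 := approx s (Z_ n) s0 (proj1 mn) (has_all_moments_integrable mn)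
  (proj2 mn 2%N) (ZB n).
have -> : \int[P]_w Z w - \int[P]_w Z_ n w =
  (\int[P]_w Z w - \int[P]_w f s (Z w)) +
  (\int[P]_w f s (Z w) - \int[P]_w f s (Z_ n w)) -
  (\int[P]_w Z_ n w - \int[P]_w f s (Z_ n w)) by ring.
rewrite (le_trans (ler_normB _ _))//.
have -> : e = (e / 3 + e / 3) + e / 3 by field.
rewrite lerD ?(le_trans h2)// (le_trans (ler_normD _ _))//.
by rewrite lerD ?(le_trans h1).
Qed.

(** Uniformity is asked of even moments, whose integrands are nonnegative. The class is closed under
    sums and products, so every polynomial in the grid power sums inherits it and can be passed to
    the limit. *)
Definition bounded_moments (Z_ : nat -> T -> R) : Prop :=
  (forall n, has_all_moments (Z_ n)) /\
  forall k, exists B : R, forall n, \int[P]_w (Z_ n w ^+ (k * 2)) <= B.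

Lemma bounded_momentsD (U_ V_ : nat -> T -> R) : bounded_moments U_ ->
  bounded_moments V_ ->
  bounded_moments (fun n => U_ n \+ V_ n).
Proof.
move=> [mU bU] [mV bV]; split=> [n|k]; first exact: has_all_momentsD.
have [BU hU] := bU k; have [BV hV] := bV k.
exists (4 ^+ k * (BU + BV)) => n.
apply: (@le_trans _ _ (\int[P]_w (4 ^+ k * (U_ n w ^+ (k * 2) + V_ n w ^+ (k *
  2))))).
  apply: le_Expectation.
  - exact/has_all_momentsX/has_all_momentsD.
  - by apply/has_all_momentsZ/has_all_momentsD; exact: has_all_momentsX.
  - move=> w /=; rewrite mulnC !exprM; set x := U_ n w; set y := V_ n w.
    apply: (@le_trans _ _ ((4 * Num.max (x ^+ 2) (y ^+ 2)) ^+ k)).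
      apply: lerXn2r; rewrite ?nnegrE ?sqr_ge0//.
        by rewrite mulr_ge0// le_max sqr_ge0.
      by case: (leP (x ^+ 2) (y ^+ 2)) => h; nra.
    rewrite exprMn ler_wpM2l ?exprn_ge0//.
    by case: (leP (x ^+ 2) (y ^+ 2)) => _;
      rewrite ?lerDl ?lerDr exprn_ge0// sqr_ge0.
rewrite ExpectationZ; last by apply: has_all_momentsD; exact: has_all_momentsX.
rewrite ExpectationD; [|exact: has_all_momentsX..].
by rewrite ler_wpM2l ?exprn_ge0// lerD.
Qed.

Lemma bounded_momentsM (U_ V_ : nat -> T -> R) : bounded_moments U_ ->
  bounded_moments V_ ->
  bounded_moments (fun n => U_ n \* V_ n).
Proof.
move=> [mU bU] [mV bV]; split=> [n|k]; first exact: has_all_momentsM.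
have [BU hU] := bU (k * 2)%N; have [BV hV] := bV (k * 2)%N.
exists (BU + BV) => n.
apply: (@le_trans _ _ (\int[P]_w (U_ n w ^+ (k * 2 * 2) + V_ n w ^+ (k * 2 *
  2)))).
  apply: le_Expectation.
  - exact/has_all_momentsX/has_all_momentsM.
  - by apply/has_all_momentsD; exact: has_all_momentsX.
  - move=> w /=; rewrite exprMn !(exprM _ (k * 2)).
    by set x := U_ n w ^+ _; set y := V_ n w ^+ _; nra.
rewrite ExpectationD; [|exact: has_all_momentsX..].
by rewrite lerD.
Qed.

Lemma bounded_moments_cst c : bounded_moments (fun _ _ => c).
Proof.
split=> [n|k]; first exact: has_all_moments_cst.
by exists (c ^+ (k * 2)) => n; rewrite Expectation_cst.
Qed.

End AllMoments.

(** * Independence *)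

Section Factor.
Context d (T : measurableType d) (R : realType) (P : probability T R).
Implicit Types U V Y : T -> R.

Lemma has_all_moments_indic (A : set T) :
  measurable A -> has_all_moments P (\1_A : T -> R).
Proof.
move=> mA; split=> [|k]; first exact: measurable_indic.
apply: (@le_integrable _ _ _ P setT _ _ (EFin \o cst 1)) => //=.
- by apply/measurable_EFinP; apply: measurable_funX; exact: measurable_indic.
- move=> w _; rewrite lee_fin normr1 indicE.
  by case: (w \in A); rewrite ?expr1n ?normr1//; case: k => [|k];
    rewrite ?expr0 ?normr1// expr0n normr0.
- exact: (@finite_measure_integrable_cst _ _ _ P setT 1 measurableT).
Qed.

Lemma Expectation_indic (A : set T) : measurable A ->
  \int[P]_w (\1_A : T -> R) w = fine (P A).
Proof. by move=> mA; rewrite /Rintegral integral_indic// setIT. Qed.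

Lemma has_all_moments_norm U :
  has_all_moments P U -> has_all_moments P (fun w => `|U w|).
Proof.
move=> [mU iU]; split=> [|k]; first exact: measurableT_comp.
apply: le_integrable (iU k) => //=.
  by apply/measurable_EFinP; apply: measurable_funX; exact: measurableT_comp.
by move=> w _; rewrite lee_fin !normrX normr_id.
Qed.

Lemma has_all_moments_le U V : measurable_fun setT U ->
  has_all_moments P V -> (forall w, `|U w| <= `|V w|) -> has_all_moments P U.
Proof.
move=> mU [mV iV] UV; split=> // k; apply: le_integrable (iV k) => //=.
  by apply/measurable_EFinP; exact: measurable_funX.
by move=> w _; rewrite lee_fin !normrX lerXn2r ?nnegrE.
Qed.

Lemma has_all_moments_prod (I : eqType) (r : seq I) (F : I -> T -> R) :
  (forall i, i \in r -> has_all_moments P (F i)) ->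
  has_all_moments P (fun w => \prod_(i <- r) F i w).
Proof.
elim: r => [_|i r IHr Fr].
  by under eq_fun do rewrite big_nil; exact: has_all_moments_cst.
under eq_fun do rewrite big_cons.
apply: has_all_momentsM; first by apply: Fr; rewrite mem_head.
by apply: IHr => j jr; apply: Fr; rewrite inE jr orbT.
Qed.

Section factor.
Variables (U Y : T -> R) (c : R).
Hypotheses (mU : has_all_moments P U) (mY : measurable_fun setT Y).
Hypothesis UY : forall B, measurable B ->
  \int[P]_w (U w * \1_(Y @^-1` B) w) = c * fine (P (Y @^-1` B)).

Let mYB (B : set R) : measurable B -> measurable (Y @^-1` B).
Proof. by move=> mB; rewrite -[X in measurable X]setTI; exact: mY. Qed.

Let factor_nnsfun (g : {nnsfun R >-> R}) :
  \int[P]_w (U w * g (Y w)) = c * \int[P]_w g (Y w).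
Proof.
have gE w : g (Y w) = \sum_(y <- finmap.enum_fset (fset_set (range g))) y *
  \1_(Y @^-1` (g @^-1` [set y])) w.
  by rewrite fimfunE fsbig_finite//=.
have mg y : measurable (Y @^-1` (g @^-1` [set y])).
  by apply: mYB; exact: measurable_funPTI.
under eq_Rintegral do rewrite gE mulr_sumr.
under [in RHS]eq_Rintegral do rewrite gE.
rewrite !Expectation_sum; last 2 first.
- by move=> y _; apply: has_all_momentsZ; exact: has_all_moments_indic.
- move=> y _; apply: has_all_momentsM => //.
  by apply: has_all_momentsZ; exact: has_all_moments_indic.
rewrite mulr_sumr; apply: eq_bigr => y _.
under eq_Rintegral do rewrite mulrCA.
rewrite !ExpectationZ; last 2 first.
- by apply: has_all_momentsM => //; exact: has_all_moments_indic.
- exact: has_all_moments_indic.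
by rewrite Expectation_indic// UY; [ring|exact: measurable_funPTI].
Qed.

Let factor_ge0 (f : R -> R) : measurable_fun setT f -> (forall x, 0 <= f x) ->
  has_all_moments P (f \o Y) ->
  \int[P]_w (U w * f (Y w)) = c * \int[P]_w f (Y w).
Proof.
move=> mf f0 mfY.
have mef : measurable_fun setT (EFin \o f) by exact/measurable_EFinP.
pose g := nnsfun_approx measurableT mef.
have gf x : g n x @[n --> \oo] --> f x.
  have : forall x, [set: R] x -> (0 <= (EFin \o f) x)%E by move=> y _;
    rewrite lee_fin.
  move=> /(cvg_nnsfun_approx measurableT mef)/(_ x Logic.I).
  by move/fine_cvg.
have g_le n x : g n x <= f x.
  rewrite -(cvg_lim (@Rhausdorff R) (gf x)).
  apply: (@nondecreasing_cvgn_le _ (fun n => g n x)).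
    by move=> i j ij; have /lefP := nd_nnsfun_approx measurableT mef ij; exact.
  by apply/cvg_ex; exists (f x); exact: gf.
have mUf : has_all_moments P (fun w => U w * f (Y w)) by exact: has_all_momentsM.
have mgY n : measurable_fun setT (g n \o Y) by exact: measurableT_comp.
have mgf n : has_all_moments P (g n \o Y).
  apply: has_all_moments_le mfY _ => // w /=.
  by rewrite !ger0_norm.
have lim1 : \int[P]_w (U w * g n (Y w)) @[n --> \oo] --> \int[P]_w (U w * f (Y
  w)).
  have [] // := @dominated_convergence _ _ _ P setT measurableT
    (fun n w => (U w * g n (Y w))%:E) (fun w => (U w * f (Y w))%:E)
    (fun w => `|U w * f (Y w)|%:E).
  - move=> n; apply/measurable_EFinP; apply: measurable_funM; first by case: mU.
    exact: mgY.
  - by apply/measurable_EFinP; case: mUf.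
  - apply: aeW => w _; apply: cvg_EFin; first exact: nearW.
    by apply: cvgM; [exact: cvg_cst|exact: gf].
  - exact: integrable_abse (has_all_moments_integrable mUf).
  - apply: aeW => w n _; rewrite lee_fin !normrM ler_wpM2l// !ger0_norm//.
  - move=> _ _ h; apply: fine_cvg; rewrite fineK//.
    by apply: integrable_fin_num => //; exact: has_all_moments_integrable.
have lim2 : c * \int[P]_w (g n (Y w)) @[n --> \oo] --> c * \int[P]_w (f (Y w)).
  apply: cvgM; first exact: cvg_cst.
  have [] // := @dominated_convergence _ _ _ P setT measurableT
    (fun n w => (g n (Y w))%:E) (fun w => (f (Y w))%:E)
    (fun w => (f (Y w))%:E).
  - by move=> n; apply/measurable_EFinP; exact: mgY.
  - by apply/measurable_EFinP; case: mfY.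
  - apply: aeW => w _; apply: cvg_EFin; first exact: nearW.
    exact: gf.
  - exact: has_all_moments_integrable mfY.
  - by apply: aeW => w n _; rewrite lee_fin ger0_norm//.
  - move=> _ _ h; apply: fine_cvg; rewrite fineK//.
    by apply: integrable_fin_num => //; exact: (has_all_moments_integrable mfY).
apply: (cvg_unique (@Rhausdorff R) lim1).
rewrite (_ : (fun n => _) = fun n => c * \int[P]_w (g n (Y w)))//.
by apply/funext => n; exact: factor_nnsfun.
Qed.

(** The factorisation extends from indicators of [Y] to simple functions, then to nonnegative [f] by
    dominated convergence. A general [f] is the difference of the nonnegative functions |f| + f and
    |f|. *)
Lemma factor_expectation (f : R -> R) : measurable_fun setT f ->
  has_all_moments P (f \o Y) ->
  \int[P]_w (U w * f (Y w)) = c * \int[P]_w f (Y w).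
Proof.
move=> mf mfY.
have mnY : has_all_moments P (fun w => `|f (Y w)|) by exact: has_all_moments_norm.
have mD : has_all_moments P (fun w => `|f (Y w)| + f (Y w)) by exact:
  has_all_momentsD.
have h1 := @factor_ge0 (fun x => `|f x|) (measurableT_comp _ mf) (fun=>
  normr_ge0 _) mnY.
have h2 : \int[P]_w (U w * (`|f (Y w)| + f (Y w))) =
    c * \int[P]_w (`|f (Y w)| + f (Y w)).
  apply: (@factor_ge0 (fun x => `|f x| + f x)) => //.
    by apply: measurable_funD => //; exact: measurableT_comp.
  by move=> x; rewrite -lerBlDr sub0r -normrN ler_norm.
move: h2; rewrite ExpectationD// mulrDr -h1//.
under eq_Rintegral do rewrite mulrDr.
rewrite ExpectationD; [|exact: has_all_momentsM..].
by move/addrI.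
Qed.

End factor.

Variables (N : nat) (D : nat -> T -> R) (m : nat -> R).
Hypothesis mD : forall i, (i < N)%N -> has_all_moments P (D i).
Hypothesis indep : forall B : nat -> set R, (forall i, measurable (B i)) ->
  P (\bigcap_(i in `I_N) (D i @^-1` B i)) = (\prod_(i < N) P (D i @^-1` B i))%E.
Hypothesis momE : forall i k, (i < N)%N -> \int[P]_w (D i w ^+ k) = m k.

(* The part of the independence of [U] from the increments [D i], [k <= i < N],
   that is linear in [U]: this class is closed under linear combinations and
   grows by multiplication by powers of [D k], which is all that polynomials in
   the increments require. *)
Definition past (k : nat) U : Prop :=
  has_all_moments P U /\
  forall B : nat -> set R, (forall i, measurable (B i)) ->
    \int[P]_w (U w * \prod_(k <= i < N) \1_(D i @^-1` B i) w) =
    \int[P]_w U w * \prod_(k <= i < N) fine (P (D i @^-1` B i)).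

Let mDB i (B : set R) : (i < N)%N -> measurable B -> measurable (D i @^-1` B).
Proof.
move=> iN mB; rewrite -[X in measurable X]setTI; have [mDi _] := mD iN.
exact: mDi.
Qed.

Let moments_prod k B : (forall i, measurable (B i)) ->
  has_all_moments P (fun w => \prod_(k <= i < N) \1_(D i @^-1` B i) w : R).
Proof.
move=> mB; apply: has_all_moments_prod => i;
  rewrite mem_index_iota => /andP[_ iN].
by apply: has_all_moments_indic; exact: mDB.
Qed.

(** This is where independence of events enters: the product of the indicators is the indicator of
    the intersection. *)
Lemma past0 c : past 0 (fun=> c).
Proof.
split=> [|B mB]; first exact: has_all_moments_cst.
rewrite ExpectationZ//; last exact: moments_prod.
rewrite Expectation_cst; congr (_ * _).
have -> : (fun w => \prod_(0 <= i < N) \1_(D i @^-1` B i) w) =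
    (\1_(\bigcap_(i in `I_N) (D i @^-1` B i)) : T -> R).
  apply/funext => w; rewrite indicE.
  case: (boolP (w \in _)) => [|].
    rewrite inE => h; rewrite big_nat big1// => i /andP[_ iN].
    by rewrite indicE mem_set//; exact: h.
  rewrite notin_setE => h; apply/eqP; rewrite prodf_seq_eq0.
  have [i [/= iN nB]] : exists i, `I_N i /\ ~ B i (D i w).
    apply: contrapT => /forallNP H; apply: h => i /= iN.
    by apply: contrapT => nB; apply: (H i).
  apply/hasP; exists i; first by rewrite mem_index_iota.
  by rewrite /= indicE memNset.
rewrite Expectation_indic; last first.
  by apply: bigcap_measurableType => // i /= iN; exact: mDB.
rewrite indep// big_mkord.
rewrite (eq_bigr (fun i : 'I_N => (fine (P (D i @^-1` B i)))%:E)); last first.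
  by move=> i _; rewrite fineK// fin_num_measure//; exact: mDB.
by rewrite -(big_morph EFin EFinM erefl).
Qed.

Lemma pastD k U V : past k U -> past k V -> past k (fun w => U w + V w).
Proof.
move=> [mU hU] [mV hV]; split=> [|B mB]; first exact: has_all_momentsD.
under eq_Rintegral do rewrite mulrDl.
have mP := moments_prod k mB.
by rewrite !ExpectationD ?hU ?hV ?mulrDl//; exact: has_all_momentsM.
Qed.

Lemma pastZ k c U : past k U -> past k (fun w => c * U w).
Proof.
move=> [mU hU]; split=> [|B mB]; first exact: has_all_momentsZ.
under eq_Rintegral do rewrite -mulrA.
have mP := moments_prod k mB.
by rewrite !ExpectationZ ?hU ?mulrA//; exact: has_all_momentsM.
Qed.

(** The factor [D k ^+ j] is integrated out while the later indicators stay in place, which gives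
    membership at stage k + 1. Taking all later sets to be the whole line gives the expectation. *)
Lemma past_expectationM k U j : (k < N)%N -> past k U ->
  past k.+1 (fun w => U w * D k w ^+ j) /\
  \int[P]_w (U w * D k w ^+ j) = \int[P]_w U w * m j.
Proof.
move=> kN [mU hU].
have mDk := has_all_momentsX j (mD kN).
have fac (B : nat -> set R) : (forall i, measurable (B i)) ->
    \int[P]_w ((U w * \prod_(k.+1 <= i < N) \1_(D i @^-1` B i) w) * D k w ^+ j) =
    \int[P]_w U w * \prod_(k.+1 <= i < N) fine (P (D i @^-1` B i)) * m j.
  move=> mB; rewrite -(momE j kN).
  apply: (@factor_expectation _ (D k) _ _ _ _ (fun x => x ^+ j)) => //.
  - by apply: has_all_momentsM => //; exact: moments_prod.
  - by case: (mD kN).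
  (* With an arbitrary set in slot k, [past k U] says that [U] times the later indicators factors
     against every event of [D k], as [factor_expectation] requires. *)
  - move=> B0 mB0; pose B' i := if i == k then B0 else B i.
    have mB' i : measurable (B' i) by rewrite /B'; case: ifP.
    have := hU B' mB'; rewrite [in RHS](big_ltn kN).
    have B'E : B' k = B0 by rewrite /B' eqxx.
    have eqB i : (k.+1 <= i < N)%N -> B' i = B i.
      by move=> /andP[ki _]; rewrite /B' gtn_eqF.
    rewrite B'E => h.
    rewrite -mulrA [X in _ = _ * X]mulrC.
    rewrite (eq_big_nat _ _ (F2 := fun i => fine (P (D i @^-1` B' i))));
      last first.
      by move=> i /eqB ->.
    rewrite -h; apply: eq_Rintegral => w _; rewrite [in RHS](big_ltn kN) B'E.
    rewrite -mulrA [X in _ * X]mulrC; congr (_ * (_ * _)).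
    by apply: eq_big_nat => i /eqB ->.
have E : \int[P]_w (U w * D k w ^+ j) = \int[P]_w U w * m j.
  have := fac (fun=> setT) (fun=> measurableT).
  rewrite [in RHS]big1 ?mulr1; last by move=> i _;
    rewrite preimage_setT probability_setT.
  move=> <-; apply: eq_Rintegral => w _; rewrite big1 ?mulr1// => i _.
  by rewrite preimage_setT indicT.
split=> //; split; first exact: has_all_momentsM.
move=> B mB; rewrite E mulrAC -fac//; apply: eq_Rintegral => w _; ring.
Qed.

End Factor.

(** * Power sums and elementary symmetric functions of independent variables *)

Section Newton.
Context (R : realType).
Implicit Types x : nat -> R.

Definition power_sum x (j k : nat) : R := \sum_(0 <= i < k) x i ^+ j.

(* [esym x k r] is the [r]-th elementary symmetric function of
   [x 0, ..., x (k - 1)], and [esym_pred x k r] that of order [r - 1]. *)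
Fixpoint esym x (k r : nat) : R :=
  if k is k'.+1 then
    esym x k' r + x k' * (if r is r'.+1 then esym x k' r' else 0)
  else (r == 0%N)%:R.

Definition esym_pred x (k r : nat) : R :=
  if r is r'.+1 then esym x k r' else 0.

Lemma esymS x k r : esym x k.+1 r = esym x k r + x k * esym_pred x k r.
Proof. by case: r. Qed.

Lemma esym0 x k : esym x k 0 = 1.
Proof. by elim: k => //= k ->; rewrite mulr0 addr0. Qed.

Lemma power_sumS x j k : power_sum x j k.+1 = power_sum x j k + x k ^+ j.
Proof. by rewrite /power_sum big_nat_recr. Qed.

Lemma power_sum0 x j : power_sum x j 0 = 0.
Proof. by rewrite /power_sum big_geq. Qed.

(** Induction on the number of variables. Expanding in the new variable gives four sums: two are
    induction hypotheses, at orders r + 1 and r, and the two carrying pure powers of [x k] cancel up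
    to the term [x k * esym x k r]. *)
Lemma newton_identity x k r :
  r.+1%:R * esym x k r.+1 =
  \sum_(i < r.+1) (-1) ^+ i * power_sum x i.+1 k * esym x k (r - i).
Proof.
elim: k r => [|k IHk] r.
  by rewrite /= mulr0 big1// => i _; rewrite power_sum0 mulr0 mul0r.
rewrite esymS [esym_pred _ _ _]/=.
under eq_bigr => i _ do rewrite power_sumS esymS.
have -> : \sum_(i < r.+1) (-1) ^+ i * (power_sum x i.+1 k + x k ^+ i.+1) *
    (esym x k (r - i) + x k * esym_pred x k (r - i)) =
  \sum_(i < r.+1) (-1) ^+ i * power_sum x i.+1 k * esym x k (r - i) +
  x k * \sum_(i < r.+1) (-1) ^+ i * power_sum x i.+1 k * esym_pred x k (r - i) +
  \sum_(i < r.+1) (-1) ^+ i * x k ^+ i.+1 * esym x k (r - i) +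
  \sum_(i < r.+1) (-1) ^+ i * x k ^+ i.+2 * esym_pred x k (r - i).
  rewrite mulr_sumr -!big_split/=; apply: eq_bigr => i _.
  by rewrite (exprS _ i.+1); ring.
rewrite -IHk big_ord_recr/= subnn mulr0 addr0.
rewrite [X in _ + X + _]big_ord_recl/= subn0 mul1r expr1.
rewrite [X in _ + _ + X]big_ord_recr/= subnn mulr0 addr0.
have -> : \sum_(i < r) (-1) ^+ i * power_sum x i.+1 k * esym_pred x k (r - i) =
    r%:R * esym x k r.
  case: r => [|r]; first by rewrite big_ord0 mul0r.
  rewrite IHk; apply: eq_bigr => i _; rewrite subSn//.
  by rewrite -ltnS ltn_ord.
set S3 := \sum_(i < r) _; set S4 := \sum_(i < r) _.
have S34 : S3 + S4 = 0.
  rewrite -big_split/= big1// => i _; rewrite /bump/= add1n subnS.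
  have: (0 < r - i)%N by rewrite subn_gt0.
  by case: (r - i)%N => // q _ /=; rewrite exprS; ring.
have -> : S4 = - S3 by apply/eqP; rewrite -addr_eq0 addrC S34.
by rewrite -natr1; ring.
Qed.

Lemma KS_power_sum x k r : KS r (fun j => power_sum x j k) = esym x k r.
Proof.
elim/ltn_ind: r => -[_|r IHr]; first by rewrite KS0 esym0.
rewrite KS_rec//; apply: (@mulfI _ r.+1%:R); first by rewrite pnatr_eq0.
rewrite newton_identity mulrA divff ?pnatr_eq0// mul1r big_add1/= big_mkord.
apply: eq_bigr => i _; rewrite subSS IHr ?ltnS ?leq_subr//.
by rewrite !exprS !mulrA !mulN1r opprK mul1r.
Qed.

End Newton.

(** * Moments of power sums and elementary symmetric functions of independent variables *)

Section Moments.
Context d (T : measurableType d) (R : realType) (P : probability T R).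
Variables (N : nat) (D : nat -> T -> R) (m : nat -> R).
Hypothesis mD : forall i, (i < N)%N -> has_all_moments P (D i).
Hypothesis indep : forall B : nat -> set R, (forall i, measurable (B i)) ->
  P (\bigcap_(i in `I_N) (D i @^-1` B i)) = (\prod_(i < N) P (D i @^-1` B i))%E.
Hypothesis momE : forall i k, (i < N)%N -> \int[P]_w (D i w ^+ k) = m k.
Local Notation past := (past P N D).
Local Notation S := (fun j k w => power_sum (D^~ w) j k).
Local Notation e := (fun a k w => esym (D^~ w) k a).
Local Notation ep := (fun a k w => esym_pred (D^~ w) k a).

Let pastM k U j : (k < N)%N -> past k U ->
  past k.+1 (fun w => U w * D k w ^+ j) /\
  \int[P]_w (U w * D k w ^+ j) = \int[P]_w U w * m j.
Proof. exact: past_expectationM. Qed.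

Lemma past_moments k U : past k U -> has_all_moments P U.
Proof. by case. Qed.

Lemma past_zero k : past k (fun=> 0).
Proof.
split=> [|B mB]; first exact: has_all_moments_cst.
under eq_Rintegral do rewrite mul0r.
by rewrite Expectation_cst mul0r.
Qed.

Lemma past_sum k (I : Type) (r : seq I) (F : I -> T -> R) :
  (forall i, past k (F i)) -> past k (fun w => \sum_(i <- r) F i w).
Proof.
move=> hF; elim: r => [|i r IHr].
  by under eq_fun do rewrite big_nil; exact: past_zero.
by under eq_fun do rewrite big_cons; exact: pastD.
Qed.

Lemma past_esymM k a b : (k <= N)%N -> past k (fun w => e a k w * e b k w).
Proof.
elim: k a b => [|k IHk] a b kN.
  by under eq_fun do rewrite /=; exact: past0.
have {}IHk a' b' : past k (fun w => e a' k w * e b' k w).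
  by apply: IHk; exact: ltnW.
have h a' b' : past k (fun w => e a' k w * ep b' k w).
  case: b' => [|b'] /=; last exact: IHk.
  by under eq_fun do rewrite mulr0; exact: past_zero.
have hp : past k (fun w => ep a k w * ep b k w).
  case: a => [|a] /=; last exact: h.
  by under eq_fun do rewrite mul0r; exact: past_zero.
rewrite (_ : (fun w => _) = fun w =>
   (e a k w * e b k w) * D k w ^+ 0 +
   ((e a k w * ep b k w + e b k w * ep a k w) * D k w ^+ 1 +
   (ep a k w * ep b k w) * D k w ^+ 2)); last first.
  by apply/funext => w; rewrite !esymS expr0 expr1; ring.
apply: pastD => //; first exact: (proj1 (pastM _ kN (IHk _ _))).
apply: pastD => //; last exact: (proj1 (pastM _ kN hp)).
by apply: (proj1 (pastM _ kN _)); exact: pastD.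
Qed.

(** Both factors are affine in the last variable. Its first power has mean 0, and its square
    multiplies the product of orders a - 1 and b - 1, which are again distinct. *)
Lemma Expectation_esymM k a b : m 1%N = 0 -> (k <= N)%N -> a != b ->
  \int[P]_w (e a k w * e b k w) = 0.
Proof.
move=> m1; elim: k a b => [|k IHk] a b kN ab.
  rewrite /=; under eq_Rintegral do rewrite /=.
  rewrite Expectation_cst -natrM; case: a b ab => [|a] [|b]//=.
have mo a' b' : past k (fun w => e a' k w * e b' k w).
  by apply: past_esymM; exact: ltnW.
have {}IHk a' b' : a' != b' -> \int[P]_w (e a' k w * e b' k w) = 0.
  by apply: IHk; exact: ltnW.
have h a' b' : past k (fun w => e a' k w * ep b' k w).
  case: b' => [|b'] /=; last exact: mo.
  by under eq_fun do rewrite mulr0; exact: past_zero.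
have hp : past k (fun w => ep a k w * ep b k w).
  case: a {ab} => [|a] /=; last exact: h.
  by under eq_fun do rewrite mul0r; exact: past_zero.
have Ep : \int[P]_w (ep a k w * ep b k w) = 0.
  case: a b ab {hp} => [|a] [|b]//= ab.
  - by under eq_Rintegral do rewrite mul0r; rewrite Expectation_cst.
  - by under eq_Rintegral do rewrite mulr0; rewrite Expectation_cst.
  - exact: IHk.
under eq_Rintegral => w _.
  rewrite (_ : _ * _ = (e a k w * e b k w) +
   ((e a k w * ep b k w + e b k w * ep a k w) * D k w ^+ 1 +
   (ep a k w * ep b k w) * D k w ^+ 2)); last by rewrite !esymS expr1; ring.
  over.
have hs := pastD mD (h a b) (h b a).
have [p1 E1] := pastM 1 kN hs; have [p2 E2] := pastM 2 kN hp.
rewrite ExpectationD; last 2 first.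
- exact: past_moments (mo _ _).
- by apply: has_all_momentsD; [exact: past_moments p1|exact: past_moments p2].
rewrite ExpectationD; [|exact: past_moments p1|exact: past_moments p2].
by rewrite IHk// E1 E2 m1 Ep mulr0 mul0r !addr0.
Qed.

Lemma past_esym k a : (k <= N)%N -> past k (fun w => e a k w).
Proof.
move=> kN; have := past_esymM a 0 kN.
by under eq_fun do rewrite esym0 mulr1.
Qed.

Lemma Expectation_esym k a : m 1%N = 0 -> (k <= N)%N ->
  \int[P]_w (e a k w) = (a == 0%N)%:R.
Proof.
move=> m1 kN; have [->|a0] := eqVneq a 0%N.
  by under eq_Rintegral do rewrite esym0; rewrite Expectation_cst.
have := Expectation_esymM m1 kN a0.
by under eq_Rintegral do rewrite esym0 mulr1.
Qed.

Lemma past_power_sumM_esym k j a : (k <= N)%N ->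
  past k (fun w => S j k w * e a k w).
Proof.
elim: k a => [|k IHk] a kN.
  by under eq_fun do rewrite power_sum0 mul0r; exact: past_zero.
have {}IHk a' : past k (fun w => S j k w * e a' k w).
  by apply: IHk; exact: ltnW.
have he a' : past k (fun w => e a' k w) by apply: past_esym; exact: ltnW.
have hep : past k (fun w => ep a k w).
  by case: a => [|a] /=; [exact: past_zero|exact: he].
have hp : past k (fun w => S j k w * ep a k w).
  case: a {hep} => [|a] /=; last exact: IHk.
  by under eq_fun do rewrite mulr0; exact: past_zero.
rewrite (_ : (fun w => _) = fun w =>
   (S j k w * e a k w) * D k w ^+ 0 +
   (S j k w * ep a k w * D k w ^+ 1 +
   (e a k w * D k w ^+ j + ep a k w * D k w ^+ j.+1))); last first.
  by apply/funext => w; rewrite !esymS power_sumS expr0 expr1 exprS; ring.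
apply: pastD => //; first exact: (proj1 (pastM _ kN (IHk _))).
apply: pastD => //; first exact: (proj1 (pastM _ kN hp)).
apply: pastD => //; first exact: (proj1 (pastM _ kN (he _))).
exact: (proj1 (pastM _ kN hep)).
Qed.

(** In the expansion in the last variable, the term in its first power vanishes by centering and
    [D k ^+ j] multiplies [esym] of order a >= 1, of mean 0. What a new variable adds is [m j.+1]
    times the mean of [esym] of order a - 1, nonzero only if a = 1. *)
Lemma Expectation_power_sumM_esym k j a : m 1%N = 0 -> (k <= N)%N -> (0 < a)%N ->
  \int[P]_w (S j k w * e a k w) = (a == 1%N)%:R * k%:R * m j.+1.
Proof.
move=> m1; elim: k a => [|k IHk] a kN a0.
  by under eq_Rintegral do rewrite power_sum0 mul0r;
    rewrite Expectation_cst mulr0 mul0r.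
have kN' : (k <= N)%N by exact: ltnW.
have he a' : past k (fun w => e a' k w) by exact: past_esym.
have hp a' : past k (fun w => S j k w * e a' k w) by exact: past_power_sumM_esym.
case: a a0 => [//|a _].
under eq_Rintegral => w _.
  rewrite (_ : _ * _ = (S j k w * e a.+1 k w) +
   (S j k w * e a k w * D k w ^+ 1 +
   (e a.+1 k w * D k w ^+ j + e a k w * D k w ^+ j.+1))); last first.
    by rewrite esymS power_sumS expr1 exprS/=; ring.
  over.
have [p1 E1] := pastM 1 kN (hp a).
have [p2 E2] := pastM j kN (he a.+1).
have [p3 E3] := pastM j.+1 kN (he a).
rewrite ExpectationD; last 2 first.
- exact: past_moments (hp _).
- apply: has_all_momentsD; first exact: past_moments p1.
  by apply: has_all_momentsD; [exact: past_moments p2|exact: past_moments p3].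
rewrite ExpectationD; last 2 first.
- exact: past_moments p1.
- by apply: has_all_momentsD; [exact: past_moments p2|exact: past_moments p3].
rewrite ExpectationD; [|exact: past_moments p2|exact: past_moments p3].
rewrite IHk// E1 E2 E3 m1 mulr0 !Expectation_esym//= eqSS.
by rewrite -(natr1 k); ring.
Qed.

Lemma past_power_sumX k j r : (k <= N)%N -> past k (fun w => S j k w ^+ r).
Proof.
elim: k r => [|k IHk] r kN.
  by under eq_fun do rewrite power_sum0; exact: past0.
rewrite (_ : (fun w => _) = fun w =>
   \sum_(i < r.+1) 'C(r, i)%:R * (S j k w ^+ (r - i) * D k w ^+ (j * i)));
     last first.
  apply/funext => w; rewrite power_sumS exprDn; apply: eq_bigr => i _.
  by rewrite exprM mulr_natl.
apply: past_sum => i.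
apply: pastZ => //; apply: (proj1 (pastM _ kN _)).
by apply: IHk; exact: ltnW.
Qed.

Lemma Expectation_power_sumX k j r : (k < N)%N ->
  \int[P]_w (S j k.+1 w ^+ r) =
  \sum_(i < r.+1) 'C(r, i)%:R * (\int[P]_w (S j k w ^+ (r - i)) * m (j * i)%N).
Proof.
move=> kN.
have hS r' : past k (fun w => S j k w ^+ r') by apply: past_power_sumX;
  exact: ltnW.
under eq_Rintegral => w _.
  rewrite (_ : _ ^+ _ = \sum_(i < r.+1) 'C(r, i)%:R *
      (S j k w ^+ (r - i) * D k w ^+ (j * i))); last first.
    rewrite power_sumS exprDn; apply: eq_bigr => i _.
    by rewrite exprM mulr_natl.
  over.
rewrite Expectation_sum; last first.
  move=> i _; apply: has_all_momentsZ.
  exact: past_moments (proj1 (pastM _ kN (hS _))).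
apply: eq_bigr => i _; have [p E] := pastM (j * i) kN (hS (r - i)%N).
by rewrite ExpectationZ ?E//; exact: past_moments p.
Qed.

Lemma moment0 k : (k < N)%N -> m 0%N = 1.
Proof.
move=> /(momE 0) <-; under eq_Rintegral do rewrite expr0.
exact: Expectation_cst.
Qed.

Let sum_binom_le (r : nat) (F : nat -> R) (G : R) : 0 <= G ->
  (forall i, (0 < i <= r)%N -> `|F i| <= G) ->
  `|\sum_(i < r) 'C(r, i.+1)%:R * F i.+1| <= 2 ^+ r * G.
Proof.
move=> G0 FG; rewrite (le_trans (ler_norm_sum _ _ _))//.
have -> : 2 ^+ r = \sum_(i < r.+1) ('C(r, i)%:R : R).
  rewrite -[2]/(1 + 1) exprDn; apply: eq_bigr => i _.
  by rewrite !expr1n mul1r.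
rewrite mulr_suml big_ord_recl/= -[leLHS]add0r lerD//.
  by rewrite mulr_ge0.
apply: ler_sum => i _; rewrite /bump/= add1n normrM normr_nat.
by rewrite ler_wpM2l// FG//= ltn_ord.
Qed.

(* Discrete Gronwall inequality for the vector of the first [r] moments. *)
Lemma power_sum_moment_le (j r : nat) (c : R) : 0 <= c ->
  (forall l, (0 < l <= r)%N -> `|m (j * l)%N| <= c) ->
  forall k, (k <= N)%N -> forall l, (l <= r)%N ->
  `|\int[P]_w (S j k w ^+ l)| <= (1 + 2 ^+ r * c) ^+ k.
Proof.
move=> c0 mc.
have G1 : 1 <= 1 + 2 ^+ r * c by rewrite lerDl mulr_ge0// exprn_ge0.
have G0 : 0 <= 1 + 2 ^+ r * c by exact: le_trans G1.
elim=> [|k IHk] kN l lr.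
  under eq_Rintegral do rewrite power_sum0.
  by rewrite Expectation_cst expr0n; case: l lr => //= *; rewrite ?normr0 ?normr1.
rewrite Expectation_power_sumX// big_ord_recl/= bin0 mul1r subn0 muln0.
rewrite (moment0 kN) mulr1 (le_trans (ler_normD _ _))//.
rewrite exprS mulrDl mul1r lerD//; first by apply: IHk => //; exact: ltnW.
have Gk0 : 0 <= (1 + 2 ^+ r * c) ^+ k by exact: exprn_ge0.
under eq_bigr => i _ do rewrite /bump/= add1n.
apply: le_trans (@sum_binom_le l (fun i => \int[P]_w (S j k w ^+ (l - i)) *
    m (j * i)%N) (c * (1 + 2 ^+ r * c) ^+ k) _ _) _.
- exact: mulr_ge0.
- move=> i /andP[i0 il]; rewrite normrM mulrC ler_pM//.
    by apply: mc; rewrite i0 (leq_trans il).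
  by apply: IHk; [exact: ltnW|rewrite (leq_trans (leq_subr _ _))].
- rewrite mulrA ler_wpM2r// ler_wpM2r// ler_weXn2l//.
  by rewrite ler1n.
Qed.

(** Once N m_r is removed, every term of the expansion carries a moment of order strictly between 0
    and r. As the bound involves only those, it supports an induction on the order of the
    moments. *)
Lemma first_moment_gap (r : nat) (c : R) : 0 <= c -> (0 < r)%N ->
  (forall l, (0 < l < r)%N -> `|m l| <= c) ->
  `|\int[P]_w (S 1 N w ^+ r) - N%:R * m r| <=
  N%:R * (2 ^+ r * (c * (1 + 2 ^+ r * c) ^+ N)).
Proof.
move=> c0 r0 mc.
have G1 : 1 <= 1 + 2 ^+ r * c by rewrite lerDl mulr_ge0// exprn_ge0.
have G0 : 0 <= 1 + 2 ^+ r * c by exact: le_trans G1.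
suff : forall k, (k <= N)%N -> `|\int[P]_w (S 1 k w ^+ r) - k%:R * m r| <=
    k%:R * (2 ^+ r * (c * (1 + 2 ^+ r * c) ^+ N)) by exact.
elim=> [|k IHk] kN.
  under eq_Rintegral do rewrite power_sum0.
  by rewrite Expectation_cst expr0n eqn0Ngt r0 !mul0r subr0 normr0.
rewrite Expectation_power_sumX// big_ord_recl/= bin0 mul1r subn0 muln0.
rewrite (moment0 kN) mulr1.
under eq_bigr => i _ do rewrite /bump/= add1n mul1n.
case: r r0 mc G1 G0 IHk => // r _ mc G1 G0 IHk.
rewrite big_ord_recr/= subnn binn mul1r.
under [X in `|_ + (_ + X * _) - _|]eq_Rintegral do rewrite expr0.
rewrite Expectation_cst mul1r -(natr1 k) !mulrDl !mul1r.
set A := \int[P]_w _; set B := \sum_(i < r) _.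
have -> : A + (B + m r.+1) - (k%:R * m r.+1 + m r.+1) = (A - k%:R * m r.+1) + B
  by ring.
rewrite (le_trans (ler_normD _ _))// lerD//; first by apply: IHk; exact: ltnW.
(* The top binomial term is [m r.+1] itself, already cancelled; putting 0 in its place lets
   [sum_binom_le] be applied to the full range. *)
pose F i := (if (i == r.+1)%N then 0 else
   \int[P]_w (S 1 k w ^+ (r.+1 - i)) * m i).
have -> : B = \sum_(i < r.+1) 'C(r.+1, i.+1)%:R * F i.+1.
  rewrite big_ord_recr/= {2}/F eqxx mulr0 addr0; apply: eq_bigr => i _.
  by rewrite /F eqSS ltn_eqF.
apply: sum_binom_le; first by rewrite mulr_ge0// exprn_ge0.
move=> i /andP[i0 ir]; rewrite /F; case: eqP => [_|/eqP ir1].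
  by rewrite normr0 mulr_ge0// exprn_ge0.
have ilt : (i < r.+1)%N by rewrite ltn_neqAle ir1.
rewrite normrM mulrC ler_pM//; first by apply: mc; rewrite i0.
apply: (@le_trans _ _ ((1 + 2 ^+ r.+1 * c) ^+ k)); last first.
  by rewrite ler_weXn2l//; exact: ltnW.
apply: le_trans (@power_sum_moment_le 1 r c c0 _ k _ (r.+1 - i)%N _) _.
- by move=> l /andP[l0 lr]; rewrite mul1n mc// l0.
- exact: ltnW.
- by case: (i) i0 => // q _; rewrite subSS leq_subr.
- rewrite lerXn2r ?nnegrE//; first by rewrite addr_ge0// mulr_ge0// exprn_ge0.
  by rewrite lerD2l ler_wpM2r// ler_weXn2l// ler1n.
Qed.

End Moments.

(** * Jumps of cadlag paths *)

Section Cadlag.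
Context (R : realType).
Implicit Types (f g : R -> R) (t x s u v : R).

Lemma cvg_big_seq (I : eqType) (r : seq I) (F : nat -> I -> R) (l : I -> R) :
  (forall i, i \in r -> F n i @[n --> \oo] --> l i) ->
  \sum_(i <- r) F n i @[n --> \oo] --> \sum_(i <- r) l i.
Proof.
elim: r => [_|i r IHr Fl].
  by rewrite big_nil; under eq_fun do rewrite big_nil; exact: cvg_cst.
rewrite big_cons; under eq_fun do rewrite big_cons.
apply: cvgD; first by apply: Fl; rewrite mem_head.
by apply: IHr => j jr; apply: Fl; rewrite inE jr orbT.
Qed.

Lemma near_left_ex (x : R) (Q : R -> Prop) : (\forall r \near x^'-, Q r) ->
  exists2 e : R, 0 < e & forall r, x - e < r -> r < x -> Q r.
Proof.
move=> [e /= e0 H]; exists e => // r xr rx; apply: H => //=.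
by rewrite ger0_norm ?subr_ge0 ?ltW// ltrBlDr -ltrBlDl.
Qed.

Lemma near_right_ex (x : R) (Q : R -> Prop) : (\forall r \near x^'+, Q r) ->
  exists2 e : R, 0 < e & forall r, x < r -> r < x + e -> Q r.
Proof.
move=> [e /= e0 H]; exists e => // r xr rx; apply: H => //=.
by rewrite distrC ger0_norm ?subr_ge0 ?ltW// ltrBlDl.
Qed.

Definition path_jump f (s : R) : R := f s - lim (f r @[r --> s^'-]).

Definition grid_point (t : R) (N i : nat) : R := t * (i%:R / N%:R).

Definition grid_incr f (t : R) (N i : nat) : R :=
  f (grid_point t N i.+1) - f (grid_point t N i).

(** The oscillation is small separately on the two sides of x, by the left limit and by right
    continuity; the point x itself belongs to the right side. *)
Lemma cadlag_oscillation f (eta x : R) : cadlag f -> 0 < eta -> 0 <= x ->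
  exists2 e : R, 0 < e & forall u v, 0 <= u -> 0 <= v ->
    (x - e < u < x /\ x - e < v < x) \/ (x <= u < x + e /\ x <= v < x + e) ->
    `|f u - f v| < eta.
Proof.
move=> [rf lf] eta0 x0.
have eta2 : 0 < eta / 2 by rewrite divr_gt0.
have tri l u v : `|l - f u| < eta / 2 -> `|l - f v| < eta / 2 ->
  `|f u - f v| < eta.
  move=> lu lv; rewrite (_ : f u - f v = (l - f v) - (l - f u)); last by ring.
  rewrite (le_lt_trans (ler_normB _ _))// (_ : eta = eta / 2 + eta / 2).
    exact: ltrD.
  by field.
have [e1 e10 H1] : exists2 e : R, 0 < e & forall u, x <= u < x + e ->
  `|f x - f u| < eta / 2.
  have /cvgrPdist_lt /(_ _ eta2) /near_right_ex[e e0 H] := rf x x0.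
  exists e => // u /andP[]; rewrite le_eqVlt => /predU1P[<- _|xu ue];
    last exact: H.
  by rewrite subrr normr0.
have [e2 e20 [l H2]] : exists2 e : R, 0 < e & exists l, forall u, 0 <= u ->
    x - e < u < x -> `|l - f u| < eta / 2.
  (* At x = 0 there are no nonnegative points to the left, so any value serves as the left limit. *)
  move: x0; rewrite le_eqVlt => /predU1P[x00|x0].
    by exists 1 => //; exists 0 => u u0; rewrite -x00 => /andP[_];
      rewrite ltNge u0.
  have /cvgrPdist_lt /(_ _ eta2) /near_left_ex[e e0 H] := lf x x0.
  by exists e => //; eexists => u u0 /andP[xu ux]; exact: H.
exists (Num.min e1 e2); first by rewrite lt_min e10.
move=> u v u0 v0 [[/andP[xu ux] /andP[xv vx]]|[/andP[xu ux] /andP[xv vx]]].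
  by apply: (tri l); apply: H2 => //; apply/andP; split=> //;
    rewrite (le_lt_trans _ xu, le_lt_trans _ xv)// lerD2l lerN2 ge_min lexx orbT.
by apply: (tri (f x)); apply: H1; apply/andP; split=> //;
    rewrite (lt_le_trans ux, lt_le_trans vx)// lerD2l ge_min lexx.
Qed.

(** Compactness of [0, t], covered by balls of half the radius on which the oscillation is
    controlled. The half left over absorbs v - u < e, so an increment that is not small must
    straddle one of the finitely many centres. *)
Lemma cadlag_finite f (eta t : R) : cadlag f -> 0 < eta -> 
  exists F : seq R, exists2 e : R, 0 < e & forall u v, 0 <= u -> u <= v ->
    v <= t ->
    v - u < e -> `|f v - f u| < eta \/ exists2 x, x \in F & u < x <= v.
Proof.
move=> cf eta0.
pose Q (x e : R) := 0 < e /\ (forall u v, 0 <= u -> 0 <= v ->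
    (x - e < u < x /\ x - e < v < x) \/ (x <= u < x + e /\ x <= v < x + e) ->
    `|f u - f v| < eta).
have exQ x : exists e, 0 <= x -> Q x e.
  have [x0|x0] := leP 0 x; last by exists 1.
  by have [e e0 H] := cadlag_oscillation cf eta0 x0; exists e.
have [dl Hdl] := choice exQ.
have := @segment_compact R 0 t; rewrite compact_cover.
move=> /(_ R `[0, t]%classic (fun x => ball x (dl x / 2))) [].
- by move=> x _; exact: ball_open.
- move=> x /= xt; exists x => //; apply: ballxx.
  by move: xt; rewrite in_itv/= => /andP[x0 _]; have [? _] := Hdl x x0;
    rewrite divr_gt0.
move=> D Dsub Dcov; exists (finmap.enum_fset D).
have [e e0 He] : exists2 e : R, 0 < e & forall x,
  x \in finmap.enum_fset D -> e <= dl x / 2.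
  have : forall x, x \in finmap.enum_fset D -> 0 < dl x / 2.
    move=> x xD; have := Dsub x xD; rewrite inE/= in_itv/= => /andP[x0 _].
    by have [? _] := Hdl x x0; rewrite divr_gt0.
  elim: (finmap.enum_fset D) => [|x s IHs] H; first by exists 1.
  have [e e0 He] := IHs (fun y ys => H y (mem_behead (s := x :: s) ys)).
  exists (Num.min (dl x / 2) e); first by rewrite lt_min e0 H// mem_head.
  move=> y; rewrite inE => /predU1P[->|ys]; first by rewrite ge_min lexx.
  by rewrite ge_min He ?orbT.
exists e => // u v u0 uv vt uve.
have : `[0, t]%classic u by rewrite /= in_itv/= u0 (le_trans uv).
move=> /Dcov[x /= xD]; rewrite /ball/= => xu.
have x0 : 0 <= x by have := Dsub x xD; rewrite inE/= in_itv/= => /andP[].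
have [dx0 osc] := Hdl x x0.
have := He x xD => ex.
have [vx|xv] := ltP v x.
  left; apply: osc => //; first exact: le_trans uv.
  move: xu; rewrite ltr_norml => /andP[xu1 xu2]; left.
  by split; apply/andP; split; lra.
have [ux|xu'] := ltP u x; first by right; exists x => //; rewrite ux.
left; apply: osc => //; first exact: le_trans uv.
move: xu; rewrite ltr_norml => /andP[xu1 xu2]; right.
by split; apply/andP; split; lra.
Qed.

(** As [F] is finite, a left neighbourhood of s is free of its points. The increments ending at s
    are below eta there, and the jump is their limit. *)
Lemma small_path_jump f (eta t : R) (F : seq R) (e : R) : cadlag f -> 0 < e ->
  (forall u v, 0 <= u -> u <= v -> v <= t ->
    v - u < e -> `|f v - f u| < eta \/ exists2 x, x \in F & u < x <= v) ->
  forall s, 0 < s -> s <= t -> s \notin F -> `|path_jump f s| <= eta.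
Proof.
move=> [_ lf] e0 osc s s0 st sF.
have [e1 e10 He1] : exists2 e1 : R, 0 < e1 & forall x, x \in F ->
  x <= s - e1 \/ s < x.
  elim: F sF {osc} => [_|x F IHF]; first by exists 1.
  rewrite inE negb_or => /andP[sx /IHF[e1 e10 He1]].
  have [sx'|xs] := ltP s x.
    exists e1 => // y; rewrite inE => /predU1P[->|/He1//]; by right.
  have xs' : x < s by rewrite lt_neqAle xs eq_sym sx.
  exists (Num.min e1 (s - x)); first by rewrite lt_min e10 subr_gt0.
  move=> y; rewrite inE => /predU1P[->|/He1[ys|]]; [left|left|by right].
    by rewrite lerBrDl -lerBrDr ge_min lexx orbT.
  by rewrite (le_trans ys)// lerD2l lerN2 ge_min lexx.
have cl := lf s s0.
have cj : `|f s - f r| @[r --> s^'-] --> `|path_jump f s|.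
  by apply: cvg_norm; apply: cvgB => //; exact: cvg_cst.
have <- := cvg_lim (@Rhausdorff R) cj.
apply: limr_le; first by apply/cvg_ex; eexists; exact: cj.
pose e2 := Num.min (Num.min e e1) s.
have e20 : 0 < e2 by rewrite !lt_min e0 e10 s0.
have e2e : e2 <= e by rewrite /e2 !ge_min lexx.
have e2e1 : e2 <= e1 by rewrite /e2 !ge_min lexx orbT.
have e2s : e2 <= s by rewrite /e2 !ge_min lexx orbT.
exists e2 => // r /= sre rs.
have sr : s - r < e2 by move: sre; rewrite ger0_norm// subr_ge0 ltW.
apply/ltW; have [||||//|[x xF /andP[rx xs]]] := osc r s.
- lra.
- exact: ltW.
- by [].
- lra.
- by have [|] := He1 x xF; lra.
Qed.

Lemma near_divn_lt (t e : R) : 0 < e -> \forall N \near \oo, t / N%:R < e.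
Proof.
move=> e0.
have [t0|t0] := leP t 0.
  by apply: nearW => N; rewrite (le_lt_trans _ e0)// mulr_le0_ge0.
near=> N.
have N0 : (0 < N)%N by near: N; exact: nbhs_infty_gt.
rewrite ltr_pdivrMr ?ltr0n// mulrC -ltr_pdivrMr//.
by near: N; exact: nbhs_infty_gtr.
Unshelve. all: by end_near. Qed.

Lemma grid_pointS t N i : (0 < N)%N ->
  grid_point t N i.+1 = grid_point t N i + t / N%:R.
Proof. by move=> N0; rewrite /grid_point -natr1; field;
  rewrite pnatr_eq0 -lt0n. Qed.

Lemma grid_point_ge0 t N i : 0 <= t -> 0 <= grid_point t N i.
Proof. by move=> t0; rewrite /grid_point mulr_ge0. Qed.

Lemma grid_point_le t N i j : 0 <= t -> (i <= j)%N ->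
  grid_point t N i <= grid_point t N j.
Proof.
by move=> t0 ij; rewrite /grid_point ler_wpM2l// ler_wpM2r// ler_nat.
Qed.

Lemma grid_point0 t N : grid_point t N 0 = 0.
Proof. by rewrite /grid_point mul0r mulr0. Qed.

Lemma grid_pointN t N : (0 < N)%N -> grid_point t N N = t.
Proof. by move=> N0; rewrite /grid_point divff ?mulr1// pnatr_eq0 -lt0n. Qed.

Lemma grid_cell t N x : (0 < N)%N -> 0 < x -> x <= t ->
  exists2 i, (i < N)%N & grid_point t N i < x <= grid_point t N i.+1.
Proof.
move=> N0 x0 xt.
suff H k : (k <= N)%N -> x <= grid_point t N k ->
    exists2 i, (i < k)%N & grid_point t N i < x <= grid_point t N i.+1.
  by apply: H => //; rewrite grid_pointN.
elim: k => [|k IHk] kN; first by rewrite grid_point0 leNgt x0.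
have [xk _|kx xk] := leP x (grid_point t N k); last by exists k => //; rewrite kx.
by have [i ik xi] := IHk (ltnW kN) xk; exists i => //; exact: ltnW.
Qed.

Lemma grid_cell_uniq t N x i j : 0 <= t ->
  grid_point t N i < x <= grid_point t N i.+1 ->
  grid_point t N j < x <= grid_point t N j.+1 -> i = j.
Proof.
move=> t0 /andP[ix xi] /andP[jx xj]; apply/eqP;
  rewrite eqn_leq (leqNgt i) (leqNgt j).
apply/andP; split; apply/negP => /(grid_point_le N t0) ij.
  by have := lt_le_trans ix (le_trans xj ij); rewrite ltxx.
by have := lt_le_trans jx (le_trans xi ij); rewrite ltxx.
Qed.

(** The cell around x has its left end strictly before x and its right end at or after x. The left
    limit and right continuity thus make its increment tend to the jump at x. *)
Lemma cvg_grid_cell f g (t x : R) : cadlag f -> continuous g -> 0 < x -> x <= t ->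
  \sum_(i < N) (if grid_point t N i < x <= grid_point t N i.+1
                then g (grid_incr f t N i) else 0) @[N --> \oo] -->
  g (path_jump f x).
Proof.
move=> [rf lf] cg x0 xt; have t0 : 0 <= t by rewrite ltW// (lt_le_trans x0).
apply/cvgrPdist_lt => e e0.
have /cvgrPdist_lt /(_ e e0) [r /= r0 Hr] := cg (path_jump f x).
have r2 : 0 < r / 2 by rewrite divr_gt0.
have /cvgrPdist_lt /(_ _ r2) /near_right_ex[e1 e10 H1] := rf x (ltW x0).
have /cvgrPdist_lt /(_ _ r2) /near_left_ex[e2 e20 H2] := lf x x0.
near=> N.
have N0 : (0 < N)%N by near: N; exact: nbhs_infty_gt.
have [i iN xi] := grid_cell N0 x0 xt.
rewrite (bigD1 (Ordinal iN))//= xi big1 ?addr0; last first.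
  move=> j ji; case: ifP => // xj.
  by have := grid_cell_uniq t0 xi xj => ij; case/eqP: ji; apply/val_inj.
move: (xi) => /andP[ix xi']; apply: Hr => /=.
have tN1 : t / N%:R < e1 by near: N; exact: near_divn_lt.
have tN2 : t / N%:R < e2 by near: N; exact: near_divn_lt.
have gS := grid_pointS t i N0.
rewrite /path_jump /grid_incr; set l := lim _.
set v := grid_point t N i.+1; set u := grid_point t N i.
have fv : `|f x - f v| < r / 2.
  move: xi'; rewrite le_eqVlt => /predU1P[xv|xv];
    first by rewrite /v -xv subrr normr0.
  by apply: H1 => //; rewrite /v gS; lra.
have fu : `|l - f u| < r / 2 by apply: H2 => //; rewrite /u; lra.
rewrite (_ : _ - _ = (f x - f v) - (l - f u)); last by ring.
rewrite (le_lt_trans (ler_normB _ _))// (_ : r = r / 2 + r / 2); last by field.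
exact: ltrD.
Unshelve. all: by end_near. Qed.

(** When the mesh does not exceed the distances between points of [F], a cell contains at most one
    of them, so a nonzero contribution is counted exactly once. *)
Lemma big_grid_cell (F : seq R) (t : R) (N i : nat) (y : R) : uniq F ->
  (forall x x', x \in F -> x' \in F -> x != x' -> t / N%:R <= `|x - x'|) ->
  (0 < N)%N ->
  (y != 0 -> exists2 x, x \in F & grid_point t N i < x <= grid_point t N i.+1) ->
  \sum_(x <- F) (if grid_point t N i < x <= grid_point t N i.+1
                 then y else 0) = y.
Proof.
move=> uF sepF N0 Hy; have [->|y0] := eqVneq y 0.
  by rewrite big1// => x _; case: ifP.
have [x xF xi] := Hy y0.
rewrite (bigD1_seq x)//= xi big1_seq ?addr0// => x' /andP[xx' x'F].
case: ifP => // xi'; have := sepF _ _ xF x'F; rewrite eq_sym => /(_ xx').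
move: xi xi'; rewrite grid_pointS// => /andP[? ?] /andP[? ?].
by rewrite ler_normr => /orP[]; lra.
Qed.

(** As g vanishes on [-eta, eta], both sides are carried by a finite set: jumps outside it are at
    most eta, and fine cells avoiding it have increments below eta. The grid sum is eventually a sum
    over these points of single-cell terms. *)
Lemma cvg_grid_sum f g (t eta : R) : cadlag f -> continuous g ->
  (forall x, 0 <= g x) -> 0 < eta -> (forall x, `|x| <= eta -> g x = 0) ->
    0 <= t ->
  exists2 L : R, (\esum_(s in `]0%R, t]%classic) (g (path_jump f s))%:E =
    L%:E)%E &
    \sum_(i < N) g (grid_incr f t N i) @[N --> \oo] --> L.
Proof.
move=> cf cg g0 eta0 geta t0.
have [F0 [e e0 osc]] := cadlag_finite t cf eta0.
pose F := undup [seq x <- F0 | 0 < x <= t].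
have Ft x : x \in F -> 0 < x <= t by rewrite mem_undup mem_filter => /andP[].
exists (\sum_(x <- F) g (path_jump f x)).
  have -> : (\esum_(s in `]0%R, t]%classic) (g (path_jump f s))%:E =
      \esum_(s in [set` F]) (g (path_jump f s))%:E)%E.
    rewrite (esum_mkcond [set` F]) esum_mkcond; apply: eq_esum => s _.
    case: ifPn => st; case: ifPn => sF //.
      rewrite geta//; move: st; rewrite inE/= in_itv/= => /andP[s0 st].
      apply: (small_path_jump cf e0 osc) => //.
      apply: contra sF => sF0; rewrite inE/= mem_undup mem_filter s0 st.
      exact: sF0.
    by move: sF st; rewrite inE/= => /Ft h; rewrite notin_setE/= in_itv/= h.
  rewrite esum_fset; last 2 first.
  - exact: finite_seq.
  - by move=> x _; rewrite lee_fin.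
  by rewrite -fsbig_seq ?undup_uniq//= sumEFin.
have : \sum_(x <- F) \sum_(i < N) (if grid_point t N i < x <= grid_point t N i.+1
      then g (grid_incr f t N i) else 0) @[N --> \oo] -->
    \sum_(x <- F) g (path_jump f x).
  by apply: cvg_big_seq => x /Ft/andP[x0 xt]; exact: cvg_grid_cell.
apply: cvg_trans; apply: near_eq_cvg.
have [e' e'0 sep] : exists2 e' : R, 0 < e' & forall x x', x \in F -> x' \in F ->
    x != x' -> e' <= `|x - x'|.
  have [e' e'0 He'] : exists2 e' : R, 0 < e' & forall p, p \in [seq (x,
    y) | x <- F, y <- F] ->
      p.1 != p.2 -> e' <= `|p.1 - p.2|.
    elim: [seq (x, y) | x <- F, y <- F] => [|[x y] s [e' e'0 IHs]];
      first by exists 1.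
    have [xy|xy] := eqVneq x y.
      exists e' => // p; rewrite inE => /predU1P[->/=|/IHs//].
      by rewrite xy eqxx.
    exists (Num.min e' `|x - y|); first by rewrite lt_min e'0 normr_gt0 subr_eq0.
    move=> p; rewrite inE => /predU1P[->/= _|/IHs h /h h']; rewrite ge_min.
      by rewrite lexx orbT.
    by rewrite h'.
  exists e' => // x x' xF x'F xx'; apply: (He' (x, x')) => //.
  exact: allpairs_f.
near=> N.
have N0 : (0 < N)%N by near: N; exact: nbhs_infty_gt.
rewrite exchange_big/=; apply: eq_bigr => i _; apply: big_grid_cell => //.
- exact: undup_uniq.
- move=> x x' xF x'F xx'; apply: le_trans (sep _ _ xF x'F xx').
  by apply/ltW; near: N; exact: near_divn_lt.
- move=> gi.
  have tNe : t / N%:R < e by near: N; exact: near_divn_lt.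
  have u0 : 0 <= grid_point t N i by exact: grid_point_ge0.
  have vt : grid_point t N i.+1 <= t.
    by rewrite -[leRHS](grid_pointN t N0) grid_point_le.
  have uv : grid_point t N i <= grid_point t N i.+1 by exact: grid_point_le.
  have [|small|[x xF xi]] := osc _ _ u0 uv vt.
  + by rewrite grid_pointS// addrAC subrr add0r.
  + by move: gi; rewrite geta ?eqxx// ltW.
  + exists x => //; rewrite mem_undup mem_filter xF andbT.
    move: xi => /andP[ix xi]; rewrite (le_lt_trans u0 ix)/=.
    exact: le_trans vt.
Unshelve. all: by end_near. Qed.

End Cadlag.

(** * Power sums of the jumps as limits of grid sums *)

Section JumpSums.
Context (R : realType).
Implicit Types (f : R -> R) (t x : R).

(* The positive part of [c x^j], to be used with [c = 1] and [c = -1]. *)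
Definition signed_power (c : R) (j : nat) x : R := Num.max (c * x ^+ j) 0.

(* As [3 <= j], the cutoff [harmonic k ^+ 3] makes the truncation error at most
   [harmonic k * x ^+ 2], which the quadratic variation controls. *)
Definition truncated_power (c : R) (j k : nat) x : R :=
  Num.max (signed_power c j x - harmonic k ^+ 3) 0.

Lemma signed_power_ge0 c j x : 0 <= signed_power c j x.
Proof. by rewrite /signed_power le_max lexx orbT. Qed.

Lemma truncated_power_ge0 c j k x : 0 <= truncated_power c j k x.
Proof. by rewrite /truncated_power le_max lexx orbT. Qed.

Lemma signed_power_le c j x : `|c| <= 1 -> signed_power c j x <= `|x| ^+ j.
Proof.
move=> c1; rewrite /signed_power ge_max exprn_ge0// andbT.
by rewrite (le_trans (ler_norm _))// normrM normrX ler_piMl// exprn_ge0.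
Qed.

Let harm_gt0 k : 0 < harmonic k :> R. Proof. by rewrite /harmonic invr_gt0. Qed.

Let harm_le1 k : harmonic k <= 1 :> R.
Proof. by rewrite /harmonic invf_le1// ler1n. Qed.

Lemma truncated_power_le c j k x : truncated_power c j k x <= signed_power c j x.
Proof.
by rewrite /truncated_power ge_max signed_power_ge0 gerBl exprn_ge0// ltW.
Qed.

Lemma truncated_power_nd c j k l x : (k <= l)%N ->
  truncated_power c j k x <= truncated_power c j l x.
Proof.
move=> kl; rewrite /truncated_power ge_max; apply/andP; split; last first.
  by rewrite le_max lexx orbT.
rewrite le_max lerD2l lerN2 lerXn2r ?nnegrE ?(ltW (harm_gt0 _))//.
by rewrite /harmonic lef_pV2 ?posrE// ler_nat.
Qed.

Lemma truncated_power_eq0 c j k x : `|c| <= 1 -> (0 < j)%N ->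
  `|x| <= harmonic k ^+ 3 -> truncated_power c j k x = 0.
Proof.
move=> c1 j0 xk; rewrite /truncated_power max_r// subr_le0.
have x1 : `|x| <= 1.
  by apply: (le_trans xk); rewrite exprn_ile1 ?harm_le1// ltW.
apply: le_trans (signed_power_le _ _ c1) _; apply: le_trans xk.
by rewrite -[leRHS]expr1 ler_wiXn2l.
Qed.

(** With h = [harmonic k]: if |x| <= h, then |x|^j <= |x|^3 <= h x^2; otherwise the cutoff h^3 is
    itself at most h x^2. *)
Lemma signed_power_truncated c j k x : `|c| <= 1 -> (3 <= j)%N ->
  signed_power c j x <= truncated_power c j k x + harmonic k * x ^+ 2.
Proof.
move=> c1 j3; have [xk|kx] := leP `|x| (harmonic k).
  have x1 : `|x| <= 1 by apply: le_trans xk _; exact: harm_le1.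
  rewrite ler_wpDl ?truncated_power_ge0//.
  apply: le_trans (signed_power_le _ _ c1) _.
  apply: (@le_trans _ _ (`|x| ^+ 3)); first by rewrite ler_wiXn2l.
  by rewrite exprS real_normK ?num_real// ler_wpM2r// sqr_ge0.
rewrite -lerBlDr; apply: (@le_trans _ _ (signed_power c j x - harmonic k ^+ 3)).
  rewrite lerD2l lerN2 exprS; apply: ler_wpM2l; first exact: ltW.
  by rewrite -[leRHS]real_normK ?num_real// lerXn2r ?nnegrE// ltW.
by rewrite /truncated_power le_max lexx.
Qed.

Lemma cvg_truncated_power c j x :
  truncated_power c j k x @[k --> \oo] --> signed_power c j x.
Proof.
apply: (@squeeze_cvgr _ _ _ _ (fun k => signed_power c j x - harmonic k)
  (fun=> signed_power c j x)); last exact: cvg_cst.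
- apply: nearW => k; rewrite truncated_power_le andbT.
  rewrite /truncated_power le_max lerD2l lerN2.
  by rewrite -[leRHS]expr1 ler_wiXn2l// ltW.
- rewrite -[X in _ --> X]subr0; apply: cvgB; first exact: cvg_cst.
  exact: cvg_harmonic.
Qed.

Lemma continuous_signed_power c j : continuous (signed_power c j).
Proof.
have cX : continuous (fun x : R => c * x ^+ j).
  by move=> x; apply: cvgM; [exact: cvg_cst|exact: exprn_continuous].
rewrite /signed_power; under eq_fun do rewrite maxr_absE subr0 addr0.
move=> x; apply: cvgM; last exact: cvg_cst.
by apply: cvgD; [exact: cX|apply: cvg_norm; exact: cX].
Qed.

Lemma continuous_truncated_power c j k : continuous (truncated_power c j k).
Proof.
have cX : continuous (fun x : R => signed_power c j x - harmonic k ^+ 3).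
  by move=> x; apply: cvgB; [exact: continuous_signed_power|exact: cvg_cst].
rewrite /truncated_power; under eq_fun do rewrite maxr_absE subr0 addr0.
move=> x; apply: cvgM; last exact: cvg_cst.
by apply: cvgD; [exact: cX|apply: cvg_norm; exact: cX].
Qed.

(** Monotone convergence for unordered sums: they increase with k, and each finite subsum of the
    limit is a limit of finite subsums. *)
Lemma cvg_esum_truncated (D : set R) (h : R -> R) c j :
  (\esum_(s in D) (truncated_power c j k (h s))%:E)%E @[k --> \oo] -->
  (\esum_(s in D) (signed_power c j (h s))%:E)%E.
Proof.
set u := fun k => _; set l := \esum_(_ in _) _.
have nd_u : nondecreasing_seq u.
  by move=> k k' kk'; apply: le_esum => s _; rewrite lee_fin truncated_power_nd.
have := ereal_nondecreasing_cvgn nd_u.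
suff -> : ereal_sup (range u) = l by [].
apply/eqP; rewrite eq_le; apply/andP; split.
  apply: ge_ereal_sup => _ [k _ <-].
  by apply: le_esum => s _; rewrite lee_fin truncated_power_le.
apply: ge_ereal_sup => _ [A [finA AD] <-].
rewrite fsbig_finite//= sumEFin.
have cA : \sum_(s <- finmap.enum_fset (fset_set A)) truncated_power c j k (h s)
  @[k --> \oo] -->
    \sum_(s <- finmap.enum_fset (fset_set A)) signed_power c j (h s).
  by apply: cvg_big_seq => s _; exact: cvg_truncated_power.
have {}cA : (\sum_(s <- finmap.enum_fset (fset_set A)) truncated_power c j k (h
  s))%:E
    @[k --> \oo] -->
    (\sum_(s <- finmap.enum_fset (fset_set A)) signed_power c j (h s))%:E.
  by apply: cvg_EFin; [exact: nearW|exact: cA].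
rewrite -(cvg_lim _ cA)//; apply: lime_le; first by apply/cvg_ex; eexists;
  exact: cA.
apply: nearW => k; apply: (@le_trans _ _ (u k)).
  apply: esum_ge; exists A => //.
  by rewrite fsbig_finite//= sumEFin.
by apply: ereal_sup_ubound; exists k.
Qed.

Section one_path.
Variables (f : R -> R) (t : R).
Hypotheses (cf : cadlag f) (t0 : 0 <= t).

Definition grid_sum (g : R -> R) (N : nat) : R :=
  \sum_(i < N) g (grid_incr f t N i).

Lemma cvg_grid_sum_truncated c j k : `|c| <= 1 -> (0 < j)%N ->
  exists2 L : R,
    (\esum_(s in `]0%R, t]%classic) (truncated_power c j k (path_jump f s))%:E
      = L%:E)%E &
    grid_sum (truncated_power c j k) N @[N --> \oo] --> L.
Proof.
move=> c1 j0; apply: (@cvg_grid_sum _ _ _ _ (harmonic k ^+ 3)) => //.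
- exact: continuous_truncated_power.
- by move=> x; exact: truncated_power_ge0.
- by rewrite exprn_gt0.
- by move=> x; exact: truncated_power_eq0.
Qed.

(** The grid sums of the power and of its truncation at level m differ by at most [harmonic m * A],
    uniformly along the subsequence. This permits the exchange of the limits in the grid and in the
    truncation level. *)
Lemma cvg_grid_sum_signed c j (phi : nat -> nat) (A : R) :
  `|c| <= 1 -> (3 <= j)%N -> phi k @[k --> \oo] --> \oo ->
  (forall k, grid_sum (fun x => x ^+ 2) (phi k) <= A) ->
  exists2 L : R,
    (\esum_(s in `]0%R, t]%classic) (signed_power c j (path_jump f s))%:E =
      L%:E)%E &
    grid_sum (signed_power c j) (phi k) @[k --> \oo] --> L.
Proof.
move=> c1 j3 cphi phiA; have j0 : (0 < j)%N by exact: leq_trans j3.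
have /choice[L HL] : forall m, exists L : R,
    (\esum_(s in `]0%R, t]%classic) (truncated_power c j m (path_jump f s))%:E
      = L%:E)%E /\
    grid_sum (truncated_power c j m) (phi k) @[k --> \oo] --> L.
  move=> m; have [L LE cL] := cvg_grid_sum_truncated m c1 j0.
  by exists L; split=> //; exact: (cvg_comp _ _ cphi cL).
have A0 : 0 <= A.
  by apply: le_trans (phiA 0%N); apply: sumr_ge0 => i _; exact: sqr_ge0.
have ub m k : grid_sum (signed_power c j) (phi k) <=
    grid_sum (truncated_power c j m) (phi k) + harmonic m * A.
  apply: (@le_trans _ _ (grid_sum (truncated_power c j m) (phi k) +
      harmonic m * grid_sum (fun x => x ^+ 2) (phi k))).
    rewrite /grid_sum mulr_sumr -big_split/=; apply: ler_sum => i _.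
    exact: signed_power_truncated.
  by rewrite lerD2l; apply: ler_wpM2l; [exact: ltW|exact: phiA].
have lb m k : grid_sum (truncated_power c j m) (phi k) <=
    grid_sum (signed_power c j) (phi k).
  by apply: ler_sum => i _; exact: truncated_power_le.
have cL m := proj2 (HL m).
have ndL : nondecreasing_seq L.
  move=> m m' mm'; rewrite -lee_fin -(proj1 (HL m)) -(proj1 (HL m')).
  by apply: le_esum => s _; rewrite lee_fin truncated_power_nd.
(* Level m is compared with level 0 through the untruncated sum between them; this makes the
   increasing limits [L] bounded, and so the unordered sum finite. *)
have LA m : L m <= L 0%N + harmonic 0 * A.
  have c0 : grid_sum (truncated_power c j 0) (phi k) + harmonic 0 * A @[k -->
    \oo] -->
      L 0%N + harmonic 0 * A by apply: cvgD => //; exact: cvg_cst.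
  apply: (ler_cvg_to (cL m) c0); apply: nearW => k.
  exact: le_trans (lb m k) (ub 0%N k).
have cvL : L @ \oo --> limn L.
  apply: nondecreasing_is_cvgn => //; exists (L 0%N + harmonic 0 * A) =>
    _ [m _ <-].
  exact: LA.
exists (limn L).
  have h1 := @cvg_esum_truncated `]0%R, t]%classic (path_jump f) c j.
  apply: (cvg_unique _ h1) => //=.
  under eq_fun do rewrite (proj1 (HL _)).
  by apply: cvg_EFin; [exact: nearW|exact: cvL].
apply/cvgrPdist_le => e e0; have e3 : 0 < e / 3 by rewrite divr_gt0.
have hA : harmonic m * A @[m --> \oo] --> 0.
  by rewrite -(mul0r A); apply: cvgM; [exact: cvg_harmonic|exact: cvg_cst].
have [m [Hm1 Hm2]] : exists m, `|limn L - L m| <= e / 3 /\ `|harmonic m * A| <=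
  e / 3.
  have /cvgrPdist_le /(_ _ e3) cvL' := cvL.
  have /cvgrPdist_le /(_ _ e3) hA' := hA.
  have [m _ H] := filterI cvL' hA'; exists m.
  by have [] := H m (leqnn m); rewrite sub0r normrN.
have /cvgrPdist_le /(_ _ e3) := cL m; apply: filterS => k Hk.
have := lb m k; have := ub m k; move: Hm1 Hm2 Hk.
set S := grid_sum (signed_power c j) _; set S' := grid_sum _ _.
by rewrite !ler_norml => /andP[? ?] /andP[? ?] /andP[? ?] ? ?; apply/andP;
  split; lra.
Qed.

End one_path.

Lemma signed_powerB j x :
  signed_power 1 j x - signed_power (-1) j x = x ^+ j.
Proof.
rewrite /signed_power mul1r mulN1r.
by case: leP => h1; case: leP => h2; lra.
Qed.

Lemma jump_power_sumE d (T : measurableType d) (P : probability T R)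
    (X : R -> {RV P >-> R}) j t w :
  jump_power_sum X j t w =
  fine (\esum_(s in `]0%R, t]%classic) (signed_power 1 j (path_jump (X^~ w)
    s))%:E -
        \esum_(s in `]0%R, t]%classic) (signed_power (-1) j (path_jump (X^~ w)
          s))%:E)%E.
Proof.
rewrite /jump_power_sum; congr (fine (_ - _)); apply: eq_esum => s _.
  by rewrite funeposE /signed_power mul1r EFin_max.
by rewrite funenegE /signed_power mulN1r EFin_max EFinN.
Qed.

Lemma cvg_jump_power_sum d (T : measurableType d) (P : probability T R)
    (X : R -> {RV P >-> R}) j t w (phi : nat -> nat) (A : R) :
  cadlag (X^~ w) -> 0 <= t -> (3 <= j)%N -> phi k @[k --> \oo] --> \oo ->
  (forall k, grid_sum (X^~ w) t (fun x => x ^+ 2) (phi k) <= A) ->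
  grid_sum (X^~ w) t (fun x => x ^+ j) (phi k) @[k --> \oo] -->
  jump_power_sum X j t w.
Proof.
move=> cX t0 j3 cphi phiA; rewrite jump_power_sumE.
have n1 : `|1 : R| <= 1 by rewrite normr1.
have n2 : `|-1 : R| <= 1 by rewrite normrN1.
have [L1 -> c1] := cvg_grid_sum_signed cX t0 n1 j3 cphi phiA.
have [L2 -> c2] := cvg_grid_sum_signed cX t0 n2 j3 cphi phiA.
rewrite /=.
have -> : (fun k => grid_sum (X^~ w) t (fun x => x ^+ j) (phi k)) =
    fun k => grid_sum (X^~ w) t (signed_power 1 j) (phi k) -
      grid_sum (X^~ w) t (signed_power (-1) j) (phi k).
  apply/funext => k; rewrite /grid_sum -sumrB; apply: eq_bigr => i _.
  by rewrite signed_powerB.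
exact: cvgB.
Qed.

(** The uncountable sums are iterated limits of finite grid sums, first in N for a fixed truncation
    and then in the truncation level. Both limits exist for every path, possibly infinite in the
    second case. *)
Lemma measurable_jump_power_sum d (T : measurableType d) (P : probability T R)
    (X : R -> {RV P >-> R}) j t :
  (forall w, cadlag (X^~ w)) -> 0 <= t -> (0 < j)%N ->
  measurable_fun setT (jump_power_sum X j t).
Proof.
move=> cX t0 j0; rewrite (funext (jump_power_sumE X j t)).
suff H c : `|c| <= 1 -> measurable_fun setT (fun w =>
    \esum_(s in `]0%R, t]%classic) (signed_power c j (path_jump (X^~ w) s))%:E)%E.
  apply: measurableT_comp => //; apply: emeasurable_funB; apply: H.
    by rewrite normr1.
  by rewrite normrN1.
move=> c1.
apply: (emeasurable_fun_cvg (fun k w =>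
    \esum_(s in `]0%R, t]%classic) (truncated_power c j k (path_jump (X^~ w)
      s))%:E)%E).
  move=> k; apply: (emeasurable_fun_cvg (fun N w =>
     (grid_sum (X^~ w) t (truncated_power c j k) N)%:E)).
    move=> N; apply/measurable_EFinP; apply: measurable_sum => i.
    apply: measurableT_comp.
      by apply: continuous_measurable_fun; exact: continuous_truncated_power.
    exact: measurable_funB.
  move=> w _; have [L -> cL] := cvg_grid_sum_truncated (cX w) t0 k c1 j0.
  by apply: cvg_EFin; [exact: nearW|exact: cL].
by move=> w _; exact: cvg_esum_truncated.
Qed.

End JumpSums.

(** * Moments of the increments of a Levy process *)

Section EqualLaw.
Context d (T : measurableType d) (R : realType) (P : probability T R).
Implicit Types U V : T -> R.

Lemma eq_law_expectation U V k :
  has_all_moments P U -> has_all_moments P V ->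
  (forall B, measurable B -> P (U @^-1` B) = P (V @^-1` B)) ->
  \int[P]_w (U w ^+ k) = \int[P]_w (V w ^+ k).
Proof.
move=> [mU iU] [mV iV] UV.
pose U' : {mfun T >-> R} :=
  MeasurableFun.Pack (MeasurableFun.Class (isMeasurableFun.Build _ _ _ _ _ mU)).
pose V' : {mfun T >-> R} :=
  MeasurableFun.Pack (MeasurableFun.Class (isMeasurableFun.Build _ _ _ _ _ mV)).
pose f (x : R) := (x ^+ k)%:E.
have mf : measurable_fun setT f by apply/measurable_EFinP;
  exact: exprn_measurable.
congr fine.
rewrite -[LHS]/(\int[P]_w (f \o U') w)%E -[RHS]/(\int[P]_w (f \o V') w)%E.
rewrite -[LHS](@integral_distribution _ _ _ _ _ P U' f)
  -?[RHS](@integral_distribution _ _ _ _ _ P V' f)//; last 2 first.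
- exact: iV.
- exact: iU.
by apply: eq_measure_integral => B mB _; exact: UV.
Qed.

Lemma ae_eq_expectation U V : measurable_fun setT U -> measurable_fun setT V ->
  {ae P, forall w, U w = V w} -> \int[P]_w U w = \int[P]_w V w.
Proof.
move=> mU mV UV; congr fine; apply: ae_eq_integral => //.
- exact/measurable_EFinP.
- exact/measurable_EFinP.
- by apply: filterS UV => w -> _.
Qed.

End EqualLaw.

Section LevyMoments.
Context d (T : measurableType d) (R : realType) (P : probability T R).
Variable X : R -> {RV P >-> R}.
Hypotheses (hX : levy_process X) (hmoments : all_moments X)
  (hcentered : centered X).

Definition levy_moment (h : R) (k : nat) : R := \int[P]_w (X h w ^+ k).

Lemma levy_has_all_moments (t : R) : 0 <= t -> has_all_moments P (X t).
Proof. by move=> t0; split=> // k; exact: hmoments. Qed.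

Lemma increment_has_all_moments (s t : R) : 0 <= s -> 0 <= t ->
  has_all_moments P (increment X s t).
Proof.
move=> s0 t0; rewrite (_ : increment X s t = fun w => X t w + (-1) * X s w).
  by apply: has_all_momentsD; [|apply: has_all_momentsZ];
    exact: levy_has_all_moments.
by apply/funext => w; rewrite /increment mulN1r.
Qed.

(** Stationarity leads to the increment from time 0, which agrees with [X h] only almost surely. *)
Lemma increment_moment (s h : R) k : 0 <= s -> 0 <= h ->
  \int[P]_w (increment X s (s + h) w ^+ k) = levy_moment h k.
Proof.
move=> s0 h0.
rewrite (@eq_law_expectation _ _ _ _ _ (increment X 0 h)).
- apply: ae_eq_expectation.
  + by apply: measurable_funX; case: (increment_has_all_moments (lexx 0) h0).
  + by apply: measurable_funX; case: (levy_has_all_moments h0).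
  + by apply: filterS (levy_start hX) => w Xw; rewrite /increment Xw subr0.
- by apply: increment_has_all_moments => //; exact: addr_ge0.
- exact: increment_has_all_moments.
- by move=> B mB; apply: (levy_stationary hX).
Qed.

Variable t : R.
Hypothesis t0 : 0 <= t.

Definition grid_increment (N i : nat) (w : T) : R := grid_incr (X^~ w) t N i.

Lemma grid_increment_moments N i : has_all_moments P (grid_increment N i).
Proof. by apply: increment_has_all_moments; exact: grid_point_ge0. Qed.

Lemma grid_increment_indep N (B : nat -> set R) : (forall i, measurable (B i)) ->
  P (\bigcap_(i in `I_N) (grid_increment N i @^-1` B i)) =
  (\prod_(i < N) P (grid_increment N i @^-1` B i))%E.
Proof.
move=> mB; apply: (levy_independent hX (s := grid_point t N)) => //.
- exact: grid_point_ge0.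
- by move=> i _; exact: grid_point_le.
Qed.

Lemma grid_increment_moment N i k : (i < N)%N ->
  \int[P]_w (grid_increment N i w ^+ k) = levy_moment (t / N%:R) k.
Proof.
move=> iN; have N0 : (0 < N)%N by exact: leq_ltn_trans iN.
rewrite -(@increment_moment (grid_point t N i)) ?grid_point_ge0//; last first.
  by rewrite divr_ge0.
by rewrite /increment -grid_pointS.
Qed.

Lemma levy_moment1 (h : R) : 0 <= h -> levy_moment h 1 = 0.
Proof.
move=> h0; rewrite /levy_moment; under eq_Rintegral do rewrite expr1.
by rewrite /Rintegral; have := hcentered h0; rewrite unlock => ->.
Qed.

Definition grid_power_sum (j N : nat) (w : T) : R :=
  power_sum ((grid_increment N)^~ w) j N.

Lemma grid_power_sumE j N w :
  grid_power_sum j N w = grid_sum (X^~ w) t (fun x => x ^+ j) N.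
Proof. by rewrite /grid_power_sum /power_sum big_mkord. Qed.

Lemma grid_power_sum1 N w : (0 < N)%N -> grid_power_sum 1 N w = X t w - X 0 w.
Proof.
move=> N0; rewrite /grid_power_sum /power_sum.
under eq_bigr do rewrite expr1.
by rewrite (telescope_sumr (fun i => X (grid_point t N i) w))// grid_pointN//
  grid_point0.
Qed.

Lemma grid_power_sum1_moment r N : (0 < N)%N ->
  \int[P]_w (grid_power_sum 1 N w ^+ r) = levy_moment t r.
Proof.
move=> N0; under eq_Rintegral do rewrite (grid_power_sum1 _ N0).
by rewrite -(@increment_moment 0 t)// add0r.
Qed.

Lemma compound_bound (x : R) N : 0 <= x -> (0 < N)%N ->
  (1 + x / N%:R) ^+ N <= expR x.
Proof.
move=> x0 N0; have N0' : N%:R != 0 :> R by rewrite pnatr_eq0 -lt0n.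
have -> : expR x = expR (x / N%:R) ^+ N.
  by rewrite -expRM_natl -mulr_natl; congr expR; field.
by rewrite lerXn2r ?nnegrE ?expR_ge0 ?expR_ge1Dx// addr_ge0// divr_ge0.
Qed.

(* E[X_t^r] differs from N E[X_(t/N)^r] by products of at least two lower moments
   of X_(t/N), which are O(1/N) by induction. *)
Lemma levy_moment_bound r : exists2 C : R, 0 <= C &
  forall l, (0 < l <= r)%N -> forall N, (0 < N)%N ->
  N%:R * `|levy_moment (t / N%:R) l| <= C.
Proof.
elim: r => [|r [C C0 HC]].
  by exists 0 => // l /andP[l0]; rewrite leqn0 => /eqP l0'; rewrite l0' in l0.
pose K := 2 ^+ r.+1 * C.
have K0 : 0 <= K by rewrite mulr_ge0// exprn_ge0.
(* [C] serves the orders up to r. At order r + 1, S_1 has the moment of X_t because it telescopes,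
   and [first_moment_gap] with c = C / N is K (1 + K / N)^N <= K e^K. *)
exists (C + (`|levy_moment t r.+1| + K * expR K)).
  by rewrite addr_ge0// addr_ge0// mulr_ge0// expR_ge0.
move=> l /andP[l0]; rewrite leq_eqVlt => /predU1P[->|]; last first.
  rewrite ltnS => lr N N0; rewrite (le_trans (HC l _ N N0)) ?l0// lerDl.
  by rewrite addr_ge0// mulr_ge0// expR_ge0.
move=> N N0; have N0' : (0 : R) < N%:R by rewrite ltr0n.
have CN0 : 0 <= C / N%:R by rewrite divr_ge0.
have gap := @first_moment_gap _ _ _ P N (grid_increment N) (levy_moment (t /
  N%:R))
  (fun i _ => grid_increment_moments N i) (@grid_increment_indep N)
  (fun i k iN => grid_increment_moment k iN) r.+1 (C / N%:R) CN0 isT.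
have {}gap := gap _; rewrite grid_power_sum1_moment// in gap.
rewrite -[X in X * _](ger0_norm (ltW N0')) -normrM.
set a := levy_moment t r.+1 in gap *.
set b := N%:R * _.
rewrite ler_wpDl//.
have -> : b = a - (a - b) by ring.
rewrite (le_trans (ler_normB _ _))// lerD2l.
apply: le_trans (gap _) _.
  move=> q /andP[q0 qr]; rewrite ler_pdivlMr// mulrC; apply: HC => //.
  by rewrite q0.
rewrite (_ : _ * _ = K * (1 + K / N%:R) ^+ N); last first.
  rewrite /K; set p := 2 ^+ r.+1; rewrite [in LHS](mulrA p C).
  by set q := (1 + _) ^+ N; field; rewrite gt_eqF.
by rewrite ler_wpM2l// compound_bound.
Qed.

(** The moments of one increment are at most C / N, so each of the N steps of the Gronwall
    inequality multiplies the bound by 1 + K / N, and the product stays below e^K. *)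
Lemma bounded_grid_power_sum j : (0 < j)%N ->
  bounded_moments P (grid_power_sum j).
Proof.
move=> j0; split=> [N|k].
  rewrite /grid_power_sum; apply: has_all_moments_sum => i _.
  exact/has_all_momentsX/grid_increment_moments.
have [C C0 HC] := levy_moment_bound (j * (k * 2)).
pose K := 2 ^+ (k * 2) * C.
have K0 : 0 <= K by rewrite mulr_ge0// exprn_ge0.
(* The 1 accounts for N = 0, where the power sum is 0 and its power of order 0 is 1. *)
exists (1 + expR K); case=> [|N].
  under eq_Rintegral do rewrite /grid_power_sum power_sum0.
  rewrite Expectation_cst expr0n ler_wpDr ?expR_ge0//.
  by case: eqP.
have N0' : (0 : R) < N.+1%:R by rewrite ltr0n.
have CN0 : 0 <= C / N.+1%:R by rewrite divr_ge0.
have := @power_sum_moment_le _ _ _ P N.+1 (grid_increment N.+1) (levy_moment (t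
  / N.+1%:R))
  (fun i _ => grid_increment_moments N.+1 i) (@grid_increment_indep N.+1)
  (fun i k iN => grid_increment_moment k iN) j (k * 2) (C / N.+1%:R) CN0.
move=> /(_ _ N.+1 (leqnn _) (k * 2)%N (leqnn _)) H.
rewrite (le_trans (ler_norm _))// (le_trans (H _))//.
  move=> l /andP[l0 lk]; rewrite ler_pdivlMr// mulrC; apply: HC => //.
  by rewrite muln_gt0 j0 l0 leq_mul2l lk orbT.
rewrite ler_wpDl// mulrA -/K; exact: compound_bound.
Qed.

Lemma grid_esym_ortho a b N : a != b ->
  \int[P]_w (esym ((grid_increment N)^~ w) N a * esym ((grid_increment N)^~ w)
    N b) = 0.
Proof.
move=> ab; apply: (@Expectation_esymM _ _ _ P N (grid_increment N) (levy_moment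
  (t / N%:R))) => //.
- by move=> i _; exact: grid_increment_moments.
- exact: grid_increment_indep.
- by move=> i k; exact: grid_increment_moment.
- by apply: levy_moment1; rewrite divr_ge0.
Qed.

Lemma grid_power_sum_esym j a N : (0 < a)%N ->
  \int[P]_w (grid_power_sum j N w * esym ((grid_increment N)^~ w) N a) =
  (a == 1%N)%:R * (N%:R * levy_moment (t / N%:R) j.+1).
Proof.
move=> a0; rewrite mulrA.
apply: (@Expectation_power_sumM_esym _ _ _ P N (grid_increment N) (levy_moment
  (t / N%:R))) => //.
- by move=> i _; exact: grid_increment_moments.
- exact: grid_increment_indep.
- by move=> i k; exact: grid_increment_moment.
- by apply: levy_moment1; rewrite divr_ge0.
Qed.

Lemma grid_power_sum_expectation j N :
  \int[P]_w grid_power_sum j N w = N%:R * levy_moment (t / N%:R) j.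
Proof.
rewrite /grid_power_sum /power_sum Expectation_sum; last first.
  by move=> i _; exact/has_all_momentsX/grid_increment_moments.
rewrite big_nat (eq_bigr (fun=> levy_moment (t / N%:R) j)); last first.
  by move=> i /andP[_ iN]; exact: grid_increment_moment.
by rewrite -big_nat sumr_const_nat subn0 mulr_natl.
Qed.

End LevyMoments.

(** * Moments of the Levy measure *)

Section SinCosBounds.
Context (R : realType).
Implicit Types x y u v : R.

Lemma le_of_eq x y : x = y -> x <= y.
Proof. by move=> ->. Qed.

(** Starting from |cos| <= 1, three applications give the Taylor bounds for sin y, cos y - 1 and sin
    y - y, with the factorials dropped. *)
Lemma derive_bound (f df : R -> R) (k : nat) y :
  (forall x, is_derive x 1 f (df x)) -> f 0 = 0 ->
  (forall x, `|df x| <= `|x| ^+ k) -> `|f y| <= `|y| ^+ k.+1.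
Proof.
move=> fdf f0 dfk.
have cf : continuous f.
  move=> x; apply: differentiable_continuous; apply/derivable1_diffP.
  by have := fdf x => H; exact: ex_derive.
have [y0|y0] := leP 0 y.
  have [c] := @MVT_segment R f df 0 y y0 (fun x _ =>
    fdf x) (continuous_subspaceT cf).
  rewrite in_itv/= => /andP[c0 cy]; rewrite f0 !subr0 => ->.
  rewrite normrM exprSr ler_wpM2r// (le_trans (dfk c))// lerXn2r ?nnegrE//.
  by rewrite !ger0_norm.
have [c] := @MVT_segment R f df y 0 (ltW y0) (fun x _ =>
  fdf x) (continuous_subspaceT cf).
rewrite in_itv/= => /andP[yc c0]; rewrite f0 !sub0r => fy.
rewrite -normrN fy normrM normrN exprSr ler_wpM2r// (le_trans (dfk c))//
  lerXn2r ?nnegrE//.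
by rewrite !ler0_norm ?lerN2// ltW.
Qed.

Lemma norm_sin_le y : `|sin y| <= `|y|.
Proof.
rewrite -[leRHS]expr1; apply: (@derive_bound sin cos) => //; first exact: sin0.
by move=> x; rewrite expr0 cos_max.
Qed.

Lemma norm_cosB1_le y : `|cos y - 1| <= `|y| ^+ 2.
Proof.
apply: (@derive_bound (fun x => cos x - 1) (fun x => - sin x)).
- by move=> x; apply: is_derive_eq; rewrite subr0.
- by rewrite cos0 subrr.
- by move=> x; rewrite normrN expr1 norm_sin_le.
Qed.

Lemma norm_sinB_le y : `|sin y - y| <= `|y| ^+ 3.
Proof.
apply: (@derive_bound (fun x => sin x - x) (fun x => cos x - 1)).
- by rewrite sin0 subrr.
- exact: norm_cosB1_le.
Qed.

Lemma norm_subX_le x y k : `|x| <= `|y| ->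
  `|y ^+ k.+1 - x ^+ k.+1| <= k.+1%:R * `|y| ^+ k * `|y - x|.
Proof.
move=> xy; elim: k => [|k IHk]; first by rewrite !expr1 expr0 mulr1 mul1r.
rewrite (_ : _ - _ = y * (y ^+ k.+1 - x ^+ k.+1) + (y - x) * x ^+ k.+1);
  last first.
  by rewrite (exprS y k.+1) (exprS x k.+1); ring.
rewrite (le_trans (ler_normD _ _))// !normrM normrX.
have h1 : `|y| * `|y ^+ k.+1 - x ^+ k.+1| <= `|y| * (k.+1%:R * `|y| ^+ k * `|y
  - x|).
  by rewrite ler_wpM2l.
have h2 : `|y - x| * `|x| ^+ k.+1 <= `|y - x| * `|y| ^+ k.+1.
  by rewrite ler_wpM2l// lerXn2r// nnegrE.
apply: le_trans (lerD h1 h2) _.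
by rewrite -(natr1 k.+1) (exprS `|y| k); apply: le_of_eq; ring.
Qed.

Definition scaled_sin (e x : R) : R := sin (e * x) / e.

Lemma norm_scaled_sin_le e x : 0 < e -> `|scaled_sin e x| <= `|x|.
Proof.
move=> e0; rewrite /scaled_sin normrM normfV (gtr0_norm e0) ler_pdivrMr//.
by rewrite (le_trans (norm_sin_le _))// normrM (gtr0_norm e0) mulrC.
Qed.

(** The sine has no quadratic term, so x is approximated to order e^2 |x|^3. The two additional
    powers of |x| are paid for by higher moments. *)
Lemma scaled_sinX_approx e x k : 0 < e ->
  `|x ^+ k.+1 - scaled_sin e x ^+ k.+1| <= k.+1%:R * e ^+ 2 * `|x| ^+ k.+3.
Proof.
move=> e0; apply: le_trans (norm_subX_le k (norm_scaled_sin_le x e0)) _.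
have h : `|x - scaled_sin e x| <= e ^+ 2 * `|x| ^+ 3.
  rewrite (_ : x - scaled_sin e x = - ((sin (e * x) - e * x) / e)); last first.
    by rewrite /scaled_sin; field; rewrite gt_eqF.
  rewrite normrN normrM normfV (gtr0_norm e0) ler_pdivrMr//.
  apply: le_trans (norm_sinB_le _) _.
  by rewrite normrM (gtr0_norm e0) exprMn !exprS expr0; apply: le_of_eq; ring.
apply: le_trans (ler_wpM2l _ h) _; first by rewrite mulr_ge0// exprn_ge0.
by rewrite !exprS; apply: le_of_eq; ring.
Qed.

End SinCosBounds.

(** * Trigonometric polynomials and their second-order jets at 0 *)

Section TrigPolynomials.
Context (R : realType).
Implicit Types (f g : R -> R).

(* Trigonometric polynomials [g] together with [g 0], [g' 0] and [g'' 0]. *)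
Inductive trig_poly : (R -> R) -> R -> R -> R -> Prop :=
| trig_cos (u : R) : trig_poly (fun x => cos (u * x)) 1 0 (- u ^+ 2)
| trig_sin (u : R) : trig_poly (fun x => sin (u * x)) 0 u 0
| trig_lin (c : R) f (f0 f1 f2 : R) g (g0 g1 g2 : R) :
    trig_poly f f0 f1 f2 -> trig_poly g g0 g1 g2 ->
    trig_poly (fun x => c * f x + g x) (c * f0 + g0) (c * f1 + g1) (c * f2 + g2).

Lemma trig_eq f g (f0 f1 f2 g0 g1 g2 : R) : f = g -> f0 = g0 -> f1 = g1 ->
  f2 = g2 ->
  trig_poly f f0 f1 f2 -> trig_poly g g0 g1 g2.
Proof. by move=> -> -> -> ->. Qed.

Lemma trig_zero : trig_poly (fun=> 0) 0 0 0.
Proof.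
by apply: trig_eq (trig_sin 0) => //; apply/funext => x; rewrite mul0r sin0.
Qed.

Lemma trig_scale (c : R) f (f0 f1 f2 : R) :
  trig_poly f f0 f1 f2 -> trig_poly (fun x => c * f x) (c * f0) (c * f1) (c * f2).
Proof.
move=> tf; apply: trig_eq (trig_lin c tf trig_zero); rewrite ?addr0//.
by apply/funext => x; rewrite addr0.
Qed.

(** The Levy-Khintchine formula treats single cosines and sines, so powers of a sine must be
    linearised: product-to-sum formulas on the generators, bilinearity elsewhere. The jet obeys the
    Leibniz rule. *)
Lemma trig_mul f (f0 f1 f2 : R) g (g0 g1 g2 : R) :
  trig_poly f f0 f1 f2 -> trig_poly g g0 g1 g2 ->
  trig_poly (fun x => f x * g x) (f0 * g0) (f0 * g1 + f1 * g0)
    (f0 * g2 + 2 * (f1 * g1) + f2 * g0).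
Proof.
move=> tf; elim: tf g g0 g1 g2 => {f f0 f1 f2}.
- move=> u g g0 g1 g2; elim => {g g0 g1 g2} [v|v|c g g0 g1 g2 h h0 h1 h2 tg IHg
  th IHh].
  + apply: trig_eq (trig_lin 2^-1 (trig_cos (u - v)) (trig_scale 2^-1 (trig_cos
    (u + v)))).
    * by apply/funext => x; rewrite mulrBl mulrDl cosB cosD; field.
    * by field.
    * by ring.
    * by field.
  + apply: trig_eq (trig_lin 2^-1 (trig_sin (u + v)) (trig_scale (- 2^-1)
    (trig_sin (u - v)))).
    * by apply/funext => x; rewrite mulrBl mulrDl sinB sinD; field.
    * by ring.
    * by field.
    * by ring.
  + apply: trig_eq (trig_lin c IHg IHh); try by ring.
    by apply/funext => x; ring.
- move=> u g g0 g1 g2; elim => {g g0 g1 g2} [v|v|c g g0 g1 g2 h h0 h1 h2 tg IHg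
  th IHh].
  + apply: trig_eq (trig_lin 2^-1 (trig_sin (u + v)) (trig_scale 2^-1 (trig_sin
    (u - v)))).
    * by apply/funext => x; rewrite mulrBl mulrDl sinB sinD; field.
    * by ring.
    * by field.
    * by ring.
  + apply: trig_eq (trig_lin 2^-1 (trig_cos (u - v)) (trig_scale (- 2^-1)
    (trig_cos (u + v)))).
    * by apply/funext => x; rewrite mulrBl mulrDl cosB cosD; field.
    * by field.
    * by ring.
    * by field.
  + apply: trig_eq (trig_lin c IHg IHh); try by ring.
    by apply/funext => x; ring.
- move=> c f f0 f1 f2 g g0 g1 g2 tf IHf tg IHg h h0 h1 h2 th.
  apply: trig_eq (trig_lin c (IHf _ _ _ _ th) (IHg _ _ _ _ th)); try by ring.
  by apply/funext => x; ring.
Qed.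

(** The jet is that of x^(k+2) at 0. Its second derivative survives for k = 0 only, which is why
    sigma enters the second cumulant and no higher one. *)
Lemma trig_scaled_sinX (e : R) k : 0 < e ->
  trig_poly (fun x => scaled_sin e x ^+ k.+2) 0 0 (2 * (k == 0%N)%:R).
Proof.
move=> e0; have t1 : trig_poly (scaled_sin e) 0 1 0.
  apply: trig_eq (trig_scale e^-1 (trig_sin e)).
  - by apply/funext => x; rewrite mulrC.
  - by rewrite mulr0.
  - by rewrite mulVf// gt_eqF.
  - by rewrite mulr0.
have t2 : trig_poly (fun x => scaled_sin e x ^+ 2) 0 0 2.
  apply: trig_eq (trig_mul t1 t1); try by ring.
  by apply/funext => x; rewrite expr2.
elim: k => [|k IHk]; first by apply: trig_eq t2; rewrite ?mulr1.
apply: trig_eq (trig_mul t1 IHk); rewrite ?mulr0 ?mul0r ?addr0//.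
Qed.

Lemma trig_continuous g (g0 g1 g2 : R) : trig_poly g g0 g1 g2 -> continuous g.
Proof.
elim=> {g g0 g1 g2} [u|u|c f f0 f1 f2 g g0 g1 g2 _ cf _ cg] x.
- apply: continuous_comp; last exact: continuous_cos.
  by apply: cvgM; [exact: cvg_cst|exact: cvg_id].
- apply: continuous_comp; last exact: continuous_sin.
  by apply: cvgM; [exact: cvg_cst|exact: cvg_id].
- by apply: cvgD; [apply: cvgM; [exact: cvg_cst|exact: cf]|exact: cg].
Qed.

Lemma trig_bounded g (g0 g1 g2 : R) : trig_poly g g0 g1 g2 ->
  exists M, forall x, `|g x| <= M.
Proof.
elim=> {g g0 g1 g2} [u|u|c f f0 f1 f2 g g0 g1 g2 _ [M hM] _ [K hK]].
- by exists 1 => x; exact: cos_max.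
- by exists 1 => x; exact: sin_max.
- exists (`|c| * M + K) => x; rewrite (le_trans (ler_normD _ _))// normrM lerD//.
  by rewrite ler_wpM2l.
Qed.

(* The integrand of the generator of a Levy process, applied to [g] at 0. *)
Definition jump_integrand g (g0 g1 x : R) : R :=
  g x - g0 - (if `|x| <= 1 then g1 * x else 0).

(** Of order x^2 near 0 by the Taylor bounds and bounded elsewhere. The integrand is linear in g and
    its jet, so cosines and sines suffice. *)
Lemma jump_integrand_bound g (g0 g1 g2 : R) : trig_poly g g0 g1 g2 ->
  exists M, forall x, `|jump_integrand g g0 g1 x| <= M * Num.min 1 (x ^+ 2).
Proof.
elim=> {g g0 g1 g2} [u|u|c f f0 f1 f2 g g0 g1 g2 _ [M hM] _ [K hK]].
- exists (2 + u ^+ 2) => x; rewrite /jump_integrand mul0r if_same subr0.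
  have [x1|x1] := leP 1 (x ^+ 2).
    rewrite mulr1 (le_trans (ler_normB _ _))// normr1.
    by have := cos_max (u * x); have := sqr_ge0 u; lra.
  rewrite (le_trans (norm_cosB1_le _))// real_normK ?num_real// exprMn.
  by rewrite ler_wpM2r ?sqr_ge0// lerDr.
- exists (1 + `|u| ^+ 3) => x; rewrite /jump_integrand subr0.
  have [x1|x1] := leP `|x| 1.
    have xx : x ^+ 2 <= 1 by rewrite -real_normK ?num_real// exprn_ile1.
    rewrite min_r//; apply: le_trans (norm_sinB_le _) _.
    rewrite normrM exprMn -(real_normK (num_real x)) mulrDl mul1r ler_wpDl//.
    by rewrite ler_wpM2l// ler_wiXn2l.
  have xx : 1 <= x ^+ 2 by rewrite -real_normK ?num_real// exprn_ege1// ltW.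
  rewrite subr0 min_l// mulr1 (le_trans (sin_max _))// lerDl.
  by rewrite exprn_ge0.
- exists (`|c| * M + K) => x.
  have -> : jump_integrand (fun y => c * f y + g y) (c * f0 + g0) (c * f1 + g1)
    x =
      c * jump_integrand f f0 f1 x + jump_integrand g g0 g1 x.
    by rewrite /jump_integrand; case: ifP => _; ring.
  rewrite (le_trans (ler_normD _ _))// normrM mulrDl lerD// -mulrA.
  by rewrite ler_wpM2l.
Qed.

End TrigPolynomials.

Section SequenceDerivative.
Context (R : realType).

Lemma cvg_scaled_difference (F : R -> R) (dF t : R) : is_derive (0 : R) 1 F dF ->
  N%:R * (F (t / N%:R) - F 0) @[N --> \oo] --> t * dF.
Proof.
move=> [dF1 dFE]; have [->|t0] := eqVneq t 0.
  by under eq_fun do rewrite mul0r subrr mulr0; rewrite mul0r; exact: cvg_cst.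
have /cvgr_dnbhsP H : h^-1 *: ((F \o shift 0) (h *: 1) - F 0) @[h --> 0^'] --> dF.
  by rewrite -dFE.
(* The shift removes N = 0, so that t / N is a sequence of nonzero reals tending to 0. *)
rewrite -cvg_shiftS.
have := H (fun N => t / N.+1%:R) _.
have -> : (fun N : nat => N.+1%:R * (F (t / N.+1%:R) - F 0)) =
    fun N => t * ((t / N.+1%:R)^-1 *: ((F \o shift 0) ((t / N.+1%:R) *: 1) - F
      0)).
  apply/funext => N; rewrite /= /shift/= addr0 [_ *: 1]mulr1 /GRing.scale/=.
  by rewrite invf_div mulrA; congr (_ * _); field.
move=> H'; apply: cvgM; first exact: cvg_cst.
apply: H'; split; first by move=> N; rewrite mulf_neq0// invr_neq0.
rewrite -[X in _ --> X](mulr0 t); apply: cvgM; first exact: cvg_cst.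
exact: cvg_harmonic.
Qed.

Lemma cvg_expR_cos (a b t : R) :
  N%:R * (expR (t / N%:R * a) * cos (t / N%:R * b) - 1) @[N --> \oo] --> t * a.
Proof.
have := @cvg_scaled_difference (fun h => expR (h * a) * cos (h * b)) a t.
rewrite !mul0r expR0 cos0 mulr1; apply.
apply: is_derive_eq; rewrite !mul0r expR0 cos0 sin0.
by rewrite /GRing.scale/=; ring.
Qed.

Lemma cvg_expR_sin (a b t : R) :
  N%:R * (expR (t / N%:R * a) * sin (t / N%:R * b) - 0) @[N --> \oo] --> t * b.
Proof.
have := @cvg_scaled_difference (fun h => expR (h * a) * sin (h * b)) b t.
rewrite !mul0r expR0 sin0 mulr0.
apply; apply: is_derive_eq; rewrite !mul0r expR0 cos0 sin0.
by rewrite /GRing.scale/=; ring.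
Qed.

End SequenceDerivative.

(** * The generator at 0 on trigonometric polynomials *)

Section Generator.
Context d (T : measurableType d) (R : realType) (P : probability T R).
Variables (X : R -> {RV P >-> R}) (sigma : R) (nu : {measure set R ->
  \bar R}) (b : R).
Hypothesis hnu : levy_measure nu.
Hypothesis hchar : forall t u : R, 0 <= t ->
    let re := levy_exponent_re sigma nu u in
    let im := levy_exponent_im b nu u in
    ('E_P[fun w => cos (u * X t w)] = (expR (t * re) * cos (t * im))%:E)%E /\
    ('E_P[fun w => sin (u * X t w)] = (expR (t * re) * sin (t * im))%:E)%E.

Lemma integrable_min1_sqr : nu.-integrable setT (fun x =>
  (Num.min 1 (x ^+ 2))%:E).
Proof.
have [_ fin] := hnu; apply/integrableP; split.
  apply/measurable_EFinP; apply: measurable_minr => //.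
by under eq_integral do rewrite gee0_abs ?lee_fin ?le_min ?ler01 ?sqr_ge0//.
Qed.

Lemma integrable_jump_integrand g (g0 g1 g2 : R) : trig_poly g g0 g1 g2 ->
  nu.-integrable setT (EFin \o jump_integrand g g0 g1).
Proof.
move=> tg; have [M hM] := jump_integrand_bound tg.
have := integrableZl measurableT `|M| integrable_min1_sqr.
apply: le_integrable => //.
  apply/measurable_EFinP; apply: measurable_funB.
    apply: measurable_funB => //; apply: continuous_measurable_fun.
    exact: trig_continuous tg.
  apply: measurable_fun_ifT => //.
    by apply: measurable_fun_ler => //; exact: measurableT_comp.
move=> x _; rewrite lee_fin/= (le_trans (hM x))//.
have m0 : 0 <= Num.min 1 (x ^+ 2) by rewrite le_min ler01 sqr_ge0.
by rewrite [leRHS]ger0_norm ?mulr_ge0// ler_wpM2r// ler_norm.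
Qed.

Definition generator g (g0 g1 g2 : R) : R :=
  sigma ^+ 2 / 2 * g2 + b * g1 + \int[nu]_x jump_integrand g g0 g1 x.

Lemma trig_has_all_moments g (g0 g1 g2 : R) t : trig_poly g g0 g1 g2 ->
  has_all_moments P (fun w => g (X t w)).
Proof.
move=> tg; have [M hM] := trig_bounded tg.
apply: has_all_moments_le (has_all_moments_cst P M) _.
  apply: measurableT_comp => //; apply: continuous_measurable_fun.
  exact: trig_continuous tg.
by move=> w; rewrite (le_trans (hM _))// ler_norm.
Qed.

(** For a cosine or a sine this is the derivative at h = 0 of the real or imaginary part of e^(h
    psi(u)). Both sides are linear in g, the right one because the jump integrands are
    integrable. *)
Lemma generator_limit g (g0 g1 g2 t : R) : trig_poly g g0 g1 g2 -> 0 <= t ->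
  N%:R * (\int[P]_w g (X (t / N%:R) w) - g0) @[N --> \oo] --> t * generator g
    g0 g1 g2.
Proof.
move=> tg t0; have tN0 N : 0 <= t / N%:R :> R by rewrite divr_ge0.
elim: tg => {g g0 g1 g2} [u|u|c f f0 f1 f2 g g0 g1 g2 tf IHf tg IHg].
- have -> : generator (fun x => cos (u * x)) 1 0 (- u ^+ 2) = levy_exponent_re
  sigma nu u.
    rewrite /generator /levy_exponent_re mulr0 addr0; congr (_ + _);
      first by field.
    by apply: eq_Rintegral => x _; rewrite /jump_integrand mul0r if_same subr0.
  have := @cvg_expR_cos R (levy_exponent_re sigma nu u) (levy_exponent_im b nu
    u) t.
  apply: cvg_trans; apply: near_eq_cvg; apply: nearW => N.
  have [/= h _] := hchar u (tN0 N).
  by rewrite /Rintegral; move: h; rewrite unlock => ->.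
- have -> : generator (fun x => sin (u * x)) 0 u 0 = levy_exponent_im b nu u.
    rewrite /generator /levy_exponent_im mulr0 add0r; congr (_ + _).
    by apply: eq_Rintegral => x _; rewrite /jump_integrand subr0.
  have := @cvg_expR_sin R (levy_exponent_re sigma nu u) (levy_exponent_im b nu
    u) t.
  apply: cvg_trans; apply: near_eq_cvg; apply: nearW => N.
  have [_ /= h] := hchar u (tN0 N).
  by rewrite /Rintegral; move: h; rewrite unlock => ->.
- have -> : t * generator (fun x => c * f x + g x) (c * f0 + g0) (c * f1 + g1)
  (c * f2 + g2) =
      c * (t * generator f f0 f1 f2) + t * generator g g0 g1 g2.
    rewrite /generator (_ : \int[nu]_x _ = c * \int[nu]_x jump_integrand f f0
      f1 x +
        \int[nu]_x jump_integrand g g0 g1 x); first by ring.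
    have ig := integrable_jump_integrand tg;
      have if_ := integrable_jump_integrand tf.
    have icf : nu.-integrable setT (EFin \o (fun x =>
      c * jump_integrand f f0 f1 x)).
      exact: (integrableZl measurableT c if_).
    rewrite -RintegralZl// -RintegralD//.
    by apply: eq_Rintegral => x _; rewrite /jump_integrand; case: ifP => _; ring.
  rewrite (_ : (fun N => _) = fun N => c * (N%:R * (\int[P]_w f (X (t / N%:R)
    w) - f0)) +
      N%:R * (\int[P]_w g (X (t / N%:R) w) - g0)).
    by apply: cvgD => //; apply: cvgM; [exact: cvg_cst|exact: IHf].
  apply/funext => N.
  have mf := trig_has_all_moments (t / N%:R) tf;
    have mg := trig_has_all_moments (t / N%:R) tg.
  rewrite ExpectationD//; last exact: has_all_momentsZ.
  by rewrite ExpectationZ//; ring.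
Qed.

End Generator.

(** * Integrability of powers under the Levy measure, and the cumulants as limits *)

Section Cumulants.
Context (R : realType).

Lemma fatou_Rintegral d (T : measurableType d) (mu : {measure set T -> \bar R})
    (f_ : nat -> T -> R) (f : T -> R) (C : R) :
  (forall n, mu.-integrable setT (EFin \o f_ n)) ->
  (forall n x, 0 <= f_ n x) -> (forall x, f_ n x @[n --> \oo] --> f x) ->
  (forall n, \int[mu]_x f_ n x <= C) -> mu.-integrable setT (EFin \o f).
Proof.
move=> if_ f_0 cf fC.
have mf_ n : measurable_fun setT (EFin \o f_ n) by case/integrableP : (if_ n).
have ecf x : (EFin \o f_ n) x @[n --> \oo] --> (EFin \o f) x.
  by apply: cvg_EFin; [exact: nearW|exact: cf].
have f0 x : 0 <= f x.
  by apply: (cvgr_to_ge (cf x)); exact: nearW.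
apply/integrableP; split.
  by apply: (emeasurable_fun_cvg (fun n => EFin \o f_ n)) => // x _; exact: ecf.
under eq_integral do rewrite gee0_abs ?lee_fin//.
apply: (@le_lt_trans _ _ C%:E); last exact: ltry.
have -> : (\int[mu]_x (f x)%:E = \int[mu]_x limn_einf (fun n => (f_ n x)%:E))%E.
  apply: eq_integral => x _; rewrite is_cvg_limn_einfE.
    by symmetry; apply: cvg_lim => //; exact: ecf.
  by apply/cvg_ex; eexists; exact: ecf.
apply: (le_trans (fatou _ _ mf_ _)) => // [n x _|]; first by rewrite lee_fin.
rewrite limn_einf_lim; apply: lime_le; first exact: is_cvg_einfs.
apply: nearW => n; apply: (@le_trans _ _ (\int[mu]_x (f_ n x)%:E)%E).
  by apply: ereal_inf_lbound; exists n => //=.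
have ifin := integrable_fin_num measurableT (if_ n).
by have := fC n; rewrite -lee_fin fineK.
Qed.

Context d (T : measurableType d) (P : probability T R).
Variables (X : R -> {RV P >-> R}) (sigma : R) (nu : {measure set R ->
  \bar R}) (b : R).
Hypotheses (hX : levy_process X) (hmoments : all_moments X)
  (hcentered : centered X).
Hypothesis hnu : levy_measure nu.
Hypothesis hchar : forall t u : R, 0 <= t ->
    let re := levy_exponent_re sigma nu u in
    let im := levy_exponent_im b nu u in
    ('E_P[fun w => cos (u * X t w)] = (expR (t * re) * cos (t * im))%:E)%E /\
    ('E_P[fun w => sin (u * X t w)] = (expR (t * re) * sin (t * im))%:E)%E.

Definition levy_cumulant (k : nat) : R :=
  sigma ^+ 2 * (k == 2%N)%:R + \int[nu]_x (x ^+ k).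

Lemma integrable_scaled_sinX (e : R) k : 0 < e ->
  nu.-integrable setT (EFin \o (fun x => scaled_sin e x ^+ k.+2)).
Proof.
move=> e0; have := integrable_jump_integrand hnu (trig_scaled_sinX k e0).
rewrite (_ : jump_integrand _ _ _ = fun x => scaled_sin e x ^+ k.+2)//.
by apply/funext => x; rewrite /jump_integrand mul0r if_same !subr0.
Qed.

Lemma scaled_sinX_limit (e t : R) k : 0 < e -> 0 <= t ->
  N%:R * \int[P]_w (scaled_sin e (X (t / N%:R) w) ^+ k.+2) @[N --> \oo] -->
  t * (sigma ^+ 2 * (k == 0%N)%:R + \int[nu]_x (scaled_sin e x ^+ k.+2)).
Proof.
move=> e0 t0; have := generator_limit hnu hchar (trig_scaled_sinX k e0) t0.
rewrite /generator mulr0 addr0.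
have -> : \int[nu]_x jump_integrand (fun x0 : R =>
  scaled_sin e x0 ^+ k.+2) 0 0 x =
    \int[nu]_x (scaled_sin e x ^+ k.+2).
  by apply: eq_Rintegral => x _; rewrite /jump_integrand mul0r if_same !subr0.
have -> : sigma ^+ 2 / 2 * (2 * (k == 0%N)%:R) = sigma ^+ 2 * (k == 0%N)%:R :> R.
  by field.
by under eq_fun do rewrite subr0.
Qed.

Lemma abs_levy_moment_bound (t : R) k : 0 <= t -> exists2 C : R, 0 <= C &
  forall N, (0 < N)%N -> N%:R * \int[P]_w (`|X (t / N%:R) w| ^+ k.+2) <= C.
Proof.
move=> t0; have [C C0 HC] := levy_moment_bound hX hmoments t0 k.+3.
have mX N : has_all_moments P (X (t / N%:R)).
  by apply: levy_has_all_moments => //; rewrite divr_ge0.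
have mnX N := has_all_moments_norm (mX N).
have evenE j N : ~~ odd j -> \int[P]_w (`|X (t / N%:R) w| ^+ j) = levy_moment X
  (t / N%:R) j.
  move=> ej; apply: eq_Rintegral => w _; rewrite -normrX ger0_norm//.
  by rewrite exprn_even_ge0.
have bd j N : (0 < j <= k.+3)%N -> (0 < N)%N -> ~~ odd j ->
    N%:R * \int[P]_w (`|X (t / N%:R) w| ^+ j) <= C.
  move=> jk N0 ej; rewrite evenE//; apply: le_trans (HC j jk N N0).
  by rewrite ler_wpM2l// ler_norm.
exists (C + C); first exact: addr_ge0.
move=> N N0; have [ok|ek] := boolP (odd k); last first.
  by rewrite (le_trans (bd k.+2 N _ _ _))//= ?negbK// lerDl.
apply: (@le_trans _ _ (N%:R * \int[P]_w (`|X (t / N%:R) w| ^+ k.+1 + `|X (t /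
  N%:R) w| ^+ k.+3))).
  rewrite ler_wpM2l// le_Expectation//; first exact: has_all_momentsX.
    by apply: has_all_momentsD; exact: has_all_momentsX.
  move=> w; set y : R := `|_|; have y0 : 0 <= y by exact: normr_ge0.
  have yk : 0 <= y ^+ k.+1 by exact: exprn_ge0.
  (* An odd order is bounded by its even neighbours: expanding y^(k+1) (y - 1/2)^2 >= 0 gives
     y^(k+2) <= y^(k+3) + y^(k+1) / 4. *)
  have := mulr_ge0 yk (sqr_ge0 (y - 1 / 2)).
  by rewrite (exprS y k.+2) (exprS y k.+1); lra.
rewrite ExpectationD; [|exact: has_all_momentsX..].
rewrite mulrDr lerD//; apply: bd => //=; rewrite ?negbK//.
exact/leqW/leqnSn.
Qed.

(* Fatou's lemma for the trigonometric polynomials (sin(e x)/e)^(k+2), whose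
   nu-integrals are limits of N E[(sin(e X_(1/N))/e)^(k+2)]. *)
Lemma integrable_levy_even k : ~~ odd k ->
  nu.-integrable setT (EFin \o (fun x => x ^+ k.+2)).
Proof.
move=> ek; have [C C0 HC] := abs_levy_moment_bound k ler01.
have ev x : 0 <= x ^+ k.+2 :> R by rewrite exprn_even_ge0//= negbK.
have h0 m : 0 < harmonic m :> R by rewrite /harmonic invr_gt0.
apply: (@fatou_Rintegral _ _ nu (fun m x =>
  scaled_sin (harmonic m) x ^+ k.+2) _ C).
- by move=> m; exact: integrable_scaled_sinX.
- by move=> m x; exact: ev.
- move=> x; apply/cvgrPdist_le => e e0.
  have : (k.+2%:R * `|x| ^+ k.+4) * (harmonic m * harmonic m) @[m --> \oo] --> 0.
    rewrite -(mulr0 (k.+2%:R * `|x| ^+ k.+4)); apply: cvgM; first exact: cvg_cst.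
    by rewrite -(mulr0 0); apply: cvgM; exact: cvg_harmonic.
  move=> /cvgrPdist_le /(_ e e0); apply: filterS => m.
  rewrite sub0r normrN => /(le_trans (ler_norm _)); apply: le_trans.
  apply: le_trans (scaled_sinX_approx x k.+1 (h0 m)) _.
  by rewrite le_eqVlt; apply/orP; left; apply/eqP; ring.
- move=> m; have lim := @scaled_sinX_limit _ _ k (h0 m) ler01.
  apply: (@le_trans _ _ (1 * (sigma ^+ 2 * (k == 0%N)%:R +
      \int[nu]_x (scaled_sin (harmonic m) x ^+ k.+2)))).
    by rewrite mul1r lerDr mulr_ge0// sqr_ge0.
  apply: (cvgr_to_le lim); near=> N.
  have N0 : (0 < N)%N by near: N; exact: nbhs_infty_gt.
  apply: le_trans (HC N N0); rewrite ler_wpM2l//.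
  have mX : has_all_moments P (X (1 / N%:R)).
    by apply: levy_has_all_moments => //; rewrite divr_ge0.
  apply: le_Expectation.
  + exact: trig_has_all_moments (trig_scaled_sinX k (h0 m)).
  + exact/has_all_momentsX/has_all_moments_norm.
  + move=> w; rewrite (le_trans (ler_norm _))// normrX lerXn2r ?nnegrE//.
    exact: norm_scaled_sin_le.
Unshelve. all: by end_near. Qed.

Lemma integrable_levy_power k : (2 <= k)%N ->
  nu.-integrable setT (EFin \o (fun x => x ^+ k)).
Proof.
case: k => [|[|k]]// _; have [ok|ek] := boolP (odd k); last first.
  exact: integrable_levy_even.
case: k ok => // k /= ek.
have := integrableD measurableT (integrable_levy_even ek)
  (@integrable_levy_even k.+2 _); rewrite /= negbK => /(_ ek).
apply: le_integrable => //.
  by apply/measurable_EFinP; exact: exprn_measurable.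
move=> x _; rewrite lee_fin/=.
have ev y : 0 <= y ^+ k.+2 :> R by rewrite exprn_even_ge0//= negbK.
rewrite [leRHS]ger0_norm; last by rewrite addr_ge0// !exprS mulrA mulr_ge0//
  -?expr2 ?sqr_ge0// -!exprS.
rewrite exprS normrM [X in _ * X]ger0_norm//.
rewrite (_ : x ^+ k.+4 = x ^+ 2 * x ^+ k.+2); last by rewrite -exprD.
rewrite -[X in X + _]mul1r -mulrDl ler_wpM2r//.
by rewrite ler_norml; apply/andP; split; nra.
Qed.

Lemma integrable_levy_abs_power k : (2 <= k)%N ->
  nu.-integrable setT (EFin \o (fun x => `|x| ^+ k)).
Proof.
move=> k2; have := integrable_abse (integrable_levy_power k2).
rewrite (_ : _ \o _ = EFin \o (fun x => `|x| ^+ k))//.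
by apply/funext => x /=; rewrite normrX.
Qed.

(** The power is replaced by that of the scaled sine on both sides. The errors are h^2 times moments
    of order k + 2, bounded uniformly in N under P and finite under [nu]; for the sine itself the
    limit is known. *)
Lemma levy_moment_limit (t : R) k : 0 <= t -> (2 <= k)%N ->
  N%:R * levy_moment X (t / N%:R) k @[N --> \oo] --> t * levy_cumulant k.
Proof.
move=> t0; case: k => [|[|k]]// _.
have [C C0 HC] := abs_levy_moment_bound k.+2 t0.
set K := \int[nu]_x (`|x| ^+ k.+4).
have K0 : 0 <= K by apply: Rintegral_ge0 => x _; exact: exprn_ge0.
apply/cvgrPdist_le => e e0; have e3 : 0 < e / 3 by rewrite divr_gt0.
(* The scale is fixed before N: [C] bounds the error under P for all N >= 1, and [t * K] the error
   under [nu]. *)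
have [m Hm] : exists m, k.+2%:R * (harmonic m * harmonic m) * (C + t * K) <= e
  / 3.
  have : k.+2%:R * (harmonic m * harmonic m) * (C + t * K) @[m --> \oo] --> 0.
    rewrite -(mul0r (C + t * K)); apply: cvgM; last exact: cvg_cst.
    rewrite -(mulr0 k.+2%:R); apply: cvgM; first exact: cvg_cst.
    by rewrite -(mulr0 0); apply: cvgM; exact: cvg_harmonic.
  move=> /cvgrPdist_le /(_ _ e3)[m _ H]; exists m.
  have := H m (leqnn m); rewrite /= sub0r normrN; apply: le_trans;
    exact: ler_norm.
set h := harmonic m in Hm; have h0 : 0 < h by rewrite /h /harmonic invr_gt0.
have /cvgrPdist_le /(_ _ e3) := @scaled_sinX_limit _ _ k h0 t0.
set G := sigma ^+ 2 * _ + _.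
move=> H; near=> N.
have HN : `|t * G - N%:R * \int[P]_w (scaled_sin h (X (t / N%:R) w) ^+ k.+2)|
  <= e / 3.
  by near: N.
have N0 : (0 < N)%N by near: N; exact: nbhs_infty_gt.
have mX : has_all_moments P (X (t / N%:R)).
  by apply: levy_has_all_moments => //; rewrite divr_ge0.
set S := \int[P]_w _ in HN.
have mS := trig_has_all_moments X (t / N%:R) (trig_scaled_sinX k h0).
have h1 : `|levy_moment X (t / N%:R) k.+2 - S| <=
    k.+2%:R * h ^+ 2 * \int[P]_w (`|X (t / N%:R) w| ^+ k.+4).
  rewrite /levy_moment /S -RintegralB//; last 2 first.
  - exact: has_all_moments_integrable (has_all_momentsX _ mX).
  - exact: has_all_moments_integrable mS.
  have mB : has_all_moments P (fun w => X (t / N%:R) w ^+ k.+2 +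
      (-1) * scaled_sin h (X (t / N%:R) w) ^+ k.+2).
    by apply: has_all_momentsD; [exact: has_all_momentsX|exact: has_all_momentsZ].
  rewrite -ExpectationZ; last exact/has_all_momentsX/has_all_moments_norm.
  under eq_Rintegral do rewrite -mulN1r.
  apply: le_trans (le_normr_Rintegral _ (has_all_moments_integrable mB)) _ => //.
  apply: le_Expectation.
  - exact: has_all_moments_norm.
  - by apply: has_all_momentsZ; exact/has_all_momentsX/has_all_moments_norm.
  - by move=> w; rewrite mulN1r; exact: scaled_sinX_approx.
have h2 : `|levy_cumulant k.+2 - G| <= k.+2%:R * h ^+ 2 * K.
  rewrite /levy_cumulant /G (_ : (k.+2 == 2%N) = (k == 0%N))//.
  rewrite opprD addrACA subrr add0r -RintegralB//; last 2 first.
  - exact: integrable_levy_power.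
  - exact: integrable_scaled_sinX.
  have iB : nu.-integrable setT (EFin \o (fun x =>
    x ^+ k.+2 - scaled_sin h x ^+ k.+2)).
    exact: (integrableB measurableT (integrable_levy_power (isT : (2 <= k.+2)%N))
      (integrable_scaled_sinX k h0)).
  apply: le_trans (le_normr_Rintegral _ iB) _ => //.
  rewrite /K -RintegralZl//; last exact: integrable_levy_abs_power.
  apply: le_Rintegral => //.
  - exact: (integrable_abse iB).
  - exact: (integrableZl measurableT _ (integrable_levy_abs_power (isT : (2 <=
    k.+4)%N))).
  - by move=> x _; exact: scaled_sinX_approx.
have HCN := HC N N0.
set A := \int[P]_w _ in h1 HCN.
have hN : `|N%:R * (levy_moment X (t / N%:R) k.+2 - S)| <= k.+2%:R * h ^+ 2 * C.
  rewrite normrM normr_nat (le_trans (ler_wpM2l _ h1))//.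
  by rewrite mulrCA ler_wpM2l// mulr_ge0// sqr_ge0.
have ht : `|t * (levy_cumulant k.+2 - G)| <= t * (k.+2%:R * h ^+ 2 * K).
  by rewrite normrM (ger0_norm t0) ler_wpM2l.
have -> : t * levy_cumulant k.+2 - N%:R * levy_moment X (t / N%:R) k.+2 =
  t * (levy_cumulant k.+2 - G) + (t * G - N%:R * S) -
  N%:R * (levy_moment X (t / N%:R) k.+2 - S) by ring.
rewrite (le_trans (ler_normB _ _))//.
apply: (@le_trans _ _ (t * (k.+2%:R * h ^+ 2 * K) + e / 3 + k.+2%:R * h ^+ 2 *
  C)).
  by rewrite lerD// (le_trans (ler_normD _ _))// lerD.
rewrite (_ : _ + _ + _ = k.+2%:R * (h * h) * (C + t * K) + e / 3); last by ring.
by lra.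
Unshelve. all: by end_near. Qed.

End Cumulants.

(** * Passage to the limit *)

Lemma cvg_KS (R : realType) (m : nat) (z : nat -> nat -> R) (x : nat -> R) :
  (forall j, (0 < j)%N -> z k j @[k --> \oo] --> x j) ->
  KS m (z k) @[k --> \oo] --> KS m x.
Proof.
move=> zx; elim/ltn_ind: m => -[_|m IHm].
  by rewrite KS0; under eq_fun do rewrite KS0; exact: cvg_cst.
rewrite KS_rec//; under eq_fun do rewrite KS_rec//.
apply: cvgM; first exact: cvg_cst.
apply: cvg_big_seq => j; rewrite mem_index_iota => /andP[j0 jm].
apply: cvgM; first by apply: cvgM; [exact: cvg_cst|exact: zx].
by apply: IHm; rewrite ltn_subrL j0.
Qed.

Section AlmostSureSubsequence.
Context d (T : measurableType d) (R : realType) (P : probability T R).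

(** Borel-Cantelli: along [phi] the deviation exceeds 2^-(k+1) with probability at most 2^-(k+1),
    which is summable. Requiring k < phi k makes the indices tend to infinity and keeps them
    positive. *)
Lemma ae_subsequence (S : nat -> T -> R) (Z : T -> R) :
  (forall N, measurable_fun setT (S N)) -> measurable_fun setT Z ->
  (forall e : R, 0 < e -> \forall N \near \oo,
     (P [set w | (e <= `|S N w - Z w|)%R] <= e%:E)%E) ->
  exists phi : nat -> nat, [/\ (forall k, (k < phi k)%N),
    phi k @[k --> \oo] --> \oo &
    {ae P, forall w, S (phi k) w @[k --> \oo] --> Z w}].
Proof.
move=> mS mZ SZ.
pose e k : R := 1 / (2 ^ k.+1)%:R.
have e0 k : 0 < e k by rewrite /e divr_gt0// ltr0n expn_gt0.
have /choice[phi Hphi] k : exists N, (k < N)%N /\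
    (P [set w | (e k <= `|S N w - Z w|)%R] <= (e k)%:E)%E.
  have [N0 _ HN] := SZ (e k) (e0 k).
  exists (maxn k.+1 N0); split; first by rewrite leq_maxl.
  by apply: HN; rewrite /= leq_maxr.
have phik k : (k < phi k)%N by have [] := Hphi k.
exists phi; split => //.
  apply/cvgnyPge => M; near=> k; apply: leq_trans (ltnW (phik k)).
  by near: k; exact: nbhs_infty_ge.
pose F k := [set w | e k <= `|S (phi k) w - Z w|].
have mF k : measurable (F k).
  rewrite (_ : F k = (fun w => `|S (phi k) w - Z w|) @^-1` `[e k, +oo[).
    rewrite -[X in measurable X]setTI.
    by apply: measurableT_comp => //; exact: measurable_funB.
  by apply/seteqP; split=> w /=; rewrite in_itv/= andbT.
have PF : P (lim_sup_set F) = 0%E.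
  apply: lim_sup_set_cvg0 => //.
  apply: (@le_lt_trans _ _ (\sum_(k <oo) (e k)%:E)%E).
    by apply: lee_nneseries => // k _; have [] := Hphi k.
  apply: le_lt_trans (epsilon_trick0 xpredT (ltW (@ltr01 R))) _.
  exact: ltry.
exists (lim_sup_set F); split => //.
  apply: bigcap_measurable => // k _; exact: bigcup_measurable.
move=> w /= nc; apply: contrapT => nF; apply: nc.
have [n Hn] : exists n, forall k, (n <= k)%N -> `|S (phi k) w - Z w| < e k.
  apply: contrapT => /forallNP H; apply: nF => n _.
  have /existsNP[k /not_implyP[nk /negP]] := H n.
  by rewrite -leNgt => Fk; exists k.
apply/cvgrPdist_lt => r r0.
have := @cvg_harmonic R => /cvgrPdist_lt /(_ r r0) [K _ HK].
near=> k.
rewrite distrC; apply: (@lt_trans _ _ (e k)).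
  by apply: Hn; near: k; exact: nbhs_infty_ge.
apply: (@le_lt_trans _ _ (harmonic k)).
  rewrite /e /harmonic div1r lef_pV2 ?posrE ?ltr0n ?expn_gt0// ler_nat.
  exact/ltnW/ltn_expl.
have : (K <= k)%N by near: k; exact: nbhs_infty_ge.
move=> /HK /=; rewrite sub0r normrN; apply: le_lt_trans; exact: ler_norm.
Unshelve. all: by end_near. Qed.

(** [Vitali_expectation] is applied to every power of the sequence: the square integrability of all
    powers of the limit gives its moments, and the first power gives the convergence of means. *)
Lemma Vitali_bounded_moments (Z_ : nat -> T -> R) (Z : T -> R) :
  bounded_moments P Z_ -> measurable_fun setT Z ->
  {ae P, forall w, Z_ n w @[n --> \oo] --> Z w} ->
  has_all_moments P Z /\ \int[P]_w Z_ n w @[n --> \oo] --> \int[P]_w Z w.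
Proof.
move=> [mZ_ bZ_] mZ cZ.
have step r : P.-integrable setT (fun w => (Z w ^+ r ^+ 2)%:E) /\
    \int[P]_w (Z_ n w ^+ r) @[n --> \oo] --> \int[P]_w (Z w ^+ r).
  have [B hB] := bZ_ r.
  apply: (@Vitali_expectation _ _ _ P (fun n w => Z_ n w ^+ r) _ B).
  - by move=> n; exact: has_all_momentsX.
  - exact: measurable_funX.
  - by move=> n; under eq_Rintegral do rewrite -exprM.
  - apply: filterS cZ => w cw; elim: r {hB} => [|r IHr].
      by under eq_fun do rewrite expr0; rewrite expr0; exact: cvg_cst.
    by under eq_fun do rewrite exprS; rewrite exprS; exact: cvgM.
split; last first.
  have E (U : T -> R) : \int[P]_w (U w ^+ 1) = \int[P]_w U w.
    by apply: eq_Rintegral => w _; rewrite expr1.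
  by have [_] := step 1%N; rewrite E; under eq_fun do rewrite E.
split=> // r; have [i2 _] := step r.
have : P.-integrable setT (fun w => 1%:E + (Z w ^+ r ^+ 2)%:E)%E.
  apply: integrableD => //.
  exact: (@finite_measure_integrable_cst _ _ _ P setT 1 measurableT).
apply: le_integrable => //=.
  by apply/measurable_EFinP; exact: measurable_funX.
move=> w _; rewrite lee_fin; set x := Z w ^+ r.
rewrite [leRHS]ger0_norm ?addr_ge0 ?sqr_ge0//.
by rewrite ler_norml; apply/andP; split; nra.
Qed.

Lemma bounded_moments_sum (I : Type) (s : seq I) (F : I -> nat -> T -> R) :
  (forall i, bounded_moments P (F i)) ->
  bounded_moments P (fun n w => \sum_(i <- s) F i n w).
Proof.
move=> hF; elim: s => [|i s IHs].
  rewrite (_ : (fun _ _ => _) = fun _ _ => 0); first exact: bounded_moments_cst.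
  by apply/funext => n; apply/funext => w; rewrite big_nil.
rewrite (_ : (fun _ _ => _) = fun n => F i n \+ (fun w => \sum_(i <- s) F i n w)).
  exact: bounded_momentsD.
by apply/funext => n; apply/funext => w; rewrite big_cons.
Qed.

Lemma bounded_moments_KS (m : nat) (Z_ : nat -> nat -> T -> R) :
  (forall j, (0 < j)%N -> bounded_moments P (Z_ j)) ->
  bounded_moments P (fun n w => KS m (fun j => Z_ j n w)).
Proof.
move=> hZ; elim/ltn_ind: m => -[_|m IHm].
  rewrite (_ : (fun _ _ => _) = fun _ _ => 1); first exact: bounded_moments_cst.
  by apply/funext => n; apply/funext => w; rewrite KS0.
rewrite (_ : (fun _ _ => _) = fun n => (fun=> m.+1%:R^-1) \* (fun w =>
   \sum_(i < m.+1) ((fun=> (-1) ^+ i) \* (Z_ i.+1 n \*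
      (fun w => KS (m - i) (fun j => Z_ j n w)))) w)).
  apply: (@bounded_momentsM _ _ _ _ (fun=> (fun=> m.+1%:R^-1))).
    exact: bounded_moments_cst.
  apply: bounded_moments_sum => i.
  apply: (@bounded_momentsM _ _ _ _ (fun=> (fun=> (-1) ^+ i))).
    exact: bounded_moments_cst.
  apply: bounded_momentsM; first exact: hZ.
  by apply: IHm; rewrite ltnS leq_subr.
apply/funext => n; apply/funext => w; rewrite /= KS_rec// big_add1/= big_mkord.
congr (_ * _); apply: eq_bigr => i _.
by rewrite subSS !exprS !mulrA !mulN1r opprK mul1r.
Qed.

Lemma measurable_KS (m : nat) (x : nat -> T -> R) :
  (forall j, (0 < j)%N -> measurable_fun setT (x j)) ->
  measurable_fun setT (fun w => KS m (fun j => x j w)).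
Proof.
move=> mx; elim/ltn_ind: m => -[_|m IHm].
  by under eq_fun do rewrite KS0; exact: measurable_cst.
under eq_fun do rewrite KS_rec// big_add1/= big_mkord.
apply: measurable_funM => //; apply: measurable_sum => i.
apply: measurable_funM; first by apply: measurable_funM => //; exact: mx.
by apply: IHm; rewrite ltnS subSS leq_subr.
Qed.

End AlmostSureSubsequence.

(** * The variations and their Kailath-Segall polynomials as limits along grids *)

Section Variations.
Context d (T : measurableType d) (R : realType) (P : probability T R).
Variables (X Q : R -> {RV P >-> R}) (sigma : R) (nu : {measure set R ->
  \bar R}) (b : R).
Hypotheses (hX : levy_process X) (hmoments : all_moments X)
  (hcentered : centered X) (hQ : is_quadratic_variation X Q).
Hypothesis hnu : levy_measure nu.
Hypothesis hchar : forall t u : R, 0 <= t ->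
    let re := levy_exponent_re sigma nu u in
    let im := levy_exponent_im b nu u in
    ('E_P[fun w => cos (u * X t w)] = (expR (t * re) * cos (t * im))%:E)%E /\
    ('E_P[fun w => sin (u * X t w)] = (expR (t * re) * sin (t * im))%:E)%E.
Variable t : R.
Hypothesis t0 : 0 <= t.
Local Notation S := (grid_power_sum X t).
Local Notation x := (Xvar X Q).
Local Notation kappa := (levy_cumulant sigma nu).

Let grid N := mkseq (fun i => grid_point t N i.+1) N.

Let nth_grid N i : (i <= N)%N -> nth t (0 :: grid N) i = grid_point t N i.
Proof. by case: i => [_|i iN] /=; rewrite ?grid_point0// nth_mkseq. Qed.

Let squared_variation_grid N w : squared_variation X t (grid N) w = S 2 N w.
Proof.
rewrite /squared_variation size_mkseq /grid_power_sum /power_sum big_nat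
  [RHS]big_nat.
apply: eq_bigr => i /andP[_ iN]; congr (_ ^+ 2).
by rewrite [LHS]/= -[nth t (grid N) i]/(nth t (0 :: grid N) i.+1) !nth_grid//
  ltnW.
Qed.

Lemma grid_quadratic_variation (e : R) : 0 < e -> \forall N \near \oo,
  (P [set w | (e <= `|S 2 N w - Q t w|)%R] <= e%:E)%E.
Proof.
move=> e0; have [del del0 Hdel] := hQ t0 e0 e0.
(* For t = 0 the grid points coincide, so they do not form a strictly increasing partition; the
   empty partition replaces them. *)
move: (t0); rewrite le_eqVlt => /predU1P[t00|tpos].
  apply: nearW => N.
  have -> : [set w | e <= `|S 2 N w - Q t w|] =
      [set w | e <= `|squared_variation X t [::] w - Q t w|].
    apply/seteqP; split=> w /=; rewrite /squared_variation/= big_geq//;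
    rewrite /grid_power_sum /power_sum big1// => i _;
    by rewrite /grid_increment /grid_incr /grid_point -t00 !mul0r subrr expr0n.
  by apply: Hdel => //; split; rewrite //= t00.
near=> N.
have N0 : (0 < N)%N by near: N; exact: nbhs_infty_gt.
have tN : t / N%:R < del by near: N; exact: near_divn_lt.
have := Hdel (grid N); under eq_set do rewrite squared_variation_grid.
apply.
- split; last first.
    by rewrite (last_nth t) size_mkseq nth_grid// grid_pointN.
  apply/(pathP t) => i; rewrite size_mkseq => iN.
  rewrite -[nth t (grid N) i]/(nth t (0 :: grid N) i.+1) !nth_grid ?(ltnW iN)//.
  by rewrite grid_pointS// ltrDl divr_gt0// ltr0n.
- move=> i; rewrite size_mkseq => iN; rewrite !nth_grid ?(ltnW iN)//.
  by rewrite grid_pointS// addrAC subrr add0r.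
Unshelve. all: by end_near. Qed.

(** One subsequence and one null set serve all orders j. Only S_2 requires the extraction: S_1
    telescopes, and for j >= 3 the boundedness of S_2 along the path suffices. *)
Lemma exists_grid_subsequence : exists phi : nat -> nat,
  [/\ (forall k, (k < phi k)%N), phi k @[k --> \oo] --> \oo &
    {ae P, forall w, forall j, (0 < j)%N ->
      S j (phi k) w @[k --> \oo] --> x j t w}].
Proof.
have mS N : measurable_fun setT (S 2 N).
  by case: (bounded_grid_power_sum hX hmoments t0 (isT : (0 < 2)%N)) => /(_ N)[].
have [phi [phik cphi aeS2]] := ae_subsequence mS (measurable_funPT (Q t))
  grid_quadratic_variation.
exists phi; split => //.
apply: filterS2 aeS2 (levy_start hX) => w cS2 X0 j j0.
case: j j0 => [//|[|[|j]]] _ /=.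
- rewrite (_ : (fun k => _) = fun=> X t w); first exact: cvg_cst.
  apply/funext => k; rewrite grid_power_sum1 ?X0 ?subr0//.
  exact: leq_ltn_trans (phik k).
- exact: cS2.
- have [A HA] : exists A, forall k, S 2 (phi k) w <= A.
    have [A /ubP HA] := cvg_has_ub (cvgP _ cS2).
    by exists A => k; apply: le_trans (ler_norm _) _; apply: HA; exists k.
  under eq_fun do rewrite grid_power_sumE.
  apply: (@cvg_jump_power_sum _ _ _ _ _ _ _ _ _ A) => //.
    exact: (levy_cadlag hX).
  by move=> k; rewrite -grid_power_sumE.
Qed.

Lemma measurable_Xvar j : (0 < j)%N -> measurable_fun setT (x j t).
Proof.
case: j => [//|[|[|j]]] _ //=.
by apply: measurable_jump_power_sum => //; exact: (levy_cadlag hX).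
Qed.

Lemma variation_limit (F : nat -> T -> R) (G : T -> R) (phi : nat -> nat) :
  bounded_moments P F -> measurable_fun setT G ->
  {ae P, forall w, F (phi k) w @[k --> \oo] --> G w} ->
  has_all_moments P G /\ \int[P]_w F (phi k) w @[k --> \oo] --> \int[P]_w G w.
Proof.
move=> [mF bF] mG cF; apply: Vitali_bounded_moments => //; split=> [n //|k].
by have [B hB] := bF k; exists B => n.
Qed.

Let bS j : (0 < j)%N -> bounded_moments P (S j).
Proof. exact: bounded_grid_power_sum. Qed.

Lemma Xvar_has_all_moments j : (0 < j)%N -> has_all_moments P (x j t).
Proof.
move=> j0; have [phi [_ _ ae]] := exists_grid_subsequence.
have [] // := @variation_limit (S j) (x j t) phi (bS j0) (measurable_Xvar j0).
by apply: filterS ae => w; apply.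
Qed.

Lemma Expectation_Xvar1 : \int[P]_w x 1 t w = 0.
Proof.
have := levy_moment1 hcentered t0; rewrite /levy_moment.
by under eq_Rintegral do rewrite expr1.
Qed.

Lemma Expectation_Xvar j : (2 <= j)%N -> \int[P]_w x j t w = t * kappa j.
Proof.
move=> j2; have j0 : (0 < j)%N by exact: leq_trans j2.
have [phi [_ cphi ae]] := exists_grid_subsequence.
have [_ lim] := @variation_limit (S j) (x j t) phi (bS j0) (measurable_Xvar j0)
  (filterS (fun w h => h j j0) ae).
apply: (cvg_unique (@Rhausdorff R) lim) => /=.
under eq_fun do rewrite grid_power_sum_expectation//.
have := levy_moment_limit hX hmoments hnu hchar t0 j2.
exact: (cvg_comp _ _ cphi).
Qed.

Lemma measurable_KS_Xvar m : measurable_fun setT (fun w => KS m (fun j =>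
  x j t w)).
Proof. by apply: (@measurable_KS _ _ _ m (fun j => x j t)) => j;
  exact: measurable_Xvar. Qed.

Let bKS m : bounded_moments P (fun N w => KS m (fun j => S j N w)).
Proof. exact: (@bounded_moments_KS _ _ _ _ m S). Qed.

Lemma KS_Xvar_has_all_moments m : has_all_moments P (fun w => KS m (fun j =>
  x j t w)).
Proof.
have [phi [_ _ ae]] := exists_grid_subsequence.
have [] // := @variation_limit _ (fun w => KS m (fun j => x j t w)) phi (bKS m)
  (measurable_KS_Xvar m).
by apply: filterS ae => w h; exact: (@cvg_KS _ m (fun k j => S j (phi k) w)).
Qed.

Lemma KS_Xvar_ortho a c : a != c ->
  \int[P]_w (KS a (fun j => x j t w) * KS c (fun j => x j t w)) = 0.
Proof.
move=> ac; have [phi [_ _ ae]] := exists_grid_subsequence.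
have [_ lim] := @variation_limit _
  (fun w => KS a (fun j => x j t w) * KS c (fun j => x j t w)) phi
  (bounded_momentsM (bKS a) (bKS c))
  (measurable_funM (measurable_KS_Xvar a) (measurable_KS_Xvar c))
  (filterS (fun w h => cvgM (@cvg_KS _ a (fun k j => S j (phi k) w) _ h)
     (@cvg_KS _ c (fun k j => S j (phi k) w) _ h)) ae).
apply: (cvg_unique (@Rhausdorff R) lim) => /=.
rewrite (_ : (fun k => _) = fun=> 0); first exact: cvg_cst.
apply/funext => k; under eq_Rintegral do rewrite !KS_power_sum.
exact: grid_esym_ortho.
Qed.

Lemma Expectation_KS_Xvar a : (0 < a)%N -> \int[P]_w KS a (fun j => x j t w) = 0.
Proof.
move=> a0; have := @KS_Xvar_ortho a 0; rewrite -lt0n => /(_ a0).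
by under eq_Rintegral do rewrite KS0 mulr1.
Qed.

Lemma Expectation_Xvar_KS j a : (0 < j)%N -> (0 < a)%N ->
  \int[P]_w (x j t w * KS a (fun j => x j t w)) =
  (a == 1%N)%:R * (t * kappa j.+1).
Proof.
move=> j0 a0; have [phi [_ cphi ae]] := exists_grid_subsequence.
have [_ lim] := @variation_limit _
  (fun w => x j t w * KS a (fun j => x j t w)) phi
  (bounded_momentsM (bS j0) (bKS a))
  (measurable_funM (measurable_Xvar j0) (measurable_KS_Xvar a))
  (filterS (fun w h => cvgM (h j j0)
     (@cvg_KS _ a (fun k j => S j (phi k) w) _ h)) ae).
apply: (cvg_unique (@Rhausdorff R) lim) => /=.
rewrite (_ : (fun k => _) = fun k => (a == 1%N)%:R *
    ((phi k)%:R * levy_moment X (t / (phi k)%:R) j.+1)).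
  apply: cvgM; first exact: cvg_cst.
  have := levy_moment_limit hX hmoments hnu hchar t0 (j0 : (2 <= j.+1)%N).
  exact: (cvg_comp _ _ cphi).
apply/funext => k; under eq_Rintegral do rewrite KS_power_sum.
exact: grid_power_sum_esym.
Qed.

End Variations.

(** * Algebra of the decomposition *)

Section KailathSegallAlgebra.
Context (R : realType).
Implicit Types x y : nat -> R.

Lemma eq_KS m x y : (forall j, (0 < j <= m)%N -> x j = y j) -> KS m x = KS m y.
Proof.
elim/ltn_ind: m => -[_ _|m IHm xy]; first by rewrite !KS0.
rewrite !KS_rec//; congr (_ * _).
rewrite !big_nat; apply: eq_bigr => j /andP[j0 jm].
rewrite xy ?j0//; congr (_ * _); apply: IHm; first by rewrite ltn_subrL j0.
by move=> i /andP[i0 im]; apply: xy; rewrite i0 (leq_trans im)// leq_subr.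
Qed.

(** P_(m+1) is affine in its last argument, which occurs only in the term of the recursion
    containing P_0 = 1. *)
Lemma KS_last m x y : (forall j, (0 < j <= m)%N -> x j = y j) ->
  KS m.+1 x - KS m.+1 y = (-1) ^+ m / m.+1%:R * (x m.+1 - y m.+1).
Proof.
move=> xy; rewrite !KS_rec// -mulrBr !(big_nat_recr m.+1)//= subnn !KS0 !mulr1.
have -> : \sum_(1 <= j < m.+1) (-1) ^+ j.+1 * x j * KS (m.+1 - j) x =
    \sum_(1 <= j < m.+1) (-1) ^+ j.+1 * y j * KS (m.+1 - j) y.
  rewrite !big_nat; apply: eq_bigr => j /andP[j0 jm].
  rewrite xy ?j0//; congr (_ * _); apply: eq_KS => i /andP[i0 im].
  apply: xy; rewrite i0 (leq_trans im)//.
  by case: j j0 {jm im} => // j _; rewrite subSS leq_subr.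
by rewrite !exprS; ring.
Qed.

Lemma LopE (q : {poly R}) (M : nat) x : (size q <= M)%N ->
  Lop q x = \sum_(i < M) q`_i * x i.+1.
Proof.
move=> qM; rewrite /Lop (big_ord_widen M (fun i => q`_i * x i.+1) qM) big_mkcond.
apply: eq_bigr => i _; case: ltnP => // iq.
by rewrite nth_default// mul0r.
Qed.

Lemma LopB (q : {poly R}) x y : Lop q (fun j => x j - y j) = Lop q x - Lop q y.
Proof. by rewrite /Lop -sumrB; apply: eq_bigr => i _; rewrite mulrBr. Qed.

Lemma Lop_lin (q r s : {poly R}) (b c : R) x :
  Lop (q + b *: r + c *: s) x = Lop q x + b * Lop r x + c * Lop s x.
Proof.
pose M := maxn (maxn (size q) (size r)) (size s).
have qM : (size q <= M)%N by rewrite /M !leq_max leqnn.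
have rM : (size r <= M)%N by rewrite /M !leq_max leqnn orbT.
have sM : (size s <= M)%N by rewrite /M !leq_max leqnn orbT.
have aM : (size (q + b *: r + c *: s)%R <= M)%N.
  rewrite (leq_trans (size_polyD _ _))// geq_max; apply/andP; split.
    rewrite (leq_trans (size_polyD _ _))// geq_max qM.
    by rewrite (leq_trans (size_scale_leq _ _)).
  by rewrite (leq_trans (size_scale_leq _ _)).
rewrite (LopE x qM) (LopE x rM) (LopE x sM) (LopE x aM) !mulr_sumr -!big_split/=.
by apply: eq_bigr => i _; rewrite !coefD !coefZ; ring.
Qed.

Lemma Lop_mulX (q : {poly R}) x :
  Lop ('X * q) x = \sum_(i < size q) q`_i * x i.+2.
Proof.
have sX : (size ('X * q)%R <= (size q).+1)%N.
  by rewrite (leq_trans (size_polyMleq _ _))// size_polyX.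
rewrite (LopE x sX) big_ord_recl coefXM/= mul0r add0r.
by apply: eq_bigr => i _; rewrite coefXM.
Qed.

(** [J] changes only the last argument, from x_(n+k) to u. Pairing the coefficients of q with the
    sums of a_j^(i+k) y_j gives the sum of q(a_j) a_j^k y_j, which is 0. As q is monic, x_(n+k) - u
    is then the sum of all q_i x_(i+k). *)
Lemma KS_J (k n : nat) (a : n.-tuple R) (q : {poly R}) x : (0 < k)%N ->
  uniq a -> 0 \notin (a : seq R) -> q \is monic -> size q = n.+1 ->
  (forall j, root q (tnth a j)) ->
  KS (n + k) x =
  (-1) ^+ (n + k).-1 / (n + k)%:R * \sum_(i < n.+1) q`_i * x (i + k)%N + J k a x.
Proof.
move=> k0 ua a0 qm sq qa; rewrite /J.
set y := power_solution k a x; pose u := \sum_j tnth a j ^+ (n + k) * y j 0.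
rewrite -/u.
have ya : forall i : 'I_n, x (i + k)%N = \sum_j tnth a j ^+ (i + k) * y j 0.
  exact/(@power_solutionP R k n a x y ua a0).
have nk : (n + k = (n + k).-1.+1)%N by rewrite prednK// addn_gt0 k0 orbT.
apply/eqP; rewrite -subr_eq; apply/eqP; rewrite [in LHS]nk KS_last; last first.
  by move=> j /andP[_ jnk]; rewrite -nk ltn_eqF// nk ltnS.
rewrite -nk eqxx; congr (_ * _).
rewrite big_ord_recr/=; have -> : q`_n = 1.
  by move/monicP: qm; rewrite lead_coefE sq.
rewrite mul1r addrC; congr (_ + _).
have : \sum_(i < n.+1) q`_i * (\sum_j tnth a j ^+ (i + k) * y j 0) = 0.
  under eq_bigr do rewrite mulr_sumr.
  rewrite exchange_big/= big1// => j _.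
  have /rootP := qa j; rewrite horner_coef sq => qj.
  transitivity ((\sum_(i < n.+1) q`_i * tnth a j ^+ i) * (tnth a j ^+ k * y j 0)).
    by rewrite mulr_suml; apply: eq_bigr => i _; rewrite exprD; ring.
  by rewrite qj mul0r.
rewrite big_ord_recr/= -/u; have -> : q`_n = 1.
  by move/monicP: qm; rewrite lead_coefE sq.
move=> /eqP; rewrite mul1r addr_eq0 => /eqP <-.
by apply: eq_bigr => i _; rewrite ya.
Qed.

End KailathSegallAlgebra.

(** * Integration with respect to the orthogonality measures *)

Section TeugelsIntegral.
Context (R : realType).
Variable nu : {measure set R -> \bar R}.
Local Open Scope ereal_scope.

Let msqr : measurable_fun setT (fun x : R => (x ^+ 2)%:E).
Proof. by apply/measurable_EFinP; exact: exprn_measurable. Qed.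

Lemma integral_teugels_nnsfun (g : {nnsfun R >-> R}) :
  \int[teugels_gamma nu]_x (g x)%:E = \int[nu]_x (g x * x ^+ 2)%:E.
Proof.
pose s := finmap.enum_fset (fset_set (range g)).
have gE x : (g x = \sum_(y <- s) y * \1_(g @^-1` [set y]) x)%R.
  by rewrite fimfunE fsbig_finite.
have mg y : measurable (g @^-1` [set y]) by exact: measurable_funPTI.
transitivity (\sum_(y <- s) y%:E * teugels_gamma nu (g @^-1` [set y])).
  by rewrite integralT_nnsfun sintegralE fsbig_finite.
under [RHS]eq_integral do rewrite gE mulr_suml -sumEFin.
rewrite [RHS]ge0_integral_sum//; last 2 first.
- move=> y; apply/measurable_EFinP; apply: measurable_funM;
  last exact: exprn_measurable.
  by apply: measurable_funM => //; exact: measurable_indic.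
- move=> y x _; rewrite lee_fin mulr_ge0 ?sqr_ge0// indicE.
  by case: (boolP (x \in _)) => [|_]; rewrite ?mulr0// inE => /= <-;
    rewrite mulr1.
rewrite !big_seq; apply: eq_bigr => y ys.
have y0 : (0 <= y)%R.
  by move: ys; rewrite in_fset_set// inE => -[x _ <-].
rewrite /teugels_gamma (integral_mkcond (g @^-1` [set y]))
  -ge0_integralZl_EFin//; last 2 first.
- by move=> x _; rewrite patchE; case: ifP => // _; rewrite lee_fin sqr_ge0.
- apply/(measurable_restrictT _ _).1 => //; exact: measurable_funTS.
apply: eq_integral => x _; rewrite patchE indicE.
by case: ifP => _; rewrite ?mulr1 ?mulr0 ?mul0r ?mule0// EFinM.
Qed.

Lemma ge0_integral_teugels (f : R -> R) : measurable_fun setT f ->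
  (forall x, 0 <= f x)%R ->
  \int[teugels_gamma nu]_x (f x)%:E = \int[nu]_x (f x * x ^+ 2)%:E.
Proof.
move=> mf f0.
have mef : measurable_fun setT (EFin \o f) by exact/measurable_EFinP.
pose g := nnsfun_approx measurableT mef.
have f0' x : [set: R] x -> 0 <= (EFin \o f) x by move=> _; rewrite lee_fin.
have gf x : (g n x)%:E @[n --> \oo] --> (f x)%:E.
  exact: (cvg_nnsfun_approx measurableT mef f0' (x := x) Logic.I).
have ndg x n m : (n <= m)%N -> (g n x <= g m x)%R.
  by move=> nm; have /lefP := nd_nnsfun_approx measurableT mef nm; exact.
have lim1 : \int[teugels_gamma nu]_x (g n x)%:E @[n --> \oo] -->
    \int[teugels_gamma nu]_x (f x)%:E.
  have := @cvg_monotone_convergence _ _ _ (teugels_gamma nu) setT measurableT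
    (fun n x => (g n x)%:E).
  under [X in _ -> _ -> _ -> _ --> X]eq_integral do rewrite (cvg_lim _ (gf _))//.
  apply => //.
  - by move=> n; apply/measurable_EFinP.
  - by move=> n x _; rewrite lee_fin.
  - by move=> x _ n m nm; rewrite lee_fin ndg.
have gf2 x : (g n x * x ^+ 2)%:E @[n --> \oo] --> (f x * x ^+ 2)%:E.
  apply: cvg_EFin; first exact: nearW.
  apply: cvgM; last exact: cvg_cst.
  exact: (fine_cvg (gf x)).
have lim2 : \int[nu]_x (g n x * x ^+ 2)%:E @[n --> \oo] -->
    \int[nu]_x (f x * x ^+ 2)%:E.
  have := @cvg_monotone_convergence _ _ _ nu setT measurableT
    (fun n x => (g n x * x ^+ 2)%:E).
  under [X in _ -> _ -> _ -> _ --> X]eq_integral do rewrite (cvg_lim _ (gf2 _))//.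
  apply => //.
  - by move=> n; apply/measurable_EFinP; apply: measurable_funM.
  - by move=> n x _; rewrite lee_fin mulr_ge0// sqr_ge0.
  - by move=> x _ n m nm; rewrite lee_fin ler_wpM2r ?sqr_ge0// ndg.
apply: (cvg_unique _ lim1) => //=.
by under eq_fun do rewrite integral_teugels_nnsfun.
Qed.

Lemma ge0_integral_teugels_sigma (sigma : R) (f : R -> R) :
  measurable_fun setT f -> (forall x, 0 <= f x)%R ->
  \int[teugels_gamma_sigma sigma nu]_x (f x)%:E =
  (sigma ^+ 2 * f 0%R)%:E + \int[nu]_x (f x * x ^+ 2)%:E.
Proof.
move=> mf f0; have mef : measurable_fun setT (EFin \o f) by
  exact/measurable_EFinP.
rewrite /teugels_gamma_sigma ge0_integral_measure_add//; last first.
  by move=> x _; rewrite lee_fin.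
rewrite ge0_integral_mscale//; last by move=> x _; rewrite lee_fin.
rewrite integral_dirac// diracT mul1e ge0_integral_teugels//.
Qed.

(* The hypothesis on [mu] says that mu(dx) = c delta_0(dx) + x^2 nu(dx). *)
Lemma integral_weighted (mu : {measure set R -> \bar R}) (c : R) :
  (forall f : R -> R, measurable_fun setT f -> (forall x, 0 <= f x)%R ->
    \int[mu]_x (f x)%:E = (c * f 0%R)%:E + \int[nu]_x (f x * x ^+ 2)%:E) ->
  forall f : R -> R, measurable_fun setT f ->
  nu.-integrable setT (fun x => (f x * x ^+ 2)%:E) ->
  \int[mu]_x (f x)%:E = (c * f 0%R + \int[nu]_x (f x * x ^+ 2))%R%:E.
Proof.
move=> H f mf iff.
pose fp (x : R) := Num.max (f x) 0%R; pose fn (x : R) := Num.max (- f x)%R 0%R.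
have fp0 x : (0 <= fp x)%R by rewrite le_max lexx orbT.
have fn0 x : (0 <= fn x)%R by rewrite le_max lexx orbT.
have mfp : measurable_fun setT fp by apply: measurable_maxr.
have mfn : measurable_fun setT fn.
  by apply: measurable_maxr => //; exact: measurableT_comp.
have fpn x : (f x = fp x - fn x)%R.
  by rewrite /fp /fn; case: leP => h1; case: leP => h2; lra.
have le_p x : (fp x <= `|f x|)%R by rewrite /fp ge_max ler_norm normr_ge0.
have le_n x : (fn x <= `|f x|)%R.
  by rewrite /fn ge_max -normrN ler_norm normr_ge0.
have ip (h : R -> R) : measurable_fun setT h -> (forall x, 0 <= h x)%R ->
    (forall x, h x <= `|f x|)%R -> nu.-integrable setT (fun x =>
      (h x * x ^+ 2)%:E).
  move=> mh h0 hf; apply: le_integrable iff => //.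
    apply/measurable_EFinP; apply: measurable_funM => //; exact: exprn_measurable.
  by move=> x _; rewrite lee_fin !normrM ler_wpM2r// (ger0_norm (h0 x)).
have ifp := ip fp mfp fp0 le_p; have ifn := ip fn mfn fn0 le_n.
rewrite integralE.
under eq_integral do rewrite funeposE -EFin_max.
under [X in _ - X]eq_integral do rewrite funenegE -EFinN -EFin_max.
rewrite (H fp mfp fp0) (H fn mfn fn0).
have -> : (\int[nu]_x (f x * x ^+ 2) =
    \int[nu]_x (fp x * x ^+ 2) - \int[nu]_x (fn x * x ^+ 2))%R.
  by rewrite -RintegralB//; apply: eq_Rintegral => x _; rewrite fpn mulrBl.
rewrite /Rintegral.
move: (integrable_fin_num measurableT ifp) (integrable_fin_num measurableT ifn).
case: (\int[nu]_x (fp x * x ^+ 2)%:E) => // rp _.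
case: (\int[nu]_x (fn x * x ^+ 2)%:E) => // rn _ /=.
by rewrite -!EFinD; congr (_%:E); rewrite (fpn 0%R); ring.
Qed.

End TeugelsIntegral.

Section PolynomialIntegrals.
Context (R : realType).

Lemma Rintegral_sum d (T : measurableType d) (mu : {measure set T -> \bar R})
    (I : Type) (s : seq I) (F : I -> T -> R) :
  (forall i, mu.-integrable setT (EFin \o F i)) ->
  mu.-integrable setT (EFin \o (fun x => \sum_(i <- s) F i x)) /\
  \int[mu]_x (\sum_(i <- s) F i x) = \sum_(i <- s) \int[mu]_x F i x.
Proof.
move=> iF; elim: s => [|i s [IHi IHs]].
  rewrite big_nil; split.
    rewrite (_ : _ \o _ = cst 0%E); first exact: integrable0.
    by apply/funext => x /=; rewrite big_nil.
  under eq_Rintegral do rewrite big_nil.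
  by rewrite /Rintegral integral0.
have E : (fun x => \sum_(j <- i :: s) F j x) = fun x =>
  F i x + \sum_(j <- s) F j x.
  by apply/funext => x; rewrite big_cons.
rewrite E big_cons -IHs; split; last by rewrite RintegralD.
exact: (integrableD measurableT (iF i) IHi).
Qed.

Variables (sigma : R) (nu : {measure set R -> \bar R}).
Hypothesis inu : forall k, (2 <= k)%N -> nu.-integrable setT (EFin \o (fun x =>
  x ^+ k)).
Local Notation kappa := (levy_cumulant sigma nu).

Let hornerX2 (q : {poly R}) x : q.[x] * x ^+ 2 = \sum_(i < size q) q`_i * x ^+
  i.+2.
Proof.
rewrite horner_coef mulr_suml; apply: eq_bigr => i _.
by rewrite -mulrA -exprD addn2.
Qed.

Lemma integrable_hornerX2 (q : {poly R}) :
  nu.-integrable setT (EFin \o (fun x => q.[x] * x ^+ 2)).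
Proof.
under eq_fun do rewrite hornerX2.
have [] // := @Rintegral_sum _ _ nu _ (index_enum 'I_(size q))
  (fun i x => q`_i * x ^+ i.+2).
by move=> i; exact: (integrableZl measurableT _ (inu (isT : (2 <= i.+2)%N))).
Qed.

Lemma Rintegral_hornerX2 (q : {poly R}) :
  \int[nu]_x (q.[x] * x ^+ 2) = \sum_(i < size q) q`_i * \int[nu]_x (x ^+ i.+2).
Proof.
under eq_Rintegral do rewrite hornerX2.
have [|_ ->] := @Rintegral_sum _ _ nu _ (index_enum 'I_(size q))
  (fun i x => q`_i * x ^+ i.+2).
  by move=> i; exact: (integrableZl measurableT _ (inu (isT : (2 <= i.+2)%N))).
by apply: eq_bigr => i _; rewrite RintegralZl//; exact: inu.
Qed.

Lemma cumulant_poly (q : {poly R}) :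
  \sum_(i < size q) q`_i * kappa i.+2 =
  sigma ^+ 2 * q.[0] + \int[nu]_x (q.[x] * x ^+ 2).
Proof.
rewrite Rintegral_hornerX2 horner_coef mulr_sumr -big_split/=.
by apply: eq_bigr => i _; rewrite /levy_cumulant expr0n/= mulrDr; ring.
Qed.

(** Orthogonality is tested on the constant 1, and the moment of order i of [mu] is the cumulant of
    order i + 2. Leaving [mu] abstract covers both orthogonality measures. *)
Lemma cumulant_orthogonal (mu : {measure set R ->
  \bar R}) (m : nat) (q : {poly R}) :
  (forall f : R -> R, measurable_fun setT f -> (forall x, 0 <= f x)%R ->
    \int[mu]_x (f x)%:E = (sigma ^+ 2 * f 0%R)%:E + \int[nu]_x (f x * x ^+
      2)%:E)%E ->
  (1 <= m)%N -> monic_orthogonal mu m q ->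
  \sum_(i < size q) q`_i * kappa i.+2 = 0.
Proof.
move=> Hmu m1 [_ _ /(_ 1)]; rewrite size_poly1 => /(_ m1).
under eq_integral do rewrite hornerC mulr1.
rewrite (integral_weighted Hmu); last 2 first.
- apply: continuous_measurable_fun; exact: continuous_horner.
- exact: integrable_hornerX2.
by rewrite cumulant_poly => /(congr1 fine).
Qed.

End PolynomialIntegrals.

(** * Orthogonality of first-order terms to the Kailath-Segall polynomials *)

Section Chaos.
Context d (T : measurableType d) (R : realType) (P : probability T R).
Variables (X Q : R -> {RV P >-> R}) (sigma : R) (nu : {measure set R ->
  \bar R}) (b : R).
Hypotheses (hX : levy_process X) (hmoments : all_moments X)
  (hcentered : centered X) (hQ : is_quadratic_variation X Q).
Hypothesis hnu : levy_measure nu.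
Hypothesis hchar : forall t u : R, 0 <= t ->
    let re := levy_exponent_re sigma nu u in
    let im := levy_exponent_im b nu u in
    ('E_P[fun w => cos (u * X t w)] = (expR (t * re) * cos (t * im))%:E)%E /\
    ('E_P[fun w => sin (u * X t w)] = (expR (t * re) * sin (t * im))%:E)%E.
Variable t : R.
Hypothesis t0 : 0 <= t.
Local Notation x := (fun w j => Xvar X Q j t w).
Local Notation Y := (fun w j => Yvar X Q j t w).
Local Notation kappa := (levy_cumulant sigma nu).

Lemma YvarE w j : Y w j = x w j - \int[P]_w x w j.
Proof. by rewrite /Yvar unlock. Qed.

Lemma Yvar_has_all_moments j : (0 < j)%N -> has_all_moments P (Yvar X Q j t).
Proof.
move=> j0; rewrite (_ : Yvar X Q j t = fun w => x w j + (- \int[P]_w x w j)).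
  apply: has_all_momentsD; last exact: has_all_moments_cst.
  exact: (Xvar_has_all_moments hX hmoments hQ t0 j0).
by apply/funext => w; rewrite YvarE.
Qed.

Lemma Lop_Yvar_has_all_moments (q : {poly R}) : has_all_moments P (fun w =>
  Lop q (Y w)).
Proof.
apply: has_all_moments_sum => i _; apply: has_all_momentsZ.
exact: Yvar_has_all_moments.
Qed.

(** The centering constants drop out because P_k has mean 0. The remaining pairings vanish for k >=
    2, and for k = 1 they add up to t times the sum assumed to be 0. *)
Lemma Lop_Yvar_KS (q : {poly R}) k : (0 < k)%N ->
  \sum_(i < size q) q`_i * kappa i.+2 = 0 ->
  \int[P]_w (Lop q (Y w) * KS k (x w)) = 0.
Proof.
move=> k0 q0; have mKS := KS_Xvar_has_all_moments hX hmoments hQ t0 k.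
under eq_Rintegral do rewrite mulr_suml.
rewrite Expectation_sum; last first.
  move=> i _; apply: has_all_momentsM => //; apply: has_all_momentsZ.
  exact: Yvar_has_all_moments.
transitivity ((k == 1%N)%:R * t * \sum_(i < size q) q`_i * kappa i.+2);
  last first.
  by rewrite q0 mulr0.
rewrite mulr_sumr; apply: eq_bigr => i _.
have mx := Xvar_has_all_moments hX hmoments hQ t0 (isT : (0 < i.+1)%N).
set c := \int[P]_w x w i.+1.
have E w : q`_i * Y w i.+1 * KS k (x w) =
    q`_i * (x w i.+1 * KS k (x w)) + (- q`_i * c) * KS k (x w).
  by rewrite YvarE -/c; ring.
under eq_Rintegral do rewrite E.
rewrite ExpectationD; last 2 first.
- by apply: has_all_momentsZ; exact: has_all_momentsM.
- exact: has_all_momentsZ.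
rewrite !ExpectationZ//; last exact: has_all_momentsM.
rewrite (Expectation_KS_Xvar hX hmoments hcentered hQ t0 k0).
rewrite (Expectation_Xvar_KS hX hmoments hcentered hQ hnu hchar t0 (isT : (0 <
  i.+1)%N) k0).
by ring.
Qed.

Lemma Lop_YvarE (q : {poly R}) w :
  Lop q (Y w) = Lop q (x w) - Lop q (fun j => \int[P]_w x w j).
Proof.
by rewrite -LopB; apply: eq_bigr => i _; rewrite YvarE.
Qed.

(* The part of the decomposition left after removing the first-order chaos is
   [KS m] minus an element of the first chaos, hence orthogonal to [KS k]. *)
Lemma L2_orthogonal_remainder (m k : nat) (c : R) (G U : T -> R) :
  (0 < k)%N -> m != k -> has_all_moments P G ->
  \int[P]_w (G w * KS k (x w)) = 0 ->
  (forall w, U w = KS m (x w) + c * G w) ->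
  L2_orthogonal P U (fun w => KS k (x w)).
Proof.
move=> k0 mk mG GK UE.
have mKS j := KS_Xvar_has_all_moments hX hmoments hQ t0 j.
have mU : has_all_moments P U.
  by rewrite (funext UE); apply: has_all_momentsD => //; exact: has_all_momentsZ.
split; [exact: has_all_moments_Lfun|exact: has_all_moments_Lfun|].
have mUK := has_all_momentsM mU (mKS k).
have ifin := integrable_fin_num measurableT (has_all_moments_integrable mUK).
rewrite unlock -[LHS]fineK//; congr (_%:E).
rewrite -[LHS]/(\int[P]_w (U w * KS k (x w))).
under eq_Rintegral do rewrite UE mulrDl -mulrA.
rewrite ExpectationD; last 2 first.
- exact: has_all_momentsM.
- by apply: has_all_momentsZ; exact: has_all_momentsM.
rewrite ExpectationZ; last exact: has_all_momentsM.
by rewrite (KS_Xvar_ortho hX hmoments hcentered hQ t0 mk) GK mulr0 addr0.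
Qed.

End Chaos.

Theorem theorem4p9 (d : measure_display) (T : measurableType d) (R : realType)
    (P : probability T R)
    (X Q : R -> {RV P >-> R}) (sigma : R) (nu : {measure set R -> \bar R})
    (hX : levy_process X) (hcentered : centered X) (hmoments : all_moments X)
    (hsigma : 0 <= sigma) (hchar : levy_characteristics X sigma nu)
    (hQ : is_quadratic_variation X Q)
    (n : nat) (hn : (1 <= n)%N) (hsupp : has_n_points n (measure_support nu))
    (p ps : nat -> {poly R})
    (hp : forall m, (m <= n)%N -> monic_orthogonal (teugels_gamma nu) m (p m))
    (hps : 0 < sigma ->
       forall m, (m <= n.+1)%N ->
         monic_orthogonal (teugels_gamma_sigma sigma nu) m (ps m))
    (hp0 : ~~ root (p n) 0)
    (a : n.-tuple R) (ha_uniq : uniq a)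
    (ha_roots : forall x : R, (x \in (a : seq R)) = root (p n) x)
    (t : R) (ht : 0 <= t) :
  let x (w : T) (j : nat) : R := Xvar X Q j t w in
  let H (m : nat) (w : T) : R := Hvar X Q sigma p ps m t w in
  (sigma = 0 ->
    let C := C_const (p n) nu in
    {ae P, forall w : T,
      KS n.+1 (x w) =
        (-1) ^+ n / n.+1%:R * H n.+1 w
        + J 1 a (x w)
        + (-1) ^+ n / n.+1%:R * C * t} /\
    forall k, (1 <= k <= n)%N ->
      L2_orthogonal P
        (fun w => J 1 a (x w) + (-1) ^+ n / n.+1%:R * C * t)
        (fun w => KS k (x w)))
  /\
  (0 < sigma ->
    forall lambda_n lambda_n1 : R,
    ps n.+1 = 'X * p n - lambda_n *: ps n - lambda_n1 *: ps n.-1 ->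
    let D := D_const (p n) sigma nu in
    {ae P, forall w : T,
      KS n.+2 (x w) =
        (-1) ^+ n.+1 / n.+2%:R
          * (H n.+2 w + lambda_n * H n.+1 w + lambda_n1 * H n w)
        + J 2 a (x w)
        + (-1) ^+ n.+1 / n.+2%:R * D * t} /\
    forall k, (1 <= k <= n.-1)%N ->
      L2_orthogonal P
        (fun w => J 2 a (x w) + (-1) ^+ n.+1 / n.+2%:R * D * t)
        (fun w => KS k (x w))).
Proof.
move=> x H; case: hchar => hnu [b hb].
have inu := integrable_levy_power hX hmoments hnu hb.
have [pmonic psize _] := hp n (leqnn n).
have a0 : 0 \notin (a : seq R) by rewrite ha_roots.
have ar j : root (p n) (tnth a j) by rewrite -ha_roots mem_tnth.
have Ex j : (2 <= j)%N -> \int[P]_w x w j = t * levy_cumulant sigma nu j.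
  by move=> j2; exact: (Expectation_Xvar hX hmoments hQ hnu hb ht j2).
(* Order 1 is separate: its mean is 0 by centering, so the constant coefficient of p_n leaves no
   trace in C. *)
have Ex1 : \int[P]_w x w 1%N = 0 by exact: (Expectation_Xvar1 Q hcentered ht).
split=> [sigma0 C|sigma0 lam lam1 psE D].
- have HE w : H n.+1 w = Lop (p n) (fun j => Yvar X Q j t w).
    by rewrite /H /Hvar sigma0 ltxx.
  have LC : Lop (p n) (fun j => \int[P]_w x w j) = C * t.
    (* The quotient of p_n - p_n(0) by x: the integrand of C is r(x) x^2, a combination of powers of
       order at least 2, integrable under [nu]. *)
    pose r : {poly R} := \poly_(i < n) (p n)`_i.+1.
    have rE y : y * ((p n).[y] - (p n).[0]) = r.[y] * y ^+ 2.
      rewrite horner_coef psize big_ord_recl/= mulr1 -horner_coef0 addrAC subrr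
        add0r.
      rewrite horner_poly mulr_sumr mulr_suml; apply: eq_bigr => i _.
      by rewrite /bump/= add1n exprS; ring.
    rewrite /C /C_const; under eq_Rintegral do rewrite rE.
    have := cumulant_poly sigma inu r; rewrite sigma0 expr0n/= mul0r add0r => <-.
    have -> : \sum_(i < size r) r`_i * levy_cumulant 0 nu i.+2 =
        \sum_(i < n) r`_i * levy_cumulant 0 nu i.+2.
      rewrite (big_ord_widen n (fun i => r`_i * levy_cumulant 0 nu i.+2))
        ?size_poly//.
      rewrite big_mkcond; apply: eq_bigr => i _; case: ltnP => // ir.
      by rewrite nth_default// mul0r.
    rewrite /Lop psize big_ord_recl Ex1 mulr0 add0r mulr_suml;
      apply: eq_bigr => i _.
    by rewrite lift0 Ex// sigma0 coef_poly ltn_ord; ring.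
  have main w : KS n.+1 (x w) = (-1) ^+ n / n.+1%:R * H n.+1 w + J 1 a (x w)
        + (-1) ^+ n / n.+1%:R * C * t.
    have := @KS_J R 1 n a (p n) (x w) isT ha_uniq a0 pmonic psize ar.
    rewrite addn1 /= => ->.
    have -> : \sum_(i < n.+1) (p n)`_i * x w (i + 1)%N = H n.+1 w + C * t.
      rewrite HE (Lop_YvarE (P := P)) LC subrK /Lop psize.
      by apply: eq_bigr => i _; rewrite addn1.
    by ring.
  split; first exact: aeW.
  move=> k /andP[k1 kn].
  (* Since n >= 1, p_n is orthogonal to 1, which settles the case k = 1. *)
  have q0 : \sum_(i < size (p n)) (p n)`_i * levy_cumulant sigma nu i.+2 = 0.
    apply: (cumulant_orthogonal inu _ hn (hp n (leqnn n))) => f mf f0.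
    by rewrite sigma0 expr0n/= mul0r add0e ge0_integral_teugels.
  apply: (@L2_orthogonal_remainder _ _ _ P X Q hX hmoments hcentered hQ t ht
    n.+1 k
     (- ((-1) ^+ n / n.+1%:R)) (fun w => Lop (p n) (fun j =>
       Yvar X Q j t w))) => //.
  + by rewrite gtn_eqF.
  + exact: Lop_Yvar_has_all_moments.
  + exact: (Lop_Yvar_KS hX hmoments hcentered hQ hnu hb ht k1 q0).
  + by move=> w; rewrite main HE; ring.
- pose q : {poly R} := 'X * p n.
  have HE m w : H m.+1 w = Lop (ps m) (fun j => Yvar X Q j t w).
    by rewrite /H /Hvar sigma0.
  (* The recurrence read backwards: the bracket of the three H's is L applied to x p_n, which is the
     form that [KS_J] produces for k = 2. *)
  have qE : q = ps n.+1 + lam *: ps n + lam1 *: ps n.-1 by rewrite psE /q; ring.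
  have HQ w : H n.+2 w + lam * H n.+1 w + lam1 * H n w =
      Lop q (fun j => Yvar X Q j t w).
    rewrite qE Lop_lin !HE; congr (_ + _ * _).
    by rewrite -HE prednK.
  (* The factor x shifts all arguments to order at least 2, where each mean is t times a cumulant;
     hence the whole of p_n appears in D. *)
  have LD : Lop q (fun j => \int[P]_w x w j) = D * t.
    rewrite Lop_mulX /D /D_const.
    have -> : \int[nu]_x0 (x0 ^+ 2 * (p n).[x0]) = \int[nu]_y ((p n).[y] * y ^+
      2).
      by apply: eq_Rintegral => y _; rewrite mulrC.
    rewrite -(cumulant_poly sigma inu) mulr_suml; apply: eq_bigr => i _.
    by rewrite Ex//; ring.
  have main w : KS n.+2 (x w) = (-1) ^+ n.+1 / n.+2%:R *
          (H n.+2 w + lam * H n.+1 w + lam1 * H n w)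
        + J 2 a (x w) + (-1) ^+ n.+1 / n.+2%:R * D * t.
    have := @KS_J R 2 n a (p n) (x w) isT ha_uniq a0 pmonic psize ar.
    rewrite addn2 /= => ->.
    have -> : \sum_(i < n.+1) (p n)`_i * x w (i + 2)%N =
        H n.+2 w + lam * H n.+1 w + lam1 * H n w + D * t.
      rewrite HQ (Lop_YvarE (P := P)) LD subrK Lop_mulX psize.
      by apply: eq_bigr => i _; rewrite addn2.
    by ring.
  split; first exact: aeW.
  move=> k /andP[k1 kn].
  (* A k in the range forces n >= 2. Then p_(n-1)^sigma also has positive degree and is orthogonal
     to 1, so all three H's are orthogonal to P_k. *)
  have n1 : (1 <= n.-1)%N by exact: leq_trans kn.
  have q0 m : (1 <= m <= n.+1)%N ->
      \sum_(i < size (ps m)) (ps m)`_i * levy_cumulant sigma nu i.+2 = 0.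
    move=> /andP[m1 mn].
    apply: (cumulant_orthogonal inu _ m1 (hps sigma0 m mn)) => f mf f0.
    exact: ge0_integral_teugels_sigma.
  have HK m : (1 <= m <= n.+1)%N ->
      \int[P]_w (Lop (ps m) (fun j => Yvar X Q j t w) * KS k (x w)) = 0.
    by move=> /q0; exact: (Lop_Yvar_KS hX hmoments hcentered hQ hnu hb ht k1).
  have mL r := Lop_Yvar_has_all_moments hX hmoments hQ ht r.
  have mKS := KS_Xvar_has_all_moments hX hmoments hQ ht k.
  have nn : (n.-1 <= n)%N by exact: leq_pred.
  apply: (@L2_orthogonal_remainder _ _ _ P X Q hX hmoments hcentered hQ t ht
    n.+2 k
     (- ((-1) ^+ n.+1 / n.+2%:R)) (fun w => Lop q (fun j =>
       Yvar X Q j t w))) => //.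
  + by rewrite gtn_eqF// (leq_ltn_trans kn)// (leq_ltn_trans nn).
  + under eq_Rintegral do rewrite qE Lop_lin !mulrDl -!mulrA.
    rewrite !ExpectationD; do ?[by apply: has_all_momentsD;
      [|apply: has_all_momentsZ]; exact: has_all_momentsM
      | by apply: has_all_momentsZ; exact: has_all_momentsM | exact:
        has_all_momentsM].
    rewrite !ExpectationZ; [|exact: has_all_momentsM..].
    rewrite !HK ?mulr0 ?addr0//.
    * by rewrite n1 (leq_trans nn).
    * by rewrite hn leqnSn.
    * by rewrite /= leqnn.
  + by move=> w; rewrite main HQ; ring.
Qed.
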